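(* Let $w_0\in L^2(-1,1)$. For $\varepsilon>0$ let $J^\varepsilon(x)=\frac1{\varepsilon^3}J\left(\frac x\varepsilon\right)$, and let $w^\varepsilon=(u^\varepsilon,v^\varepsilon)$ be the solution, with initial condition $w^\varepsilon(\cdot,0)=w_0$, of $$\begin{cases}\dfrac{\partial u^\varepsilon}{\partial t}(x,t)=\dfrac{\partial^2 u^\varepsilon}{\partial x^2}(x,t), & x\in(-1,0),\ t>0,\\[4pt] \dfrac{\partial u^\varepsilon}{\partial x}(-1,t)=0, & t>0,\\[4pt] \dfrac{\partial u^\varepsilon}{\partial x}(0,t)=C_{J,2}\displaystyle\int_{-1}^0\int_0^1 J^\varepsilon(x-y)\,(v^\varepsilon(y,t)-u^\varepsilon(0,t))\,dy\,dx, & t>0,\\[4pt] \dfrac{\partial v^\varepsilon}{\partial t}(x,t)=C_{J,1}\displaystyle\int_0^1 J^\varepsilon(x-y)(v^\varepsilon(y,t)-v^\varepsilon(x,t))\,dy-C_{J,2}\int_{-1}^0 J^\varepsilon(x-y)\,dy\,(v^\varepsilon(x,t)-u^\varepsilon(0,t)), & x\in(0,1),\ t>0,\end{cases}$$ where $C_{J,1}=\dfrac{2}{M(J)}$, $M(J)=\int_{\mathbb R}J(z)|z|^2\,dz$, and $C_{J,2}=1$. Let $w$ be the solution of the heat equation with homogeneous Neumann boundary conditions $$\begin{cases}\dfrac{\partial w}{\partial t}(x,t)=\dfrac{\partial^2w}{\partial x^2}(x,t), & x\in(-1,1),\ t>0,\\[4pt] \dfrac{\partial w}{\partial x}(-1,t)=\dfrac{\partial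 w}{\partial x}(1,t)=0,& t>0,\\[4pt] w(x,0)=w_0(x),& x\in(-1,1).\end{cases}$$ Then, for every finite $T>0$, $$\lim_{\varepsilon\to0}\Big(\max_{t\in[0,T]}\|w^\varepsilon(\cdot,t)-w(\cdot,t)\|_{L^2(-1,1)}\Big)=0.$$
   Context: The kernel $J:\mathbb R\to[0,\infty)$ is continuous, symmetric ($J(-z)=J(z)$), compactly supported with $\mathrm{supp}(J)=[-R,R]$ for some $R>0$, and $\int_{\mathbb R}J(z)\,dz=1$. A function $w\in L^2(-1,1)$ is identified with the pair $(u,v)$, where $u=w|_{(-1,0)}$ and $v=w|_{(0,1)}$. For $u\in H^1(-1,0)$, $u(0)$ denotes the value at $0$ of its continuous representative on $[-1,0]$. ''Solution'' means mild solution. For the local/nonlocal problem: let $B_\varepsilon$ be the operator in $L^2(-1,1)$ with domain $$D(B_\varepsilon)=\Big\{(u,v): u\in H^2(-1,0),\ v\in L^2(0,1),\ u'(-1)=0,\ u'(0)=C_{J,2}\int_{-1}^0\int_0^1J^\varepsilon(x-y)(v(y)-u(0))\,dy\,dx\Big\},$$ given by $B_\varepsilon(u,v)(x)=-u''(x)$ for $x\in(-1,0)$ and $B_\varepsilon(u,v)(x)=-C_{J,1}\int_0^1J^\varepsilon(x-y)(v(y)-v(x))\,dy+C_{J,2}\int_{-1}^0J^\varepsilon(x-y)\,dy\,(v(x)-u(0))$ for $x\in(0,1)$. For the heat equation: let $A w=-w''$ with $D(A)=\{w\in H^2(-1,1): w'(-1)=w'(1)=0\}$. For $\mathcal A\in\{B_\varepsilon,A\}$,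 the mild solution with initial datum $w_0$ is the (unique) $w\in C([0,\infty);L^2(-1,1))$ with $w(0)=w_0$ that solves $w'(t)+\mathcal Aw(t)=0$ in the usual sense of accretive operators: for every $T>0$ and $\delta>0$ there are $0=t_0<t_1<\dots<t_N=T$ with $t_i-t_{i-1}\le\delta$, and $w_{(0)}\in L^2(-1,1)$, $w_{(1)},\dots,w_{(N)}\in D(\mathcal A)$, such that $\frac{w_{(i)}-w_{(i-1)}}{t_i-t_{i-1}}+\mathcal Aw_{(i)}=0$ for $i=1,\dots,N$, $\|w_{(0)}-w_0\|_{L^2}\le\delta$, and $\|w(t)-w_{(i)}\|_{L^2}\le\delta$ for $t\in(t_{i-1},t_i]$. *)

(* Defs.v *)
From HB Require Import structures.
From mathcomp Require Import all_boot all_order all_algebra.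
From mathcomp Require Import all_classical all_reals all_analysis.

Set Implicit Arguments.
Unset Strict Implicit.
Unset Printing Implicit Defensive.
Import Order.TTheory GRing.Theory Num.Theory.
Import numFieldNormedType.Exports.
Local Open Scope classical_set_scope.
Local Open Scope ring_scope.

Section FunctionSpaces.
Context {R : realType}.
Local Notation mu := (@lebesgue_measure R).
Implicit Types (a b : R) (u g c phi : R -> R).

(* Elements of L^2(a, b) are represented by total functions R -> R, of which
   only the restriction to ]a, b[ matters: f \_ D is the extension by zero of
   the restriction of f to D.  Accordingly a function on (-1, 1) also represents
   its restrictions to (-1, 0) and (0, 1). *)
Definition L2 a b : set (R -> R) :=
  [set f | f \_ `]a, b[ \in Lfun mu 2%:E].

Definition L2norm a b (f : R -> R) : \bar R :=
  'N[mu]_2%:E[EFin \o (f \_ `]a, b[)].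

Definition test_function a b : set (R -> R) :=
  [set phi : R -> R | (forall n x, derivable (phi^`(n))%classic x 1) /\
     exists c d : R, [/\ a < c, d < b &
       forall x, ~ `[c, d]%classic x -> phi x = 0]].

Definition is_weak_derivative a b u g :=
  forall phi, test_function a b phi ->
    \int[mu]_(x in `]a, b[) (u x * (phi^`())%classic x) =
    - \int[mu]_(x in `]a, b[) (g x * phi x).

Definition H1 a b : set (R -> R) :=
  [set u | L2 a b u /\ exists g, L2 a b g /\ is_weak_derivative a b u g].

(* Unique up to equality almost everywhere on ]a, b[ when u is in H1 a b. *)
Definition weak_derivative a b u : R -> R :=
  xget (cst 0) [set g | L2 a b g /\ is_weak_derivative a b u g].

Definition H2 a b : set (R -> R) :=
  [set u | H1 a b u /\ H1 a b (weak_derivative a b u)].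

(* Unique on `[a, b] when it exists, in particular when u is in H1 a b. *)
Definition continuous_representative a b u : R -> R :=
  xget (cst 0) [set c | {within `[a, b], continuous c} /\
    c = u %[ae mu in `]a, b[%classic]].

End FunctionSpaces.

Section MildSolutions.
Context {R : realType}.
Local Notation mu := (@lebesgue_measure R).

(* An operator in L^2(-1, 1) is given by its domain D and a function A whose
   values are only relevant on D. *)
Definition mild_solution (D : set (R -> R)) (A : (R -> R) -> R -> R)
    (w0 : R -> R) (w : R -> R -> R) : Prop :=
  [/\ forall t, 0 <= t -> L2 (-1) 1 (w t),
      forall t, 0 <= t ->
        L2norm (-1) 1 (w s \- w t) @[s --> within `[0, +oo[ (nbhs t)] --> 0%E,
      w 0 = w0 %[ae mu in `]-1, 1[%classic] &
      forall T delta : R, 0 < T -> 0 < delta ->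
        exists (N : nat) (t : nat -> R) (W : nat -> R -> R),
        [/\ t 0%N = 0 /\ t N = T,
            forall i, (i < N)%N -> t i < t i.+1 /\ t i.+1 - t i <= delta,
            L2 (-1) 1 (W 0%N) /\ (L2norm (-1) 1 (W 0%N \- w0)%R <= delta%:E)%E,
            forall i, (i < N)%N -> D (W i.+1) /\
              {ae mu, forall x, `]-1, 1[%classic x ->
                (W i.+1 x - W i x) / (t i.+1 - t i) + A (W i.+1) x = 0} &
            forall i s, (i < N)%N -> t i < s <= t i.+1 ->
              (L2norm (-1) 1 (w s \- W i.+1)%R <= delta%:E)%E]].

End MildSolutions.

Section Operators.
Context {R : realType}.
Local Notation mu := (@lebesgue_measure R).
Implicit Types (J w : R -> R) (eps : R).

Definition second_moment J : R := \int[mu]_z (J z * `|z| ^+ 2).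

Definition rescale J eps : R -> R := fun x => (eps ^+ 3)^-1 * J (x / eps).

(* The value u(0) of u = w|_(-1,0). *)
Definition trace0 w : R := continuous_representative (-1) 0 w 0.

Definition dom_B J (C2 : R) eps : set (R -> R) :=
  [set w | let u' := continuous_representative (-1) 0
                       (weak_derivative (-1) 0 w) in
    [/\ H2 (-1) 0 w, L2 0 1 w, u' (-1) = 0 &
        u' 0 = C2 * \int[mu]_(x in `]-1, 0[) \int[mu]_(y in `]0, 1[)
                 (rescale J eps (x - y) * (w y - trace0 w))]].

Definition op_B J (C1 C2 : R) eps w : R -> R := fun x =>
  if x < 0 then - weak_derivative (-1) 0 (weak_derivative (-1) 0 w) x
  else - C1 * \int[mu]_(y in `]0, 1[) (rescale J eps (x - y) * (w y - w x))
       + C2 * (\int[mu]_(y in `]-1, 0[) rescale J eps (x - y))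
            * (w x - trace0 w).

Definition dom_A : set (R -> R) :=
  [set w | let w' := continuous_representative (-1) 1
                       (weak_derivative (-1) 1 w) in
    [/\ H2 (-1) 1 w, w' (-1) = 0 & w' 1 = 0]].

Definition op_A w : R -> R := fun x =>
  - weak_derivative (-1) 1 (weak_derivative (-1) 1 w) x.

End Operators.

Definition is_max {R : realType} (S : set (\bar R)) (m : \bar R) : Prop :=
  S m /\ ubound S m.

(* Main.v *)
Require Import Defs.
From mathcomp Require Import all_boot all_order all_algebra.
From mathcomp Require Import all_classical all_reals all_analysis.
From mathcomp Require Import measurable_realfun ring lra.
Import Order.TTheory GRing.Theory Num.Theory.
Import numFieldNormedType.Exports.
Local Open Scope classical_set_scope.
Local Open Scope ring_scope.

Set Implicit Arguments.
Unset Strict Implicit.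
Unset Printing Implicit Defensive.

(** Write A for the Neumann Laplacian and B for the coupled operator with kernel
    range a = r eps. A mild solution is a limit of implicit Euler schemes, so it
    is enough to compare an Euler scheme V_j for B with an Euler scheme W_i for A,
    both started near w0 and with unrelated small steps k_j and h_i. With
    S i j = |V_j - W_i|^2, convexity of the square gives (cross_step)

      (h + k) S(i+1, j+1) <= h S(i+1, j) + k S(i, j+1)
                             - 2 h k < B V_(j+1) - A W_(i+1), V_(j+1) - W_(i+1) >.

    Once the scalar product is at least - eta, S is dominated by an explicit
    solution of the recursion (kobayashi), which at nearby times t_i, s_j is as
    small as the initial errors, the steps and eta (schemes_close). Both operators
    are accretive, and in this way no resolvent estimate and no compactness of the
    family of solutions enters.

    The scalar product is bounded in energy_lower_bound. For i >= 2 the function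
    W_i'' = (W_i - W_(i-1)) / h_i is a difference quotient of functions of class C1
    and hence Lipschitz (euler_C2_neumann); this is why the schemes for A are
    restarted at their first point, which is still close to w0. For such a W,
    Taylor's formula shows that the nonlocal operator applied to W differs from W''
    by O(a) on [a, 1 - a], and by O(1) in the two layers of width a, where
    W'(1) = 0 is used on the right and the flux W'(0), spread over ]0, a[ with the
    weight kappa, has been taken out on the left (resid_in, resid_out). In the
    scalar product, integration by parts on ]-1, 0[ produces the boundary term
    that turns the coupling into the square rho ((V - W) - (V - W)(0-))^2, where
    rho is the rate of exchange with the left half. Since kappa <= a rho, this
    square absorbs the flux up to O(a). The remaining part of the nonlocal operator
    is nonnegative by the symmetry of the kernel (conv_accretive). With Young's
    inequality, eta is of order a / s + s for every s in ]0, 1], and s = sqrt eps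
    makes it small.

    The Euler iterates belong to H^2 in the weak sense only. The passage to
    absolutely continuous functions (H1_representative) compares averages of u
    near two Lebesgue points with the help of smooth steps, which are built from
    the function exp(-1/x).

    The constants in eta depend on the scheme W, but not on eps; so the scheme for
    A is chosen first, then eps, and finally the scheme for B
    (mild_solutions_close). The maximum in time is attained because
    t |-> |w^eps(t) - w(t)|^2 is continuous. *)

(** * Integrals over open intervals *)

Section IntervalIntegral.
Context {R : realType}.
Local Notation mu := (@lebesgue_measure R).
Implicit Types (a b c d x y k : R) (f g : R -> R).

Lemma ae_imp (P Q : R -> Prop) : (forall x, P x -> Q x) ->
  {ae mu, forall x, P x} -> {ae mu, forall x, Q x}.
Proof. by move=> PQ; apply: filterS; first exact: (ae_filter_ringOfSetsType mu). Qed.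

Lemma ae_and (P Q : R -> Prop) : {ae mu, forall x, P x} ->
  {ae mu, forall x, Q x} -> {ae mu, forall x, P x /\ Q x}.
Proof.
move=> aP aQ; apply: (@filterI _ _ (ae_filter_ringOfSetsType mu)).
  exact: aP.
exact: aQ.
Qed.

Definition oint a b f : R := \int[mu]_(x in `]a, b[) f x.
Definition oitg a b f := mu.-integrable `]a, b[ (EFin \o f).

Lemma oitg_meas a b f : oitg a b f -> measurable_fun `]a, b[ f.
Proof. by move=> /(measurable_int mu) /measurable_EFinP. Qed.

Lemma eq_oitg a b f g : (forall x, a < x < b -> f x = g x) ->
  oitg a b f -> oitg a b g.
Proof.
move=> fg; apply: eq_integrable => // x; rewrite inE/= in_itv/= => xab.
by rewrite fg.
Qed.

Lemma eq_oint a b f g : (forall x, a < x < b -> f x = g x) ->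
  oint a b f = oint a b g.
Proof.
by move=> fg; apply: eq_Rintegral => x; rewrite inE/= in_itv/= => /fg.
Qed.

Lemma EFin_oint a b f : oitg a b f ->
  (oint a b f)%:E = (\int[mu]_(x in `]a, b[) (f x)%:E)%E.
Proof. by move=> itf; rewrite fineK//; apply: integrable_fin_num. Qed.

Lemma oitg_restrict a b f :
  oitg a b f <-> mu.-integrable setT (EFin \o (f \_ `]a, b[)).
Proof. by rewrite /oitg integrable_mkcond// restrict_EFin. Qed.

Lemma oitgD a b f g : oitg a b f -> oitg a b g -> oitg a b (fun x => f x + g x).
Proof. by move=> itf itg; exact: (integrableD _ itf itg). Qed.

Lemma oitgB a b f g : oitg a b f -> oitg a b g -> oitg a b (fun x => f x - g x).
Proof. by move=> itf itg; exact: (integrableB _ itf itg). Qed.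

Lemma oitgZ a b k f : oitg a b f -> oitg a b (fun x => k * f x).
Proof. by move=> itf; exact: (integrableZl _ k itf). Qed.

Lemma oitgN a b f : oitg a b f -> oitg a b (fun x => - f x).
Proof. by move=> itf; exact: (integrableN itf). Qed.

Lemma oitg_norm a b f : oitg a b f -> oitg a b (fun x => `|f x|).
Proof. by move=> itf; exact: (integrable_norm itf). Qed.

Lemma oitg_cst a b k : oitg a b (fun=> k).
Proof.
apply: measurable_bounded_integrable => //.
  by rewrite /= lebesgue_measure_itv/=; case: ifPn => // _; rewrite -EFinB ltry.
by exists `|k|; split => // y ky x _ /=; exact: ltW.
Qed.

Lemma oitg_le a b f g : measurable_fun `]a, b[ f -> oitg a b g ->
  (forall x, a < x < b -> `|f x| <= g x) -> oitg a b f.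
Proof.
move=> mf itg fg; apply: le_integrable itg => //; first exact/measurable_EFinP.
move=> x /=; rewrite in_itv/= => /fg fgx; rewrite lee_fin.
by rewrite (le_trans fgx)// ler_norm.
Qed.

Lemma oitg_bnd a b k f : measurable_fun `]a, b[ f ->
  (forall x, a < x < b -> `|f x| <= k) -> oitg a b f.
Proof. by move=> mf fk; apply: oitg_le (oitg_cst a b k) fk. Qed.

Lemma oitg_mulb a b k f g : measurable_fun `]a, b[ g ->
  (forall x, a < x < b -> `|g x| <= k) -> oitg a b f ->
  oitg a b (fun x => g x * f x).
Proof.
move=> mg gk itf; apply: (@oitg_le _ _ _ (fun x => k * `|f x|)).
- by apply: measurable_funM => //; exact: oitg_meas.
- exact/oitgZ/oitg_norm.
- by move=> x xab; rewrite normrM ler_wpM2r// gk.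
Qed.

Lemma oitgS a b c d f : a <= c -> d <= b -> oitg a b f -> oitg c d f.
Proof.
move=> ac db; apply: integrableS => //; apply: subset_itvSoo; by rewrite bnd_simp.
Qed.

Lemma ointD a b f g : oitg a b f -> oitg a b g ->
  oint a b (fun x => f x + g x) = oint a b f + oint a b g.
Proof. by move=> itf itg; rewrite /oint RintegralD. Qed.

Lemma ointB a b f g : oitg a b f -> oitg a b g ->
  oint a b (fun x => f x - g x) = oint a b f - oint a b g.
Proof. by move=> itf itg; rewrite /oint RintegralB. Qed.

Lemma ointZ a b k f : oitg a b f -> oint a b (fun x => k * f x) = k * oint a b f.
Proof. by move=> itf; rewrite /oint RintegralZl. Qed.

Lemma ointN a b f : oitg a b f -> oint a b (fun x => - f x) = - oint a b f.
Proof.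
move=> itf; rewrite -mulN1r -ointZ//; apply: eq_oint => x _; by rewrite mulN1r.
Qed.

Lemma oint_ge0 a b f : (forall x, a < x < b -> 0 <= f x) -> 0 <= oint a b f.
Proof. by move=> f0; apply: Rintegral_ge0 => x /=; rewrite in_itv/= => /f0. Qed.

Lemma oint_le a b f g : oitg a b f -> oitg a b g ->
  (forall x, a < x < b -> f x <= g x) -> oint a b f <= oint a b g.
Proof.
by move=> itf itg fg; apply: le_Rintegral.
Qed.

Lemma oint_norm a b f : oitg a b f -> `|oint a b f| <= oint a b (fun x => `|f x|).
Proof. by move=> itf; exact: le_normr_Rintegral. Qed.

Lemma oint_cst a b k : a <= b -> oint a b (fun=> k) = k * (b - a).
Proof.
move=> ab; rewrite /oint Rintegral_cst//= lebesgue_measure_itv/= lte_fin.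
by move: ab; rewrite le_eqVlt => /predU1P[->|->]; rewrite ?ltxx ?subrr.
Qed.

Lemma oint_empty a b f : b <= a -> oint a b f = 0.
Proof.
by move=> ba; rewrite /oint set_itv_ge ?Rintegral_set0// bnd_simp -leNgt.
Qed.

Lemma oint_eq0 a b f : (forall x, a < x < b -> f x = 0) -> oint a b f = 0.
Proof.
move=> f0; have [ab|ba] := leP a b; last by rewrite oint_empty// ltW.
by rewrite (eq_oint f0) oint_cst// mul0r.
Qed.

Lemma oint_bnd a b k f : a <= b -> oitg a b f ->
  (forall x, a < x < b -> `|f x| <= k) -> `|oint a b f| <= k * (b - a).
Proof.
move=> ab itf fk; rewrite (le_trans (oint_norm itf))// -oint_cst//.
by apply: oint_le => //; [exact: oitg_norm | exact: oitg_cst].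
Qed.

Lemma oint_split a b c f : a <= c <= b -> oitg a b f ->
  oint a b f = oint a c f + oint c b f.
Proof.
move=> /andP[ac cb] itf.
move: ac; rewrite le_eqVlt => /predU1P[<-|ac].
  by rewrite (@oint_empty a a)// add0r.
move: cb; rewrite le_eqVlt => /predU1P[->|cb].
  by rewrite (@oint_empty b b)// addr0.
rewrite /oint (@itv_bndbnd_setU _ _ _ (BLeft c)) ?bnd_simp//.
rewrite Rintegral_setU//=.
- congr (_ + _); rewrite -Rintegral_itv_obnd_cbnd//.
  by apply: oitgS itf; rewrite // ltW.
- by rewrite -itv_bndbnd_setU ?bnd_simp// ?ltW.
- apply/disj_setPS => y [/=]; rewrite 2!in_itv/= => /andP[_ yc] /andP[].
  by rewrite leNgt yc.
- exact: ltW.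
Qed.

Lemma oint_ae a b f g : measurable_fun `]a, b[ f -> measurable_fun `]a, b[ g ->
  f = g %[ae mu in `]a, b[%classic] -> oint a b f = oint a b g.
Proof.
move=> mf mg fg; congr fine; apply: ae_eq_integral => //.
- exact/measurable_EFinP.
- exact/measurable_EFinP.
- by apply: ae_imp fg => x /= h /h ->.
Qed.

Lemma oitg_ae a b f g : measurable_fun `]a, b[ g ->
  f = g %[ae mu in `]a, b[%classic] -> oitg a b f -> oitg a b g.
Proof.
move=> mg fg itf; apply/integrableP; split; first exact/measurable_EFinP.
have /integrableP[mf] := itf.
congr (_ < _)%E; apply: ae_eq_integral => //.
- exact: measurableT_comp.
- by apply: measurableT_comp => //; exact/measurable_EFinP.
- by apply: ae_imp fg => x /= h /h ->.
Qed.

Lemma oitg_continuous a b f : {within `[a, b], continuous f} -> oitg a b f.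
Proof.
move=> cf; have : mu.-integrable `[a, b] (EFin \o f).
  by apply: continuous_compact_integrable => //; exact: segment_compact.
by apply: integrableS => //; exact: subset_itv_oo_cc.
Qed.

(** Membership in L^2(a, b), as L2P shows, without the extension by zero. *)
Definition sq a b f := measurable_fun `]a, b[ f /\ oitg a b (fun x => f x ^+ 2).

Lemma sq_mul a b f g : sq a b f -> sq a b g -> oitg a b (fun x => f x * g x).
Proof.
move=> [mf f2] [mg g2].
apply: (@oitg_le _ _ _ (fun x => f x ^+ 2 + g x ^+ 2)).
- exact: measurable_funM.
- exact: oitgD.
- move=> x _; rewrite normrM -(real_normK (num_real (f x))).
  rewrite -(real_normK (num_real (g x))).
  have := sqr_ge0 (`|f x| - `|g x|); nra.
Qed.

Lemma sq_itg a b f : sq a b f -> oitg a b f.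
Proof.
move=> sf; have s1 : sq a b (fun=> 1 : R).
  by split => //; apply: oitg_cst.
by apply: eq_oitg (sq_mul sf s1) => x _; rewrite mulr1.
Qed.

Lemma sqD a b f g : sq a b f -> sq a b g -> sq a b (fun x => f x + g x).
Proof.
move=> sf sg; have [[mf f2] [mg g2]] := (sf, sg); split.
  exact: measurable_funD.
apply: (@eq_oitg _ _ (fun x => (f x ^+ 2 + g x ^+ 2) + 2 * (f x * g x))).
  by move=> x _; ring.
by apply: oitgD; [exact: oitgD | apply: oitgZ; exact: sq_mul].
Qed.

Lemma sqZ a b k f : sq a b f -> sq a b (fun x => k * f x).
Proof.
move=> [mf f2]; split; first exact: measurable_funM.
apply: (@eq_oitg _ _ (fun x => k ^+ 2 * f x ^+ 2)); last exact: oitgZ.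
by move=> x _; ring.
Qed.

Lemma sqN a b f : sq a b f -> sq a b (fun x => - f x).
Proof.
move=> /(sqZ (-1)); congr sq; apply/funext => x; by rewrite mulN1r.
Qed.

Lemma sqB a b f g : sq a b f -> sq a b g -> sq a b (fun x => f x - g x).
Proof. by move=> sf sg; apply: sqD sf _; exact: sqN. Qed.

Lemma sqS a b c d f : a <= c -> d <= b -> sq a b f -> sq c d f.
Proof.
move=> ac db [mf f2]; split; last exact: oitgS f2.
by apply: measurable_funS mf => //; apply: subset_itvSoo; rewrite bnd_simp.
Qed.

Lemma sq_bnd a b k f : measurable_fun `]a, b[ f ->
  (forall x, a < x < b -> `|f x| <= k) -> sq a b f.
Proof.
move=> mf fk; split => //; apply: (@oitg_bnd _ _ (k ^+ 2)).
  exact: measurable_funX.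
move=> x xab; rewrite normrX; have := fk _ xab; have := normr_ge0 (f x); nra.
Qed.

Lemma restrict_meas a b f :
  measurable_fun setT (f \_ `]a, b[) <-> measurable_fun `]a, b[ f.
Proof. by rewrite -measurable_restrictT. Qed.

Lemma L2norm_sq a b f :
  L2norm a b f = ((\int[mu]_(x in `]a, b[) (f x ^+ 2)%:E) `^ 2^-1)%E.
Proof.
rewrite /L2norm unlock; congr (_ `^ _)%E.
rewrite [RHS]integral_mkcond/=; apply: eq_integral => x _ /=.
rewrite /patch; case: ifPn => _; rewrite ?normr0 ?powR0 ?(lt0r_neq0)//.
by rewrite powR_mulrn// real_normK// num_real.
Qed.

Lemma L2P a b f : L2 a b f <-> sq a b f.
Proof.
have E : (measurable_fun `]a, b[ f) -> oitg a b (fun x => f x ^+ 2) <->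
    finite_norm mu 2%:E (f \_ `]a, b[).
  move=> mf; rewrite /finite_norm -/(L2norm a b f) L2norm_sq.
  have i0 : (0 <= \int[mu]_(x in `]a, b[) (f x ^+ 2)%:E)%E.
    by apply: integral_ge0 => x _; rewrite lee_fin sqr_ge0.
  split.
    move=> /integrable_lty h; rewrite poweR_lty//; exact: h.
  move=> h; apply/integrableP; split.
    by apply/measurable_EFinP; exact: measurable_funX.
  under eq_integral => x _ do rewrite /= ger0_norm ?sqr_ge0//.
  by rewrite (@lty_poweRy _ _ 2^-1).
rewrite /L2/=; split.
  rewrite inE => /andP[]; rewrite !inE/= => /restrict_meas mf h; split => //.
  exact/(E mf).
move=> [mf f2]; rewrite inE; apply/andP; rewrite !inE/=; split.
  exact/restrict_meas.
exact/(E mf).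
Qed.

Lemma L2normE a b f : sq a b f ->
  L2norm a b f = (Num.sqrt (oint a b (fun x => f x ^+ 2)))%:E.
Proof.
move=> [mf f2]; rewrite L2norm_sq -(fineK (integrable_fin_num _ f2))//.
rewrite poweR_EFin powR12_sqrt//.
by apply: oint_ge0 => x _; exact: sqr_ge0.
Qed.

Lemma L2norm_le a b f k : 0 <= k -> sq a b f ->
  (L2norm a b f <= k%:E)%E = (oint a b (fun x => f x ^+ 2) <= k ^+ 2).
Proof.
move=> k0 sf; rewrite L2normE// lee_fin -[X in _ <= X](ger0_norm k0).
by rewrite -sqrtr_sqr ler_sqrt// sqr_ge0.
Qed.

End IntervalIntegral.

(** * Primitives *)

Section Primitive.
Context {R : realType}.
Local Notation mu := (@lebesgue_measure R).
Implicit Types (a b c d x y k : R) (f g E F G H : R -> R).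

Lemma oitg_cc a b f : oitg a b f -> mu.-integrable `[a, b] (EFin \o f).
Proof.
move=> itf; have mf : measurable_fun `[a, b] f.
  by apply: measurable_fun_itv_cc; exact: oitg_meas itf.
have /integrableP[_] := itf.
move=> h; apply/integrableP; split; first exact/measurable_EFinP.
rewrite -integral_itv_obnd_cbnd; last first.
  apply: measurableT_comp => //; apply/measurable_EFinP.
  by apply: measurable_fun_itv_oc mf.
rewrite -integral_itv_bndo_bndc//.
by apply: measurableT_comp => //; exact: (measurable_int mu itf).
Qed.

Lemma oint_cc a b f : oitg a b f -> oint a b f = \int[mu]_(x in `[a, b]) f x.
Proof.
move=> itf; rewrite -Rintegral_itv_obnd_cbnd; last first.
  apply: integrableS (oitg_cc itf) => //.
  by apply: subset_itvr; rewrite bnd_simp.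
by rewrite -Rintegral_itv_bndo_bndc.
Qed.

(** F is absolutely continuous on [a, b] with derivative f. Increments are used
    because f is only defined up to null sets. *)
Definition primitive a b F f := oitg a b f /\
  forall x y, a <= x -> x <= y -> y <= b -> F y - F x = oint x y f.

Lemma primitiveS a b c d F f : a <= c -> d <= b ->
  primitive a b F f -> primitive c d F f.
Proof.
move=> ac db [itf Ff]; split; first exact: oitgS itf.
move=> x y cx xy yd; apply: Ff => //; first exact: le_trans cx.
exact: le_trans yd _.
Qed.

Lemma primitiveB a b F f G g : primitive a b F f -> primitive a b G g ->
  primitive a b (fun x => F x - G x) (fun x => f x - g x).
Proof.
move=> [itf Ff] [itg Gg]; split; first exact: oitgB.
move=> x y ax xy yb; rewrite ointB; last 2 first.
- exact: oitgS itf.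
- exact: oitgS itg.
by rewrite -Ff// -Gg//; ring.
Qed.

Lemma primitive_continuous a b F f : a <= b -> primitive a b F f ->
  {within `[a, b], continuous F}.
Proof.
move=> ab [itf Ff].
have h := parameterized_integral_continuous ab (oitg_cc itf).
have {}h : {within `[a, b], continuous (fun x => F a + parameterized_integral mu a x f)}.
  by move=> x; apply: cvgD; [exact: cvg_cst|exact: h].
apply: subspace_eq_continuous h => x; rewrite inE/= in_itv/= => /andP[ax xb].
rewrite /from_subspace/= /parameterized_integral -oint_cc; last exact: oitgS itf.
by rewrite -Ff//; ring.
Qed.

Lemma primitive_meas a b F f : primitive a b F f -> measurable_fun `]a, b[ F.
Proof.
have [ba|ab] := leP b a.
  by rewrite set_itv_ge ?bnd_simp -?leNgt// => _; exact: measurable_fun_set0.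
move=> pF; have := primitive_continuous (ltW ab) pF.
move=> /(subspace_continuous_measurable_fun (measurable_itv _)).
by apply: measurable_funS => //; exact: subset_itv_oo_cc.
Qed.

Lemma primitive_bnd a b F f : primitive a b F f ->
  exists2 k : R, 0 <= k & forall x, a <= x <= b -> `|F x| <= k.
Proof.
move=> [itf Ff]; exists (`|F a| + oint a b (fun x => `|f x|)).
  by rewrite addr_ge0// oint_ge0.
move=> x /andP[ax xb]; rewrite -(subrK (F a) (F x)) addrC.
rewrite (le_trans (ler_normD _ _))// lerD2l Ff//.
rewrite (le_trans (oint_norm _))//; first exact: oitgS itf.
rewrite (@oint_split _ a b x) ?ax// ?lerDl ?oint_ge0//.
exact: oitg_norm.
Qed.

Lemma primitive_sq a b F f : primitive a b F f -> sq a b F.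
Proof.
move=> pF; have [k _ Fk] := primitive_bnd pF.
apply: (@sq_bnd _ _ _ k); first exact: primitive_meas pF.
by move=> x /andP[ax xb]; rewrite Fk// !ltW.
Qed.

Lemma primitive_itg a b F f : primitive a b F f -> oitg a b F.
Proof. by move=> /primitive_sq /sq_itg. Qed.

Lemma primitive_lip a b F f k x y : primitive a b F f ->
  a <= x <= b -> a <= y <= b ->
  (forall z, Num.min x y < z < Num.max x y -> `|f z| <= k) ->
  `|F y - F x| <= k * `|y - x|.
Proof.
move=> [itf Ff]; wlog xy : x y / x <= y => [hw ax ay fk|].
  have [xy|/ltW yx] := leP x y; first exact: hw.
  by rewrite distrC [`|y - x|]distrC; apply: hw => // z; rewrite minC maxC; exact: fk.
move=> /andP[ax _] /andP[_ yb]; rewrite min_l// max_r// => fk.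
rewrite Ff// [in leRHS]ger0_norm ?subr_ge0//.
by apply: oint_bnd => //; exact: oitgS itf.
Qed.

(** Added up over a subdivision into n equal pieces, the bounds give (b - a) / n
    times the increment of G, and n is arbitrary. *)
Lemma eq_of_increments a b H G : a <= b ->
  (forall x y, a <= x -> x <= y -> y <= b ->
     `|H y - H x| <= (y - x) * (G y - G x)) -> H b = H a.
Proof.
move=> ab HG.
have step (n : nat) : `|H b - H a| * n.+1%:R <= (b - a) * (G b - G a).
  set h := (b - a) / n.+1%:R.
  have n0 : (0 : R) < n.+1%:R by rewrite ltr0n.
  have h0 : 0 <= h by rewrite divr_ge0 ?subr_ge0// ltW.
  have hE : n.+1%:R * h = b - a by rewrite /h mulrC divfK// gt_eqF.
  have pt (i : nat) : (i <= n.+1)%N ->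
      `|H (a + i%:R * h) - H a| <= h * (G (a + i%:R * h) - G a).
    elim: i => [_|i IH im]; first by rewrite mul0r addr0 !subrr normr0 mulr0.
    have hb : a + i.+1%:R * h <= b.
      by rewrite -lerBrDl -hE ler_wpM2r// ler_nat.
    have i1 : a + i.+1%:R * h = a + i%:R * h + h by rewrite -natr1; ring.
    rewrite i1 in hb *.
    have ai : a <= a + i%:R * h by rewrite lerDl mulr_ge0 ?ler0n.
    have ih : a + i%:R * h <= a + i%:R * h + h by rewrite lerDl.
    have := HG _ _ ai ih hb.
    have -> : a + i%:R * h + h - (a + i%:R * h) = h by ring.
    have := IH (ltnW im).
    set u := H (a + i%:R * h); set v := H (_ + _).
    move=> h1 h2; have -> : v - H a = (v - u) + (u - H a) by ring.
    rewrite (le_trans (ler_normD _ _))//.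
    by have := lerD h2 h1; rewrite -mulrDr; congr (_ <= _ * _); ring.
  have := pt n.+1 (leqnn _); rewrite hE.
  have -> : a + (b - a) = b by ring.
  move=> /(ler_wpM2r (ltW n0)) /le_trans; apply.
  by rewrite mulrAC [h * _]mulrC hE.
apply/eqP; rewrite -subr_eq0 -normr_eq0 eq_le normr_ge0 andbT leNgt.
apply/negP => d0; set d := `|_| in d0 step.
have := archi_boundP (x := (b - a) * (G b - G a) / d).
have C0 : 0 <= (b - a) * (G b - G a) / d.
  rewrite divr_ge0 ?(ltW d0)//; apply: le_trans (step 0%N).
  by rewrite mulr1 ltW.
move=> /(_ C0); rewrite ltr_pdivrMr//; set n := Num.Def.archi_bound _ => hlt.
have := le_lt_trans (step n) hlt; rewrite [_ * d]mulrC ltr_pM2l//.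
by rewrite ltr_nat ltnNge leqnSn.
Qed.

Lemma primitive_mul_itg a b E F f : primitive a b E F -> oitg a b f ->
  oitg a b (fun x => f x * E x).
Proof.
move=> pE itf; have [l l0 El] := primitive_bnd pE.
apply: (@eq_oitg _ _ _ (fun x => E x * f x)); first by move=> x _; rewrite mulrC.
apply: (@oitg_mulb _ _ _ l) => //; first exact: primitive_meas pE.
by move=> x /andP[ax xb]; rewrite El// !ltW.
Qed.

(** As f is merely integrable, F * E need not be differentiable. The difference
    of the two sides, as a function of b, has increments over [x, y] of the order
    of y - x times the integral of |f| over [x, y], so that eq_of_increments
    applies. *)
Lemma primitive_by_parts a b E F f : a <= b ->
  primitive a b E F -> primitive a b F f ->
  oint a b (fun x => f x * E x) =
  F b * E b - F a * E a - oint a b (fun x => F x ^+ 2).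
Proof.
move=> ab pE pF; have [[itF EF] [itf Ff]] := (pE, pF).
have [k k0 Fk] := primitive_bnd pF.
have itfE := primitive_mul_itg pE itf.
have itF2 : oitg a b (fun x => F x ^+ 2) by have [] := primitive_sq pF.
have itfn := oitg_norm itf.
pose N x := oint a x (fun s => `|f s|).
pose H x := F x * E x - oint a x (fun s => f s * E s) - oint a x (fun s => F s ^+ 2).
suff : H b = H a.
  rewrite /H !(@oint_empty _ a a)// => h; nra.
apply: (@eq_of_increments _ _ _ (fun x => 2 * k * N x)) => // x y ax xy yb.
have xb := le_trans xy yb.
have sub g : oitg a b g -> oitg x y g by exact: oitgS.
have Nxy : N y - N x = oint x y (fun s => `|f s|).
  rewrite /N (@oint_split _ a y x) ?ax//; first by ring.
  exact: oitgS itfn.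
have osub g : oitg a b g -> oint a y g = oint a x g + oint x y g.
  by move=> itg; rewrite (@oint_split _ a y x) ?ax//; exact: oitgS itg.
have i1 : oitg x y (fun s => f s * E y).
  by apply: eq_oitg (oitgZ (E y) (sub _ itf)) => s _; rewrite mulrC.
have i2 : oitg x y (fun s => f s * E s) by exact: sub.
have i3 : oitg x y (fun s => F x * F s) by exact/oitgZ/sub.
have i4 : oitg x y (fun s => F s ^+ 2) by exact: sub.
have i5 := oitgD (oitgB i1 i2) (oitgB i3 i4).
have -> : H y - H x =
    oint x y (fun s => (f s * E y - f s * E s) + (F x * F s - F s ^+ 2)).
  rewrite ointD ?ointB//; [|exact: oitgB|exact: oitgB].
  rewrite (ointZ _ (sub _ itF)).
  rewrite (_ : oint x y (fun s => f s * E y) = E y * oint x y f).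
    rewrite -EF// -Ff// /H !osub//; ring.
  by rewrite -ointZ; [apply: eq_oint => s _; rewrite mulrC | exact: sub].
rewrite (le_trans (oint_norm i5))//.
have itR : oitg x y (fun s => k * (y - x) * `|f s| + k * (N y - N x)).
  by apply: oitgD; [apply: oitgZ; exact: sub | exact: oitg_cst].
apply: (@le_trans _ _ (oint x y (fun s => k * (y - x) * `|f s| + k * (N y - N x)))).
  apply: oint_le => //; first exact: oitg_norm.
  move=> s /andP[xs sy].
  have as_ : a <= s by rewrite (le_trans ax)// ltW.
  have sb : s <= b by rewrite (le_trans _ yb)// ltW.
  rewrite (le_trans (ler_normD _ _))// lerD//.
    rewrite -mulrBr normrM mulrC ler_wpM2r// EF ?(ltW sy)//.
    apply: (@le_trans _ _ (k * (y - s))).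
      apply: oint_bnd; [exact: ltW|exact: oitgS itF|].
      move=> z /andP[sz zy]; apply: Fk.
      by rewrite (le_trans as_ (ltW sz)) (le_trans (ltW zy)).
    by rewrite ler_wpM2l// lerD2l lerN2 ltW.
  rewrite expr2 -mulrBl normrM mulrC ler_pM// ?Fk ?as_//.
  rewrite distrC Ff ?(ltW xs)//.
  apply: (le_trans (oint_norm _)); first exact: oitgS itf.
  rewrite Nxy (@oint_split _ x y s) ?(ltW xs) ?(ltW sy)//; last exact: sub.
  by rewrite lerDl oint_ge0.
rewrite ointD ?oint_cst//; [|by apply: oitgZ; exact: sub|exact: oitg_cst].
by rewrite ointZ; [rewrite -Nxy; nra|exact: sub].
Qed.

End Primitive.

(** * Smooth steps *)

Section SmoothStep.
Context {R : realType}.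
Local Notation mu := (@lebesgue_measure R).
Implicit Types (p q : {poly R}) (f g h : R -> R) (a b x y : R).

(** The recursion is on the derivative, so that sums and products are handled by
    induction on the order. *)
Fixpoint smooth_upto (n : nat) f : Prop := (forall x, derivable f x 1) /\
  (if n is m.+1 then smooth_upto m f^`()%classic else True).

Definition smooth f := forall n, smooth_upto n f.

Lemma smooth_derivable f n x : smooth f -> derivable (f^`(n))%classic x 1.
Proof.
move=> sf; have : smooth_upto 0 (f^`(n))%classic; last by case.
elim: n 0%N => [|n IH] k; first exact: sf.
by rewrite derive1nS; have [] := IH k.+1.
Qed.

(** Reduces smoothness to one derivative computed uniformly in a family. *)
Lemma smooth_family (S : set (R -> R)) :
  (forall f, S f -> forall x, derivable f x 1) ->
  (forall f, S f -> S (f^`())%classic) -> forall f, S f -> smooth f.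
Proof.
move=> dS SS f Sf n; elim: n f Sf => [|n IH] f Sf /=.
  by split => //; exact: dS.
by split; [exact: dS | apply: IH; exact: SS].
Qed.

Lemma is_derive_derive1 f g : (forall x, is_derive x 1 f (g x)) ->
  f^`()%classic = g.
Proof. by move=> fg; apply/funext => x; rewrite derive1E derive_val. Qed.

Lemma is_derive_smooth f g : (forall x, is_derive x 1 f (g x)) ->
  smooth g -> smooth f.
Proof.
move=> fg sg; have df x : derivable f x 1 by exact: (@ex_derive _ _ _ _ _ _ _ (fg x)).
by case=> [|n]/=; split => //; rewrite (is_derive_derive1 fg); exact: sg.
Qed.

Lemma smooth_uptoW n f : smooth_upto n.+1 f -> smooth_upto n f.
Proof.
elim: n f => [|n IH] f [df sf]; split => //.
exact: IH.
Qed.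

Lemma smooth_uptoD n f g : smooth_upto n f -> smooth_upto n g ->
  smooth_upto n (fun x => f x + g x).
Proof.
elim: n f g => [|n IH] f g [df sf] [dg sg]; (split; first by move=> x; exact: derivableD).
  by [].
rewrite (_ : (fun x => f x + g x)^`()%classic = (fun x => f^`()%classic x + g^`()%classic x)).
  exact: IH.
by apply/funext => x; rewrite !derive1E deriveD.
Qed.

Lemma smooth_uptoM n f g : smooth_upto n f -> smooth_upto n g ->
  smooth_upto n (fun x => f x * g x).
Proof.
elim: n f g => [|n IH] f g sf sg; have [[df sf'] [dg sg']] := (sf, sg);
  (split; first by move=> x; exact: derivableM).
  by [].
rewrite (_ : (fun x => f x * g x)^`()%classic =
  (fun x => f x * g^`()%classic x + g x * f^`()%classic x)).
  by apply: smooth_uptoD; apply: IH => //; exact: smooth_uptoW.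
by apply/funext => x; rewrite !derive1E deriveM.
Qed.

Lemma smooth_upto_cst n k : smooth_upto n (fun=> k : R).
Proof.
elim: n k => [|n IH] k; split => //.
rewrite (_ : _^`()%classic = fun=> 0); first exact: IH.
by apply/funext => x; rewrite derive1_cst.
Qed.

Lemma is_derive_affine f g a b x : (forall y, is_derive y 1 f (g y)) ->
  is_derive x 1 (fun y => f (a * y + b)) (a * g (a * x + b)).
Proof.
move=> fg; have h : is_derive x 1 (fun y => a * y + b) a.
  by apply: is_derive_eq; rewrite /GRing.scale/=; ring.
by have := @is_derive1_comp _ f _ _ _ _ (fg _) h; rewrite mulrC.
Qed.

Lemma smooth_upto_affine n f a b : smooth_upto n f ->
  smooth_upto n (fun x => f (a * x + b)).
Proof.
elim: n f => [|n IH] f [df sf]; have D x : is_derive x 1 (fun y => f (a * y + b))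
    (a * f^`()%classic (a * x + b)).
- by apply: is_derive_affine => y; rewrite derive1E; exact: derivableP.
- by split; [move=> x; exact: (@ex_derive _ _ _ _ _ _ _ (D x)) | exact: I].
- by apply: is_derive_affine => y; rewrite derive1E; exact: derivableP.
- split; first by move=> x; exact: (@ex_derive _ _ _ _ _ _ _ (D x)).
  rewrite (is_derive_derive1 D); apply: smooth_uptoM; last exact: IH.
  exact: smooth_upto_cst.
Qed.

(** The classical flat functions p(1/x) exp(-1/x); the polynomial factor makes the
    family stable under derivation. *)
Definition flat p : R -> R := fun x =>
  if 0 < x then p.[x^-1] * expR (- x^-1) else 0.

(** With y = 1/x this bounds the difference quotient of flat p at 0 by K x. *)
Lemma poly_growth p : exists2 K : R, 0 <= K &
  forall y, 1 <= y -> `|p.[y]| * y * expR (- y) <= K * y^-1.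
Proof.
pose A : R := \sum_(i < size p) `|p`_i|; pose m := size p.
exists (A * (m.+2)`!%:R); first by rewrite mulr_ge0// sumr_ge0.
move=> y y1; have y0 : 0 < y by apply: lt_le_trans y1.
have h1 : `|p.[y]| <= A * y ^+ m.
  rewrite horner_coef (le_trans (ler_norm_sum _ _ _))// mulr_suml ler_sum// => i _.
  rewrite normrM ler_wpM2l// normrX ger0_norm ?(ltW y0)//.
  by rewrite ler_weXn2l// ltnW.
have h2 : y ^+ m.+2 <= (m.+2)`!%:R * expR y.
  have := @expR_ge1Dxn R y m.+1 (ltW y0).
  move=> /(le_trans _) h; rewrite mulrC -ler_pdivrMr ?ltr0n ?fact_gt0//.
  by apply: h; rewrite lerDr.
rewrite expRN -[_ * (expR y)^-1]/(_ / _) ler_pdivrMr ?expR_gt0// -(ler_pM2r y0).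
apply: (@le_trans _ _ (A * y ^+ m.+2)).
  by rewrite !exprSr !mulrA ler_wpM2r ?(ltW y0)// ler_wpM2r ?(ltW y0).
rewrite -mulrA -mulrA; apply: (@le_trans _ _ (A * ((m.+2)`!%:R * expR y))).
  by rewrite ler_wpM2l// sumr_ge0.
rewrite le_eqVlt; apply/orP; left; apply/eqP.
by field; rewrite gt_eqF.
Qed.

Lemma is_derive_flat p x :
  is_derive x 1 (flat p) (flat ('X^2 * (p - p^`())) x).
Proof.
have [x0|x0|->] := ltgtP x 0.
- rewrite /flat [in X in is_derive _ _ _ X]ltNge (ltW x0)/=.
  apply: (@near_eq_is_derive _ _ _ (cst (0:R))).
  near=> y; rewrite ifF//; apply/negbTE; rewrite -leNgt.
  by near: y; apply: lt_le_nbhsl.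
- rewrite /flat [in X in is_derive _ _ _ X]x0.
  apply: (@near_eq_is_derive _ _ _ (fun y => p.[y^-1] * expR (- y^-1))).
    near=> y; rewrite ifT//; near: y; exact: lt_nbhsr.
  have xn0 : x != 0 by rewrite gt_eqF.
  have dV : is_derive x 1 (fun y : R => y^-1) (- x ^- 2).
    have := @is_deriveV _ id x 1 1 xn0 (is_derive_id _ _).
    by rewrite /GRing.scale/= mulr1.
  have dp := @is_derive1_comp _ (horner p) _ _ _ _ (is_derive_poly p _) dV.
  have dN := is_deriveN dV.
  have de := @is_derive1_comp _ expR _ _ _ _ (is_derive_expR _) dN.
  apply: (is_derive_eq (is_deriveM dp de)).
  rewrite /GRing.scale/= !hornerE/=.
  field.
  by [].
- rewrite {2}/flat ltxx.
  have [K K0 HK] := poly_growth p.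
  suff h : (fun h : R => h^-1 *: ((flat p \o shift 0) (h *: (1:R)) - flat p 0))
      @ 0^' --> (0 : R).
    by apply: DeriveDef; [apply/cvg_ex; exists 0; exact: h | exact: cvg_lim h].
  apply/cvgrPdist_le => /= e e0; near=> t.
  rewrite sub0r normrN /GRing.scale/= mulr1 addr0 {2}/flat ltxx subr0 /flat.
  have [t0|t0] := ltP 0 t; last by rewrite mulr0 normr0 ltW.
  have t1 : t <= 1.
    apply: le_trans (ler_norm _) _; near: t; apply: dnbhs0_le; exact: ltr01.
  have ht : t <= e / (K + 1).
    apply: le_trans (ler_norm _) _; near: t; apply: dnbhs0_le.
    by rewrite divr_gt0// ltr_wpDl.
  have := HK t^-1; rewrite invf_ge1// => /(_ t1); rewrite invrK.
  have tv : 0 <= t^-1 by rewrite invr_ge0 ltW.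
  rewrite !normrM (ger0_norm (expR_ge0 _)) (ger0_norm tv) [t^-1 * _]mulrCA mulrA => h.
  apply: (le_trans h).
  move: ht; rewrite ler_pdivlMr ?ltr_wpDl//; nra.
Unshelve. all: by end_near.
Qed.

Definition bump : R -> R := fun x => flat 1 x * flat 1 (- 1 * x + 1).

Lemma smooth_flat p : smooth (flat p).
Proof.
apply: (@smooth_family [set f | exists p, f = flat p]); last by exists p.
  move=> _ [q ->] x; exact: (@ex_derive _ _ _ _ _ _ _ (is_derive_flat q x)).
move=> _ [q ->]; exists ('X^2 * (q - q^`())).
by apply: is_derive_derive1 => x; exact: is_derive_flat.
Qed.

Lemma smooth_bump : smooth bump.
Proof.
by move=> n; apply: smooth_uptoM; [|apply: smooth_upto_affine]; exact: smooth_flat.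
Qed.

Lemma smooth_continuous f : smooth f -> continuous f.
Proof.
move=> /(_ 0%N)[df _] x; apply: differentiable_continuous.
by apply/derivable1_diffP; exact: df.
Qed.

Lemma flat_ge0 x : 0 <= flat 1 x.
Proof. by rewrite /flat; case: ifP => // _; rewrite hornerC mul1r expR_ge0. Qed.

Lemma flat_le1 x : flat 1 x <= 1.
Proof.
rewrite /flat; case: ifP => // x0; rewrite hornerC mul1r expR_le1.
by rewrite oppr_le0 invr_ge0 ltW.
Qed.

Lemma bump_ge0 x : 0 <= bump x.
Proof. by rewrite mulr_ge0// flat_ge0. Qed.

Lemma bump_le1 x : bump x <= 1.
Proof. by rewrite mulr_ile1// ?flat_ge0// flat_le1. Qed.

Lemma bump_out x : ~~ (0 < x < 1) -> bump x = 0.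
Proof.
rewrite negb_and -!leNgt => /orP[x0|x1]; rewrite /bump /flat.
  by rewrite ltNge x0/= mul0r.
rewrite [X in _ * X]ifF ?mulr0//; apply/negbTE; rewrite -leNgt; lra.
Qed.

Lemma bump_mass : 0 < oint 0 1 bump.
Proof.
have iE : (4:R)^-1 = 1/4 by rewrite div1r.
have ib : oitg 0 1 bump.
  apply: oitg_continuous; apply: continuous_subspaceT.
  exact/smooth_continuous/smooth_bump.
rewrite (@oint_split _ 0 1 (4^-1))//; last by apply/andP; split; lra.
have i2 : oitg 4^-1 1 bump by apply: oitgS ib => //; lra.
rewrite (@oint_split _ (4^-1) 1 (3/4))//; last by rewrite iE; apply/andP; split; lra.
rewrite addrCA ltr_pwDl//; last by rewrite addr_ge0// oint_ge0// => x _; exact: bump_ge0.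
have i3 : oitg 4^-1 (3/4) bump by apply: oitgS i2 => //; lra.
apply: (@lt_le_trans _ _ (oint 4^-1 (3/4) (fun=> expR (- 4) * expR (- 4)))).
  rewrite oint_cst; last lra.
  by rewrite mulr_gt0// ?mulr_gt0 ?expR_gt0//; lra.
apply: oint_le => //; first exact: oitg_cst.
move=> x /andP[x1 x2]; have x0 : 0 < x by lra.
have x3 : 0 < -1 * x + 1 by lra.
rewrite /bump /flat x0 x3 !hornerC !mul1r ler_pM ?expR_ge0// ler_expR lerN2.
  by rewrite -[leRHS]invrK lef_pV2// ?posrE; lra.
by rewrite -[leRHS]invrK lef_pV2// ?posrE; lra.
Qed.

(** The normalized primitive of the bump. The bound B on the derivative s makes s
    an admissible weight for averages near a Lebesgue point. *)
Lemma smooth_step : exists (S s : R -> R) (B : R),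
  [/\ smooth S, (forall x, is_derive x 1 S (s x)),
     continuous s /\ (forall x, 0 <= s x <= B),
     (forall x, x <= 0 -> S x = 0) /\ (forall x, 1 <= x -> S x = 1) &
     forall x, 0 <= S x <= 1].
Proof.
have m0 := bump_mass; set m := oint 0 1 bump in m0.
have cb : continuous bump by exact/smooth_continuous/smooth_bump.
have ib : mu.-integrable setT (EFin \o bump).
  have : oitg 0 1 bump by apply: oitg_continuous; exact: continuous_subspaceT.
  rewrite /oitg integrable_mkcond//; congr (mu.-integrable _ _).
  apply/funext => x; rewrite /patch; case: ifPn => //.
  rewrite notin_setE/= in_itv/= => /negP h; by rewrite bump_out.
pose F x := \int[mu]_(t in `]-oo, x]) bump t.
have dF x : is_derive x 1 F (bump x).
  have [] := @continuous_FTC1 _ bump -oo%O x (x + 1).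
  - by rewrite ltrDl.
  - by apply: integrableS ib.
  - by rewrite ltNyr.
  - exact: cb.
  by move=> d1 d2; split; [exact: d1 | rewrite -derive1E; exact: d2].
have F0 x : x <= 0 -> F x = 0.
  move=> x0; rewrite /F (@eq_Rintegral _ _ _ _ _ (fun=> 0)) ?Rintegral_cst ?mul0r//.
  move=> y; rewrite inE/= in_itv/= => yx; rewrite bump_out// negb_and -leNgt.
  by rewrite (le_trans yx).
have F1 x : 1 <= x -> F x = m.
  move=> x1; rewrite /F /m /oint.
  rewrite Rintegral_mkcond [RHS]Rintegral_mkcond.
  apply: eq_Rintegral => y _; rewrite /patch !mem_setE !in_itv/=.
  have [y01|y01] := boolP (0 < y < 1); last by rewrite bump_out//; case: ifP.
  by rewrite (le_trans _ x1)// ltW//; case/andP: y01.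
have Fm x y : x <= y -> F x <= F y.
  move=> xy; rewrite -subr_ge0.
  have cF : {within `[x, y], continuous F}.
    apply: continuous_subspaceT => z; apply: differentiable_continuous.
    by apply/derivable1_diffP; exact: (@ex_derive _ _ _ _ _ _ _ (dF z)).
  have [c _ ->] := MVT_segment xy (fun z _ => dF z) cF.
  by rewrite mulr_ge0 ?bump_ge0// subr_ge0.
exists (fun x => m^-1 * F x), (fun x => m^-1 * bump x), m^-1.
have mv : 0 < m^-1 by rewrite invr_gt0.
have dS x : is_derive x 1 (fun x => m^-1 * F x) (m^-1 * bump x).
  by have := dF x => h; apply: is_derive_eq; rewrite /GRing.scale/=; ring.
split => //.
- apply: is_derive_smooth dS _ => n; apply: smooth_uptoM; last exact: smooth_bump.
  exact: smooth_upto_cst.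
- split; first by move=> x; apply: cvgM; [exact: cvg_cst|exact: cb].
  move=> x; rewrite mulr_ge0 ?(ltW mv) ?bump_ge0//=.
  by rewrite ler_piMr ?(ltW mv)// bump_le1.
- split => x hx; first by rewrite F0// mulr0.
  by rewrite F1// mulVf// gt_eqF.
- move=> x; rewrite mulr_ge0 ?(ltW mv)//=.
    rewrite mulrC ler_pdivrMr// mul1r; have [x1|x1] := leP 1 x; first by rewrite F1.
    by rewrite -(F1 1)// Fm// ltW.
  have [x1|x1] := leP x 0; first by rewrite F0.
  by rewrite -(F0 0)// Fm// ltW.
Qed.

End SmoothStep.

(** * Weak derivatives and continuous representatives *)

Section WeakDerivatives.
Context {R : realType}.
Local Notation mu := (@lebesgue_measure R).
Implicit Types (u f g phi : R -> R) (a b c d e x y h k : R).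

Lemma primitive_of_derive a b (F f : R -> R) :
  (forall x, is_derive x 1 F (f x)) -> continuous f -> primitive a b F f.
Proof.
move=> Ff cf; have itf x y : oitg x y f.
  by apply: oitg_continuous; exact: continuous_subspaceT.
split => // x y _ + _; rewrite le_eqVlt => /predU1P[<-|xy].
  by rewrite subrr oint_empty.
have cF : continuous F.
  move=> z; apply: differentiable_continuous; apply/derivable1_diffP.
  exact: (@ex_derive _ _ _ _ _ _ _ (Ff z)).
rewrite oint_cc// /Rintegral (@continuous_FTC2 _ f F)//.
- exact: continuous_subspaceT.
- split; first by move=> z _; exact: (@ex_derive _ _ _ _ _ _ _ (Ff z)).
  + exact/cvg_at_right_filter/cF.
  + exact/cvg_at_left_filter/cF.
- by move=> z _; rewrite (is_derive_derive1 Ff).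
Qed.

Lemma ae_exists a b (P : R -> Prop) : a < b -> {ae mu, forall x, P x} ->
  exists2 x, a < x < b & P x.
Proof.
move=> ab [N [mN N0 PN]]; apply: contrapT => nP.
have : (mu `]a, b[ <= mu N)%E.
  apply: le_measure; rewrite ?inE//.
  move=> x /=; rewrite in_itv/= => xab; apply: PN => Px; apply: nP.
  by exists x.
by rewrite N0 /= lebesgue_measure_itv/= lte_fin ab -EFinB lee_fin subr_le0 leNgt ab.
Qed.

(** Absolute continuity of the integral, to the right of c. *)
Lemma small_oint a b c e f : oitg a b f -> a < c < b -> 0 < e ->
  exists2 r : R, 0 < r & forall h, 0 < h -> h < r ->
    c + h < b /\ oint c (c + h) (fun x => `|f x|) <= e.
Proof.
move=> itf /andP[ac cb] e0; have ab := lt_trans ac cb.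
have itn := oitg_norm itf.
pose N x := oint a x (fun x => `|f x|).
have pN : primitive a b N (fun x => `|f x|).
  split => // x y ax xy yb; rewrite /N (@oint_split _ a y x) ?ax//.
    by rewrite addrAC subrr add0r.
  exact: oitgS itn.
have := within_continuous_continuous ab (primitive_continuous (ltW ab) pN).
move=> /(_ c); rewrite in_itv/= ac cb => /(_ isT).
move=> /cvgrPdist_le/(_ e e0)/nbhs_ballP[r /= r0 Hr].
exists (Num.min r (b - c)); first by rewrite lt_min r0 subr_gt0.
move=> h h0; rewrite lt_min => /andP[hr hb].
split; first by lra.
have := Hr (c + h); rewrite /ball/= opprD addNKr normrN gtr0_norm// => /(_ hr).
rewrite distrC (pN.2 c (c + h)) ?(ltW ac)//; [|lra|lra].
by move=> /(le_trans (ler_norm _)).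
Qed.

(** The interval ]c, c + h[ fills half of the ball of radius h, so that its average
    is at most twice the centered one; hence the e / 2 in the proof. *)
Lemma lebesgue_pt_oint a b c e u : oitg a b u -> a < c < b ->
  lebesgue_pt (u \_ `]a, b[) c -> 0 < e ->
  exists2 r : R, 0 < r & forall h, 0 < h -> h < r ->
    c + h < b /\ oint c (c + h) (fun x => `|u x - u c|) <= e * h.
Proof.
move=> itu /andP[ac cb] uc e0.
have e2 : (0 < (e / 2)%:E)%E by rewrite lte_fin divr_gt0.
have := uc; move=> /fine_cvgP[fin].
move=> /cvgrPdist_le /(_ (e/2)); rewrite divr_gt0// => /(_ isT) H.
have [r /= r0 Hr] : \forall r \near (0:R)^'+, (davg (u \_ `]a, b[) c r <= (e / 2)%:E)%E.
  near=> r; rewrite -(fineK (x := davg _ _ _)); last by near: r.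
  rewrite lee_fin; apply: (le_trans (ler_norm _)).
  by rewrite -normrN -[X in `|X|]sub0r; near: r.
exists (Num.min r (Num.min (c - a) (b - c))); first by rewrite !lt_min r0 !subr_gt0 ac cb.
move=> h h0; rewrite !lt_min => /and3P[hr ha hb].
split; first by lra.
have := Hr h; rewrite /ball/= sub0r normrN gtr0_norm// => /(_ hr h0).
rewrite /davg /iavg (lebesgue_measure_ball _ (ltW h0)) inver mulrn_eq0 /= (gt_eqF h0) => hle.
have ucE : (u \_ `]a, b[) c = u c.
  by rewrite patchE mem_set//= in_itv/= ac cb.
have iu : oitg c (c + h) (fun x => `|u x - u c|).
  apply: oitg_norm; apply: oitgB; last exact: oitg_cst.
  by apply: oitgS itu; lra.
have h2 : (0 < h *+ 2)%R by rewrite mulrn_wgt0.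
have E : oint c (c + h) (fun x => `|u x - u c|) =
    oint c (c + h) (fun x => `|(u \_ `]a, b[) x - (u \_ `]a, b[) c|).
  apply: eq_oint => y /andP[cy ych]; rewrite ucE patchE mem_set//=.
  by rewrite in_itv/=; apply/andP; split; lra.
have iu' : oitg c (c + h) (fun x => `|(u \_ `]a, b[) x - (u \_ `]a, b[) c|).
  apply: eq_oitg iu => y /andP[cy ych]; rewrite ucE patchE mem_set//=.
  by rewrite in_itv/=; apply/andP; split; lra.
rewrite E -lee_fin /oint /Rintegral fineK; last exact: integrable_fin_num.
apply: (@le_trans _ _ (\int[mu]_(y in ball c h) `|(u \_ `]a, b[) y - (u \_ `]a, b[) c|%:E)%E).
  apply: ge0_subset_integral => //.
  - exact: measurable_ball.
  - apply/measurable_EFinP; apply: measurableT_comp => //; apply: measurable_funB => //.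
    apply: measurable_funTS; apply/restrict_meas; exact: oitg_meas itu.
  - by move=> y /=; rewrite ball_itv/= !in_itv/= => /andP[cy ych]; apply/andP; split; lra.
move: hle; rewrite -(@lee_pmul2l _ (h *+ 2)%:E)//.
rewrite muleA -EFinM mulfV ?gt_eqF// mul1e => /le_trans; apply.
by rewrite -EFinM lee_fin mulr2n; lra.
Unshelve. all: by end_near. Qed.

(** Tested against the difference of two smooth steps at [c] and [d], the
    definition of the weak derivative compares averages of [u] right of [c] and
    [d] with the integral of [g] between them; the averages converge at
    Lebesgue points. *)
Lemma weak_derivative_increment a b c d u g : oitg a b u -> oitg a b g ->
  is_weak_derivative a b u g -> a < c -> c < d -> d < b ->
  lebesgue_pt (u \_ `]a, b[) c -> lebesgue_pt (u \_ `]a, b[) d ->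
  u d - u c = oint c d g.
Proof.
move=> itu itg wg ac cd db uc ud.
have [S [s [B [smS dS [cs sB] [S0 S1] S01]]]] := @smooth_step R.
have B0 : 0 <= B by have /andP[/le_trans] := sB 0; apply.
have ad := lt_trans ac cd; have cb := lt_trans cd db.
suff H e : 0 < e -> `|u d - u c - oint c d g| <= e * (2 * B + 2).
  apply/eqP; rewrite -subr_eq0 -normr_eq0 eq_le normr_ge0 andbT leNgt.
  apply/negP => X0; set X := `|_| in X0 H.
  have K0 : 0 < 2 * B + 2 by lra.
  have := H (X / (2 * B + 2) / 2); rewrite !divr_gt0// => /(_ isT).
  rewrite mulrAC divfK ?gt_eqF//; lra.
move=> e0.
have [r1 r1_0 H1] := lebesgue_pt_oint itu (introT andP (conj ac cb)) uc e0.
have [r2 r2_0 H2] := lebesgue_pt_oint itu (introT andP (conj ad db)) ud e0.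
have [r3 r3_0 H3] := small_oint itg (introT andP (conj ac cb)) e0.
have [r4 r4_0 H4] := small_oint itg (introT andP (conj ad db)) e0.
have [h [h0 hcd h1 h2 [h3 h4]]] : exists h, [/\ 0 < h, c + h < d, h < r1, h < r2 & h < r3 /\ h < r4].
  pose m := Num.min (d - c) (Num.min r1 (Num.min r2 (Num.min r3 r4))).
  have m0 : 0 < m by rewrite !lt_min subr_gt0 cd r1_0 r2_0 r3_0.
  have : m / 2 < m by rewrite ltr_pdivrMr// ltr_pMr// ltr1n.
  exists (m / 2); have : m / 2 < m by [].
  rewrite {2}/m !lt_min => /and5P[k1 k2 k3 k4 k5]; split => //.
    by rewrite divr_gt0.
  by rewrite -ltrBrDl.
have [_ {}H1] := H1 h h0 h1; have [dhb {}H2] := H2 h h0 h2.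
have [_ {}H3] := H3 h h0 h3; have [_ {}H4] := H4 h h0 h4.
(* P z rises from 0 to 1 over [z, z + h]; its derivative p z is a weight of mass 1
   on that interval. *)
pose P z x := S (h^-1 * x + - (h^-1 * z)).
pose p z x := h^-1 * s (h^-1 * x + - (h^-1 * z)).
have hv : 0 < h^-1 by rewrite invr_gt0.
have argE z x : h^-1 * x + - (h^-1 * z) = (x - z) / h by ring.
have dP z x : is_derive x 1 (P z) (p z x) by exact: is_derive_affine.
have cp z : continuous (p z).
  move=> x; apply: cvgM; first exact: cvg_cst.
  apply: continuous_comp; last exact: cs.
  by apply: cvgD; [apply: cvgM; [exact: cvg_cst|exact: cvg_id]|exact: cvg_cst].
have P0 z x : x <= z -> P z x = 0.
  by move=> xz; rewrite /P argE S0// ler_pdivrMr// mul0r subr_le0.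
have P1 z x : z + h <= x -> P z x = 1.
  by move=> xz; rewrite /P argE S1// ler_pdivlMr// mul1r lerBrDl.
have P01 z x : 0 <= P z x <= 1 by exact: S01.
have p0 z x : (x < z) || (z + h < x) -> p z x = 0.
  move=> xz; suff : is_derive x 1 (P z) 0.
    by move=> hd; rewrite -(derive_val (is_derive := dP z x)) derive_val.
  have [xz'|xz'] := orP xz.
    apply: (@near_eq_is_derive _ _ _ (cst (0:R))).
    near=> y; rewrite P0//; near: y; exact: lt_le_nbhsl.
  apply: (@near_eq_is_derive _ _ _ (cst (1:R))).
  near=> y; rewrite P1//; apply: ltW; near: y; exact: lt_nbhsr.
have pB z x : 0 <= p z x <= h^-1 * B.
  by have /andP[s0 s1] := sB (h^-1 * x + - (h^-1 * z)); rewrite mulr_ge0 ?(ltW hv)// ler_wpM2l// ltW.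
pose phi x := P c x - P d x.
have dphi x : is_derive x 1 phi (p c x - p d x) by exact: is_deriveB.
have tphi : test_function a b phi.
  split.
    move=> n x; apply: smooth_derivable => m.
    rewrite /phi (_ : (fun x => _) = (fun x => P c x + (-1) * P d x)).
      apply: smooth_uptoD; first exact: smooth_upto_affine.
      apply: smooth_uptoM; first exact: smooth_upto_cst.
      exact: smooth_upto_affine.
    by apply/funext => y; rewrite mulN1r.
  exists c, (d + h); split => // x /=; rewrite in_itv/= => /negP.
  rewrite negb_and -!ltNge => /orP[xc|xd].
    by rewrite /phi !P0 ?subrr// ltW// (lt_trans xc).
  rewrite /phi !P1 ?subrr// ltW//; apply: lt_trans xd; lra.
(* The average of u with weight p z is close to u z at a Lebesgue point. *)
have avg z : a < z -> z + h < b -> oint z (z + h) (fun x => `|u x - u z|) <= e * h ->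
    oitg a b (fun x => u x * p z x) /\ `|oint a b (fun x => u x * p z x) - u z| <= B * e.
  move=> az zb Hz.
  have zb' : z < b by apply: le_lt_trans zb; rewrite lerDl ltW.
  have mp x y : measurable_fun `]x, y[ (p z).
    by apply: measurable_funTS; exact: continuous_measurable_fun.
  have pn x : `|p z x| <= h^-1 * B by have /andP[q0 q1] := pB z x; rewrite ger0_norm.
  have iup : oitg a b (fun x => u x * p z x).
    apply: (@eq_oitg _ _ _ (fun x => p z x * u x)); first by move=> x _; rewrite mulrC.
    exact: oitg_mulb.
  split => //.
  rewrite (@oint_split _ a b z) ?(ltW az) ?(ltW zb')//.
  rewrite (oint_eq0 (a := a)) ?add0r; last first.
    by move=> x /andP[_ xz]; rewrite p0 ?xz// mulr0.
  rewrite (@oint_split _ z b (z + h)) ?(ltW zb) ?lerDl ?(ltW h0)//; last first.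
    by apply: oitgS iup => //; exact: ltW.
  rewrite (oint_eq0 (a := z + h)) ?addr0; last first.
    by move=> x /andP[xz _]; rewrite p0 ?xz ?orbT// mulr0.
  have pP := primitive_of_derive z (z + h) (dP z) (cp z).
  have pint : oint z (z + h) (p z) = 1.
    by rewrite -(pP.2 z (z + h)) ?lerDl ?(ltW h0)// [P z z]P0// P1// subr0.
  have iu : oitg z (z + h) u by apply: oitgS itu; exact: ltW.
  have iup' : oitg z (z + h) (fun x => u x * p z x) by apply: oitgS iup; exact: ltW.
  have ip : oitg z (z + h) (p z) by exact: pP.1.
  rewrite -[u z in X in `|X|]mulr1 -pint -ointZ// -ointB//; last exact: oitgZ.
  have idu : oitg z (z + h) (fun x => u x - u z).
    by apply: oitgB => //; exact: oitg_cst.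
  rewrite (@eq_oint _ _ _ _ (fun x => p z x * (u x - u z))); last by move=> x _; ring.
  have ipd := oitg_mulb (mp z (z + h)) (fun x _ => pn x) idu.
  apply: (le_trans (oint_norm ipd)).
  apply: (@le_trans _ _ (oint z (z + h) (fun x => (h^-1 * B) * `|u x - u z|))).
    apply: oint_le; first exact: oitg_norm.
      by apply: oitgZ; exact: oitg_norm.
    by move=> x _; rewrite normrM ler_wpM2r.
  rewrite ointZ; last exact: oitg_norm.
  apply: (le_trans (ler_wpM2l _ Hz)); first by rewrite mulr_ge0// ltW.
  by rewrite le_eqVlt; apply/orP; left; apply/eqP; field; rewrite gt_eqF.
have [ic Ac] := avg c ac (lt_trans hcd db) H1.
have [id Ad] := avg d ad dhb H2.
have := wg _ tphi; rewrite (is_derive_derive1 dphi).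
rewrite -/(oint a b _) -/(oint a b _) (@eq_oint _ _ _ _ (fun x => u x * p c x - u x * p d x)); last first.
  by move=> x _; rewrite mulrBr.
rewrite ointB//.
have mphi : measurable_fun `]a, b[ phi.
  apply: measurable_funTS; apply: continuous_measurable_fun => x.
  apply: differentiable_continuous; apply/derivable1_diffP.
  exact: (@ex_derive _ _ _ _ _ _ _ (dphi x)).
have phi1 x : `|phi x| <= 1.
  have /andP[? ?] := P01 c x; have /andP[? ?] := P01 d x.
  by rewrite /phi ler_norml; apply/andP; split; lra.
have igphi : oitg a b (fun x => g x * phi x).
  apply: (@eq_oitg _ _ _ (fun x => phi x * g x)); first by move=> x _; rewrite mulrC.
  exact: oitg_mulb.
have igc : oitg c d (fun x => g x * phi x) by apply: oitgS igphi; exact: ltW.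
have igc' : oitg c d g by apply: oitgS itg; exact: ltW.
(* phi is 1 on [c + h, d]; the two transition intervals carry little of g. *)
have -> : oint a b (fun x => g x * phi x) = oint c d g +
   (oint c (c + h) (fun x => g x * phi x - g x) + oint d (d + h) (fun x => g x * phi x)).
  rewrite (@oint_split _ a b c) ?(ltW ac) ?(ltW cb)//.
  rewrite (oint_eq0 (a := a)) ?add0r; last first.
    by move=> x /andP[_ xc]; rewrite /phi !P0 ?subrr ?mulr0// ltW// (lt_trans xc).
  rewrite (@oint_split _ c b d) ?(ltW cd) ?(ltW db)//; last by apply: oitgS igphi => //; exact: ltW.
  rewrite (@oint_split _ d b (d + h)) ?lerDl ?(ltW h0) ?(ltW dhb)//; last first.
    by apply: oitgS igphi => //; exact: ltW.
  rewrite (oint_eq0 (a := d + h)) ?addr0; last first.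
    move=> x /andP[xd _]; rewrite /phi !P1 ?subrr ?mulr0// ltW//; apply: lt_trans xd; lra.
  rewrite addrA; congr (_ + _).
  have -> : oint c (c + h) (fun x => g x * phi x - g x) = oint c d (fun x => g x * phi x - g x).
    rewrite [RHS](@oint_split _ c d (c + h)) ?lerDl ?(ltW h0) ?(ltW hcd)//; last exact: oitgB.
    rewrite [X in _ = _ + X]oint_eq0 ?addr0// => x /andP[xc xd].
    by rewrite /phi P1 ?(ltW xc)// P0 ?(ltW xd)// subr0 mulr1 subrr.
  by rewrite ointB//; ring.
set A1 := oint a b _ in Ac *; set A2 := oint a b _ in Ad *.
set E1 := oint c (c + h) _; set E2 := oint d (d + h) _ => E.
have e1 : `|E1| <= e.
  have ig1 : oitg c (c + h) g by apply: oitgS igc' => //; exact: ltW.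
  have ig2 : oitg c (c + h) (fun x => g x * phi x).
    by apply: oitgS igc => //; exact: ltW.
  apply: le_trans H3; apply: (le_trans (oint_norm _)); first exact: oitgB.
  apply: oint_le; [by apply: oitg_norm; exact: oitgB|exact: oitg_norm|].
  move=> x /andP[xc xd]; rewrite -[X in _ - X]mulr1 -mulrBr normrM ler_piMr//.
  rewrite /phi (P0 d) ?subr0; last by rewrite ltW// (lt_trans xd).
  by have /andP[? ?] := P01 c x; rewrite ler_norml; apply/andP; split; lra.
have e2 : `|E2| <= e.
  have ig1 : oitg d (d + h) g by apply: oitgS itg; exact: ltW.
  have ig2 : oitg d (d + h) (fun x => g x * phi x).
    by apply: oitgS igphi; exact: ltW.
  apply: le_trans H4; apply: (le_trans (oint_norm _)) => //.
  apply: oint_le; [exact: oitg_norm|exact: oitg_norm|].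
  by move=> x _; rewrite normrM ler_piMr.
move: Ac Ad e1 e2; rewrite !ler_norml => /andP[? ?] /andP[? ?] /andP[? ?] /andP[? ?].
have -> : u d - u c - oint c d g = (A1 - u c) - (A2 - u d) + E1 + E2.
  lra.
by apply/andP; split; lra.
Unshelve. all: by end_near. Qed.

Lemma eq_of_ae_continuous a b f g : a < b ->
  {within `[a, b], continuous f} -> {within `[a, b], continuous g} ->
  f = g %[ae mu in `]a, b[%classic] -> forall x, a <= x <= b -> f x = g x.
Proof.
move=> ab cf cg fg x /andP[ax xb]; apply/eqP; rewrite -subr_eq0 -normr_eq0.
rewrite eq_le normr_ge0 andbT leNgt; apply/negP => D0.
have cD : {within `[a, b], continuous (fun x => f x - g x)}.
  by move=> z; apply: cvgB; [exact: cf|exact: cg].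
have xab : `[a, b]%classic x by rewrite /= in_itv/= ax xb.
have := (subspace_continuousP _ _).1 cD x xab.
move=> /cvgrPdist_lt/(_ _ D0).
move=> /nbhs_ballP[r /= r0 Hr].
have lr : Num.max a (x - r) < Num.min b (x + r).
  by rewrite lt_min !gt_max ab/=; apply/andP; split; [lra|apply/andP; split; lra].
have [y] := ae_exists lr fg.
rewrite lt_min gt_max => /andP[/andP[ay xry] /andP[yb yxr]] E.
have {}E : f y = g y by apply: E; rewrite /= in_itv/= ay yb.
have H : ball x r y by rewrite /ball/= ltr_norml; apply/andP; split; lra.
have M : y \in `[a, b]%R by rewrite in_itv/= !ltW.
by have := Hr y H M; rewrite /from_subspace/= E subrr subr0 ltxx.
Qed.

(** Almost every point is a Lebesgue point; the increments from one of them, c,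
    determine u almost everywhere. *)
Lemma weak_derivative_primitive a b u g : a < b -> oitg a b u -> oitg a b g ->
  is_weak_derivative a b u g ->
  exists2 C : R -> R, primitive a b C g & C = u %[ae mu in `]a, b[%classic].
Proof.
move=> ab itu itg wg.
have lpt : {ae mu, forall x, lebesgue_pt (u \_ `]a, b[) x}.
  apply: lebesgue_differentiation; apply: open_integrable_locally; first exact: openT.
  exact/oitg_restrict.
have [c /andP[ac cb] lc] := ae_exists ab lpt.
have pI k : primitive a b (fun x => k + oint a x g) g.
  split => // x y ax xy yb; rewrite (@oint_split _ a y x) ?ax//.
    by ring.
  exact: oitgS itg.
exists (fun x => (u c - oint a c g) + oint a x g) => //.
apply: ae_imp lpt => x lx /=; rewrite in_itv/= => /andP[ax xb].
have [xc|cx|->] := ltgtP x c; last by rewrite subrK.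
  have := weak_derivative_increment itu itg wg ax xc cb lx lc.
  have := (pI 0).2 x c (ltW ax) (ltW xc) (ltW cb); lra.
have := weak_derivative_increment itu itg wg ac cx xb lc lx.
have := (pI 0).2 c x (ltW ac) (ltW cx) (ltW xb); lra.
Qed.

Lemma H1_representative a b u : a < b -> H1 a b u ->
  [/\ sq a b u, sq a b (weak_derivative a b u),
     primitive a b (continuous_representative a b u) (weak_derivative a b u) &
     continuous_representative a b u = u %[ae mu in `]a, b[%classic]].
Proof.
move=> ab [/L2P su /xgetPex -/(_ (cst 0)) []].
rewrite -/(weak_derivative a b u) => /L2P sg wg.
have [C pC Cu] := weak_derivative_primitive ab (sq_itg su) (sq_itg sg) wg.
have cC := primitive_continuous (ltW ab) pC.
have [cc cu] : [set c | {within `[a, b], continuous c} /\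
    c = u %[ae mu in `]a, b[%classic]] (continuous_representative a b u).
  by apply: xgetPex; exists C.
have E : forall x, a <= x <= b -> continuous_representative a b u x = C x.
  apply: eq_of_ae_continuous => //.
  by apply: ae_imp (ae_and cu Cu) => x [h1 h2] xab; rewrite h1// h2.
split => //; split; first exact: sq_itg.
move=> x y ax xy yb; rewrite !E ?pC.2//; first by rewrite ax (le_trans xy).
by rewrite yb (le_trans ax).
Qed.

End WeakDerivatives.

(** * Fubini for convolutions *)

Section Convolution.
Context {R : realType}.
Local Notation mu := (@lebesgue_measure R).
Implicit Types (a b c d k x y : R) (j f : R -> R).

(** The kernel is bounded and f is integrable, so the double integral converges
    absolutely. *)
Lemma convolution_Fubini j k a b c d f : continuous j -> (forall x, `|j x| <= k) ->
  oitg c d f ->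
  oitg a b (fun x => oint c d (fun y => j (x - y) * f y)) /\
  oint a b (fun x => oint c d (fun y => j (x - y) * f y)) =
  oint c d (fun y => oint a b (fun x => j (x - y)) * f y).
Proof.
move=> cj jk itf.
pose A : set R := `]a, b[%classic; pose B : set R := `]c, d[%classic.
pose F (z : measurableTypeR R * measurableTypeR R) : \bar R := ((\1_A z.1 : R) * (j (z.1 - z.2) * (f \_ B) z.2))%:E.
have mj : measurable_fun setT j by exact: continuous_measurable_fun.
have mfB : measurable_fun setT (f \_ B) by apply/restrict_meas; exact: oitg_meas itf.
have mF : measurable_fun setT F.
  apply/measurable_EFinP; apply: measurable_funM.
    have m1A : measurable_fun setT (\1_A : R -> R) by apply: measurable_indic; exact: measurable_itv.
    exact: (measurableT_comp m1A measurable_fst).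
  apply: measurable_funM; last exact: (measurableT_comp mfB measurable_snd).
  apply: (measurableT_comp mj); apply: measurable_funB.
    exact: measurable_fst.
  exact: measurable_snd.
have shl x : continuous (fun y => j (x - y)).
  move=> y; apply: continuous_comp; last exact: cj.
  by apply: cvgB; [exact: cvg_cst|exact: cvg_id].
have shr y : continuous (fun x => j (x - y)).
  move=> x; apply: continuous_comp; last exact: cj.
  by apply: cvgB; [exact: cvg_id|exact: cvg_cst].
have ijf x : oitg c d (fun y => j (x - y) * f y).
  apply: (@oitg_mulb _ _ _ k) => //.
  by apply: measurable_funTS; exact: continuous_measurable_fun.
have E1 x : (\int[mu]_y F (x, y) =
    (((fun x => oint c d (fun y => j (x - y) * f y)) \_ A) x)%:E)%E.
  rewrite /F/= patchE indicE; case: ifPn => xA.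
    rewrite EFin_oint//.
    rewrite [RHS]integral_mkcond; apply: eq_integral => y _ /=.
    by rewrite mul1r !patchE; case: ifP => _//; rewrite mulr0.
  under eq_integral do rewrite mul0r; by rewrite integral0.
have E2 y : (\int[mu]_x F (x, y) =
    (((fun y => oint a b (fun x => j (x - y)) * f y) \_ B) y)%:E)%E.
  rewrite /F/= [in RHS]patchE; case: ifPn => yB.
    rewrite mulrC -ointZ; last first.
      by apply: oitg_continuous; exact: continuous_subspaceT.
    rewrite (@eq_oint _ _ _ _ (fun x => j (x - y) * f y)); last by move=> ? _; rewrite mulrC.
    rewrite EFin_oint; last first.
      apply: eq_oitg (@oitgZ _ a b (f y) (fun x => j (x - y)) _).
        by move=> ? _; rewrite mulrC.
      by apply: oitg_continuous; exact: continuous_subspaceT.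
    rewrite [RHS]integral_mkcond; apply: eq_integral => x _ /=.
    by rewrite indicE !patchE yB; case: (x \in A); rewrite ?mul1r ?mul0r.
  under eq_integral do rewrite patchE (negbTE yB) !mulr0; by rewrite integral0.
have iF : (mu \x mu)%E.-integrable setT F.
  apply/integrable12ltyP; first exact: mF.
  pose N := oint c d (fun y => `|f y|).
  apply: (@le_lt_trans _ _ (\int[mu]_x ((cst (k * N) \_ A) x)%:E)%E).
    apply: ge0_le_integral => //.
    - by move=> x _; apply: integral_ge0.
    - apply: (measurable_fun_fubini_tonelli_F (m2 := mu) (abse \o F)).
        exact: measurableT_comp.
      by move=> x; exact: abse_ge0.
    - by apply/measurable_EFinP; apply/restrict_meas.
    - move=> x _; rewrite /F/= patchE indicE; case: ifPn => xA; last first.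
        by under eq_integral do rewrite mul0r normr0; rewrite integral0.
      apply: (@le_trans _ _ (oint c d (fun y => `|j (x - y) * f y|))%:E).
        rewrite EFin_oint; last exact/oitg_norm/ijf.
        rewrite le_eqVlt; apply/orP; left; apply/eqP.
        rewrite [RHS]integral_mkcond; apply: eq_integral => y _ /=.
        by rewrite mul1r !patchE; case: ifP => _//; rewrite mulr0 normr0.
      rewrite lee_fin /N -ointZ; last exact: oitg_norm.
      apply: oint_le; [exact/oitg_norm/ijf|by apply: oitgZ; exact: oitg_norm|].
      by move=> y _; rewrite normrM ler_wpM2r.
  apply: integrable_lty => //.
  exact: (oitg_restrict a b (fun=> k * N)).1 (oitg_cst _ _ _).
have iF1 := integrable_fubini_F iF.
have EF1 : (fun x => \int[mu]_y F (x, y))%E = EFin \o ((fun x => oint c d (fun y => j (x - y) * f y)) \_ A).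
  by apply/funext => x; rewrite E1.
have ioA : oitg a b (fun x => oint c d (fun y => j (x - y) * f y)).
  by apply/oitg_restrict; rewrite -EF1; exact: iF1.
split => //.
have := Fubini iF.
under eq_integral => x _ do rewrite E1.
under [X in _ = X -> _]eq_integral => y _ do rewrite E2.
move=> /(congr1 fine); rewrite /oint => H.
by rewrite Rintegral_mkcond [RHS]Rintegral_mkcond.
Qed.

End Convolution.

(** * Energy estimate for the nonlocal coupling *)

Section Kernel.
Context {R : realType}.
Implicit Types (x y z s b d L G : R) (f g phi : R -> R).

Lemma antiderivative f a : continuous f -> (forall z, a <= `|z| -> f z = 0) ->
  exists F : R -> R, forall x, is_derive x 1 F (f x).
Proof.
move=> cf f0.
have itf x y : oitg x y f by apply: oitg_continuous; exact: continuous_subspaceT.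
have iT : (@lebesgue_measure R).-integrable setT (EFin \o f).
  have := (oitg_restrict (- a) a f).1 (itf _ _).
  congr (_.-integrable _ _); apply/funext => x; rewrite /= patchE; case: ifPn => //.
  rewrite notin_setE/= in_itv/= => /negP h; rewrite f0//.
  by rewrite leNgt; apply: contraNN h; rewrite ltr_norml.
exists (fun x => \int[@lebesgue_measure R]_(t in `]-oo, x]) f t) => x.
have [] := @continuous_FTC1 _ f -oo%O x (x + 1).
- by rewrite ltrDl.
- exact: integrableS iT.
- by rewrite ltNyr.
- exact: cf.
by move=> d1 d2; split; [exact: d1 | rewrite -derive1E; exact: d2].
Qed.

Lemma taylor2 b d (c p g : R -> R) L : 0 <= L ->
  primitive b d c p -> primitive b d p g ->
  (forall x y, b <= x <= d -> b <= y <= d -> `|g x - g y| <= L * `|x - y|) ->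
  forall x y, b <= x <= d -> b <= y <= d ->
  `|c y - c x - p x * (y - x) - g x / 2 * (y - x) ^+ 2| <= L * `|y - x| ^+ 3.
Proof.
move=> L0 pc pp gL x y xbd ybd.
have between z t : b <= t <= d -> Num.min x t < z < Num.max x t ->
    b <= z <= d /\ `|z - x| <= `|t - x|.
  move=> /andP[bt td]; have /andP[bx xd] := xbd.
  rewrite gt_min lt_max => /andP[/orP[h1|h1] /orP[h2|h2]]; split; try lra.
  - by rewrite !ger0_norm; lra.
  - by rewrite !ler0_norm; lra.
have pol : primitive b d (fun s => g x * s) (fun=> g x).
  apply: primitive_of_derive; last exact: cst_continuous.
  by move=> s; apply: is_derive_eq; rewrite /GRing.scale/=; ring.
have T1 t : b <= t <= d -> `|p t - p x - g x * (t - x)| <= L * `|t - x| ^+ 2.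
  move=> tbd; have := @primitive_lip _ _ _ _ _ (L * `|t - x|) x t (primitiveB pp pol) xbd tbd.
  rewrite -mulrA -expr2 (_ : p t - g x * t - (p x - g x * x) = p t - p x - g x * (t - x)); last by ring.
  apply=> z zxt; have [zbd zt] := between z t tbd zxt.
  by rewrite (le_trans (gL _ _ zbd xbd))// ler_wpM2l.
have pol2 : primitive b d (fun s => p x * s + g x / 2 * (s - x) * (s - x))
    (fun s => p x + g x * (s - x)).
  apply: primitive_of_derive.
    by move=> s; apply: is_derive_eq; rewrite /GRing.scale/=; field.
  move=> s; apply: cvgD; first exact: cvg_cst.
  apply: cvgM; first exact: cvg_cst.
  by apply: cvgB; [exact: cvg_id|exact: cvg_cst].
have := @primitive_lip _ _ _ _ _ (L * `|y - x| ^+ 2) x y (primitiveB pc pol2) xbd ybd.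
rewrite -[L * _ * _]mulrA -exprSr.
rewrite (_ : c y - (p x * y + g x / 2 * (y - x) * (y - x)) -
  (c x - (p x * x + g x / 2 * (x - x) * (x - x))) =
  c y - c x - p x * (y - x) - g x / 2 * (y - x) ^+ 2); last by field.
apply=> z zxy; have [zbd zy] := between z y ybd zxy.
rewrite opprD addrA (le_trans (T1 z zbd))// ler_wpM2l// ler_pXn2r ?nnegrE//.
Qed.

(* j is a symmetric kernel of range a. Its truncated moments, in which the layers
   at 0 and 1 are visible, are increments of the antiderivatives j0, j1, j2. *)
Context (j j0 j1 j2 : R -> R) (a k : R).
Hypotheses (j_ge0 : forall z, 0 <= j z) (j_even : forall z, j (- z) = j z)
  (j_cont : continuous j) (j_out : forall z, a <= `|z| -> j z = 0)
  (j_le : forall z, j z <= k)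
  (dj0 : forall z, is_derive z 1 j0 (j z))
  (dj1 : forall z, is_derive z 1 j1 (z * j z))
  (dj2 : forall z, is_derive z 1 j2 (z ^+ 2 * j z))
  (a_gt0 : 0 < a) (a_lt : 2 * a < 1).

Let m := j0 a - j0 (- a).
Let M := j2 a - j2 (- a).

Ltac klra := move: (a_gt0) (a_lt) => ? ?; lra.

Lemma cont_j1 : continuous (fun z => z * j z).
Proof. by move=> z; apply: cvgM; [exact: cvg_id|exact: j_cont]. Qed.

Lemma cont_j2 : continuous (fun z => z ^+ 2 * j z).
Proof.
move=> z; apply: cvgM; last exact: j_cont.
by rewrite expr2; apply: cvgM; exact: cvg_id.
Qed.

Lemma prim_out F f x y : (forall z, is_derive z 1 F (f z)) -> continuous f ->
  (forall z, a <= `|z| -> f z = 0) -> (a <= x <= y) || (x <= y <= - a) -> F x = F y.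
Proof.
move=> dF cf f0 xy; have xley : x <= y by case/orP : xy => /andP[].
have [_ /(_ x y (lexx _) xley (lexx _)) E] := primitive_of_derive x y dF cf.
apply/esym/eqP; rewrite -subr_eq0 E oint_eq0// => z /andP[xz zy].
apply: f0; case/orP : xy => /andP[h1 h2].
  by rewrite (le_trans h1)// (le_trans (ltW xz))// ler_norm.
by rewrite ler_normr; apply/orP; right; klra.
Qed.

Lemma j1_even z : j1 (- z) = j1 z.
Proof.
have d0 x : is_derive x 1 (fun x => j1 x - j1 (-1 * x + 0)) 0.
  apply: (is_derive_eq (is_deriveB (dj1 x) (@is_derive_affine _ j1 _ _ _ _ dj1))).
  by rewrite addr0 !mulN1r j_even; ring.
have := @is_derive_0_is_cst _ _ z 0 d0.
by rewrite !mulr0 !addr0 mulN1r subrr => /eqP; rewrite subr_eq0 => /eqP.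
Qed.

Lemma j2_odd z : j2 (- z) = 2 * j2 0 - j2 z.
Proof.
have d0 x : is_derive x 1 (fun x => j2 x + j2 (-1 * x + 0)) 0.
  apply: (is_derive_eq (is_deriveD (dj2 x) (@is_derive_affine _ j2 _ _ _ _ dj2))).
  by rewrite addr0 !mulN1r j_even; ring.
have := @is_derive_0_is_cst _ _ z 0 d0.
by rewrite !mulr0 !addr0 mulN1r; klra.
Qed.

Lemma shift_primitive F f b c x : (forall z, is_derive z 1 F (f z)) ->
  continuous f -> b <= c -> oint b c (fun y => f (y - x)) = F (c - x) - F (b - x).
Proof.
move=> dF cf bc.
have dS z : is_derive z 1 (fun y => F (1 * y + - x)) (f (z - x)).
  apply: (is_derive_eq (@is_derive_affine _ F _ _ _ _ dF)).
  by rewrite !mul1r.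
have cS : continuous (fun y => f (y - x)).
  move=> y; apply: continuous_comp; last exact: cf.
  by apply: cvgB; [exact: cvg_id|exact: cvg_cst].
have [_ /(_ b c (lexx _) bc (lexx _)) <-] := primitive_of_derive b c dS cS.
by rewrite !mul1r.
Qed.

Lemma j_sub x y : j (x - y) = j (y - x).
Proof. by rewrite -opprB j_even. Qed.

(** rho is the rate of exchange of the point x with ]-1, 0[. kappa is the moment of
    the kernel over [x, a]: the weight with which the nonlocal operator sees a flux
    through 0, spread over the layer ]0, a[. *)
Definition rho x := oint (-1) 0 (fun y => j (x - y)).
Definition kappa x := j1 a - j1 x.

Lemma rhoE x : rho x = j0 (x + 1) - j0 x.
Proof.
rewrite /rho (eq_oint (g := fun y => j (y - x))); last by move=> y _; exact: j_sub.
rewrite (shift_primitive _ dj0 j_cont); last by rewrite oppr_le0.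
rewrite sub0r; have d0 z : is_derive z 1 (fun z => j0 z + j0 (-1 * z + 0)) 0.
  apply: (is_derive_eq (is_deriveD (dj0 z) (@is_derive_affine _ j0 _ _ _ _ dj0))).
  by rewrite addr0 !mulN1r j_even; ring.
have := @is_derive_0_is_cst _ _ x 0 d0; have := @is_derive_0_is_cst _ _ (x + 1) 0 d0.
rewrite !mulr0 !addr0 !mulN1r opprD => h1 h2.
by rewrite [-1 - x]addrC; klra.
Qed.

Lemma j0_mono x y : x <= y -> j0 x <= j0 y.
Proof.
move=> xy; rewrite -subr_ge0.
have [_ ->//] := primitive_of_derive x y dj0 j_cont.
by apply: oint_ge0 => z _.
Qed.

Lemma rho_ge0 x : 0 <= rho x.
Proof. by rewrite rhoE subr_ge0 j0_mono// lerDl. Qed.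

Lemma rhoE' x : 0 <= x -> rho x = j0 a - j0 x \/ a <= x /\ rho x = 0.
Proof.
move=> x0; rewrite rhoE; have [ax|xa] := leP a x.
  right; split => //; rewrite (@prim_out j0 j x (x + 1)) ?subrr//.
  by rewrite ax lerDl ler01.
by left; rewrite (@prim_out j0 j a (x + 1))//; apply/orP; left; apply/andP; split; klra.
Qed.

Lemma rho_out x : a <= x -> rho x = 0.
Proof.
move=> ax; have [|E|[]//] := rhoE' (x := x); first exact: le_trans (ltW a_gt0) _.
by rewrite E (@prim_out j0 j a x) ?subrr// lexx ax.
Qed.

Lemma rho_le x : 0 <= x -> rho x <= m.
Proof.
move=> x0; have mp : 0 <= m by rewrite subr_ge0 j0_mono//; klra.
have [->|[_ ->]//] := rhoE' x0.
by rewrite /m lerD2l lerN2 j0_mono//; klra.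
Qed.

Lemma kappa_out x : a <= x -> kappa x = 0.
Proof.
move=> ax; rewrite /kappa (@prim_out j1 (fun z => z * j z) a x) ?subrr ?lexx ?ax//.
  exact: cont_j1.
by move=> z az; rewrite j_out ?mulr0.
Qed.

(** On the support of the kernel z <= a. By this comparison the coupling term can
    absorb the spread flux. *)
Lemma kappa_bnd x : 0 <= x -> 0 <= kappa x <= a * rho x.
Proof.
move=> x0; have [ax|xa] := leP a x; first by rewrite kappa_out// rho_out// mulr0 lexx.
have i1 := (primitive_of_derive x a dj1 cont_j1).
have i0 := (primitive_of_derive x a dj0 j_cont).
have -> : rho x = j0 a - j0 x.
  by have [//|[ax]] := rhoE' x0; move: xa; rewrite ltNge ax.
rewrite /kappa i1.2 ?(ltW xa)// i0.2 ?(ltW xa)//.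
rewrite oint_ge0/=; last first.
  by move=> z /andP[xz _]; rewrite mulr_ge0// (le_trans x0)// ltW.
rewrite -ointZ; last exact: i0.1.
apply: oint_le; [exact: i1.1|by apply: oitgZ; exact: i0.1|].
by move=> z /andP[_ za]; rewrite ler_wpM2r// ltW.
Qed.

Lemma is_derive_kappa x : is_derive x 1 kappa (- (x * j x)).
Proof.
apply: (is_derive_eq (is_deriveB (is_derive_cst (j1 a) x 1) (dj1 x))).
by rewrite sub0r.
Qed.

Lemma kappa_cont : continuous kappa.
Proof.
move=> x; apply: differentiable_continuous; apply/derivable1_diffP.
exact: (@ex_derive _ _ _ _ _ _ _ (is_derive_kappa x)).
Qed.

(** Integration by parts: the primitive of kappa is x kappa(x) + j2 x, and half of
    the second moment M lies on the positive side. *)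
Lemma kappa_mass : oint 0 1 kappa = M / 2.
Proof.
have dF x : is_derive x 1 (fun x => x * kappa x + j2 x) (kappa x).
  apply: (is_derive_eq (is_deriveD (is_deriveM (is_derive_id x 1) (is_derive_kappa x)) (dj2 x))).
  by rewrite /GRing.scale/=; ring.
have [_ /(_ 0 1 (lexx _) ler01 (lexx _)) <-] := primitive_of_derive 0 1 dF kappa_cont.
rewrite mul0r mul1r kappa_out; last klra.
rewrite /M j2_odd (@prim_out j2 (fun z => z ^+ 2 * j z) a 1) ?lexx//; try klra.
- exact: cont_j2.
- by move=> z az; rewrite j_out ?mulr0.
Qed.

Definition mass x := oint 0 1 (fun y => j (x - y)).
Definition mom1 x := oint 0 1 (fun y => j (x - y) * (y - x)).
Definition mom2 x := oint 0 1 (fun y => j (x - y) * (y - x) ^+ 2).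

Lemma mom1E x : mom1 x = j1 (1 - x) - j1 x.
Proof.
rewrite /mom1 (eq_oint (g := fun y => (y - x) * j (y - x))); last first.
  by move=> y _; rewrite j_sub mulrC.
by rewrite (shift_primitive _ dj1 cont_j1 ler01) sub0r j1_even.
Qed.

Lemma mom2E x : mom2 x = j2 (1 - x) - j2 (- x).
Proof.
rewrite /mom2 (eq_oint (g := fun y => (y - x) ^+ 2 * j (y - x))); last first.
  by move=> y _; rewrite j_sub mulrC.
by rewrite (shift_primitive _ dj2 cont_j2 ler01) sub0r.
Qed.

Lemma mom1_in x : a <= x <= 1 - a -> mom1 x = 0.
Proof.
move=> /andP[ax xa]; rewrite mom1E -[j1 x](subKr (j1 a)) -/(kappa x) kappa_out// subr0.
by rewrite -[j1 (1 - x)](subKr (j1 a)) -/(kappa _) kappa_out ?subr0 ?subrr//; klra.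
Qed.

Lemma mom1_left x : x < a -> mom1 x = kappa x.
Proof.
move=> xa; rewrite mom1E -[j1 (1 - x)](subKr (j1 a)) -/(kappa _) kappa_out ?subr0//.
by klra.
Qed.

Lemma mom1_right x : 1 - a < x -> mom1 x = - kappa (1 - x).
Proof.
move=> xa; rewrite mom1E -[j1 x](subKr (j1 a)) -/(kappa x) kappa_out ?subr0 /kappa//.
  by ring.
by klra.
Qed.

Lemma j2_mono x y : x <= y -> j2 x <= j2 y.
Proof.
move=> xy; rewrite -subr_ge0.
have [_ ->//] := primitive_of_derive x y dj2 cont_j2.
by apply: oint_ge0 => z _; rewrite mulr_ge0// sqr_ge0.
Qed.

Lemma mom2_in x : a <= x <= 1 - a -> mom2 x = M.
Proof.
move=> /andP[ax xa]; rewrite mom2E.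
have h z : a <= `|z| -> z ^+ 2 * j z = 0 by move=> az; rewrite j_out ?mulr0.
rewrite -(@prim_out j2 _ a (1 - x) dj2 cont_j2 h); last by apply/orP; left; apply/andP; split; klra.
by rewrite (@prim_out j2 _ (- x) (- a) dj2 cont_j2 h)//; apply/orP; right; apply/andP; split; klra.
Qed.

Lemma mom2_bnd x : 0 <= x <= 1 -> 0 <= mom2 x <= M.
Proof.
move=> /andP[x0 x1]; rewrite mom2E subr_ge0 j2_mono; last klra.
have h z : a <= `|z| -> z ^+ 2 * j z = 0 by move=> az; rewrite j_out ?mulr0.
rewrite /= /M lerB//.
  have [ax|xa] := leP a (1 - x); last by rewrite j2_mono// ltW.
  by rewrite (@prim_out j2 _ a (1 - x) dj2 cont_j2 h)// lexx ax.
have [ax|xa] := leP (- x) (- a); last by rewrite j2_mono// ltW.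
by rewrite (@prim_out j2 _ (- x) (- a) dj2 cont_j2 h)// lexx ax orbT.
Qed.

Definition conv f x := oint 0 1 (fun y => j (x - y) * f y).

Lemma j_norm z : `|j z| <= k.
Proof. by rewrite ger0_norm. Qed.

Lemma cont_shift x : continuous (fun y => j (x - y)).
Proof.
move=> y; apply: continuous_comp; last exact: j_cont.
by apply: cvgB; [exact: cvg_cst|exact: cvg_id].
Qed.

Lemma meas_shift x b d : measurable_fun `]b, d[ (fun y => j (x - y)).
Proof. by apply: measurable_funTS; apply: continuous_measurable_fun; exact: cont_shift. Qed.

Lemma itg_shift x b d : oitg b d (fun y => j (x - y)).
Proof. by apply: (@oitg_bnd _ _ _ k); [exact: meas_shift|move=> y _; exact: j_norm]. Qed.

Lemma itg_conv f x : oitg 0 1 f -> oitg 0 1 (fun y => j (x - y) * f y).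
Proof.
by apply: (@oitg_mulb _ _ _ k); [exact: meas_shift|move=> y _; exact: j_norm].
Qed.

Lemma conv_bnd f x : oitg 0 1 f -> `|conv f x| <= k * oint 0 1 (fun y => `|f y|).
Proof.
move=> itf; apply: (le_trans (oint_norm (itg_conv x itf))).
rewrite -ointZ; last exact: oitg_norm.
apply: oint_le; [exact/oitg_norm/itg_conv|exact/oitgZ/oitg_norm|].
by move=> y _; rewrite normrM ler_wpM2r// j_norm.
Qed.

Lemma conv_meas f : oitg 0 1 f -> measurable_fun `]0, (1 : R)[ (conv f).
Proof.
by move=> itf; have [h _] := convolution_Fubini 0 1 j_cont j_norm itf; exact: oitg_meas h.
Qed.

Lemma mass_conv x : mass x = conv (fun=> 1) x.
Proof. by apply: eq_oint => y _; rewrite mulr1. Qed.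

Lemma mass_bnd x : `|mass x| <= k.
Proof.
have := conv_bnd x (oitg_cst 0 1 1); rewrite -mass_conv => /le_trans; apply.
by rewrite normr1 oint_cst// subr0 !mulr1.
Qed.

Lemma mass_meas : measurable_fun `]0, (1 : R)[ mass.
Proof.
have := conv_meas (oitg_cst 0 1 1); congr (measurable_fun _ _).
by apply/funext => x; rewrite mass_conv.
Qed.

Lemma massP f x : oitg 0 1 f ->
  oint 0 1 (fun y => j (x - y) * (f y - f x)) = conv f x - mass x * f x.
Proof.
move=> itf; rewrite [mass x * _]mulrC /mass -ointZ; last exact: itg_shift.
rewrite -ointB; [|exact: itg_conv|by apply: oitgZ; exact: itg_shift].
by apply: eq_oint => y _; ring.
Qed.

Lemma itg_phi_conv phi : sq 0 1 phi ->
  oitg 0 1 (fun x => phi x * (conv phi x - mass x * phi x)).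
Proof.
move=> sphi; have [mphi phi2] := sphi; have iphi := sq_itg sphi.
apply: (@eq_oitg _ _ _ (fun x => conv phi x * phi x - mass x * phi x ^+ 2)).
  by move=> x _; ring.
apply: oitgB.
  apply: oitg_mulb; [exact: conv_meas|by move=> x _; exact: conv_bnd|exact: iphi].
by apply: oitg_mulb phi2; [exact: mass_meas|move=> x _; exact: mass_bnd].
Qed.

(** By (b - a) a <= (b^2 - a^2) / 2 the quadratic form is at most half the
    difference of two integrals that agree by Fubini and the symmetry of the
    kernel. *)
Lemma conv_accretive phi : sq 0 1 phi ->
  oint 0 1 (fun x => phi x * (conv phi x - mass x * phi x)) <= 0.
Proof.
move=> sphi; have [mphi phi2] := sphi; have iphi := sq_itg sphi.
have [ic cE] := convolution_Fubini 0 1 j_cont j_norm phi2.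
have im : oitg 0 1 (fun x => mass x * phi x ^+ 2).
  by apply: oitg_mulb phi2; [exact: mass_meas|move=> x _; exact: mass_bnd].
have E : oint 0 1 (conv (fun y => phi y ^+ 2)) = oint 0 1 (fun x => mass x * phi x ^+ 2).
  rewrite cE; apply: eq_oint => y _; congr (_ * _).
  by apply: eq_oint => x _; exact: j_sub.
apply: (@le_trans _ _ (oint 0 1 (fun x => 2^-1 * (conv (fun y => phi y ^+ 2) x - mass x * phi x ^+ 2)))).
  apply: oint_le; [exact: itg_phi_conv|by apply: oitgZ; exact: oitgB|].
  move=> x _; rewrite -[mass x * phi x ^+ 2]/(mass x * (fun y => phi y ^+ 2) x) -!massP//.
  rewrite -ointZ; last first.
    by apply: itg_conv; apply: oitgB => //; exact: oitg_cst.
  rewrite -ointZ; last first.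
    by apply: itg_conv; apply: oitgB => //; exact: oitg_cst.
  apply: oint_le.
  - by apply: oitgZ; apply: itg_conv; apply: oitgB => //; exact: oitg_cst.
  - by apply: oitgZ; apply: itg_conv; apply: oitgB => //; exact: oitg_cst.
  - move=> y _; rewrite !(mulrCA _ (j _)) ler_wpM2l//.
    rewrite -subr_ge0 (_ : _ - _ = 2^-1 * (phi y - phi x) ^+ 2); last by field.
    by rewrite mulr_ge0 ?sqr_ge0// invr_ge0.
rewrite ointZ; last exact: oitgB.
by rewrite ointB// E subrr mulr0.
Qed.

Section Consistency.
Context (c p g : R -> R) (L G mu C1 : R).
Hypotheses (pc : primitive (-1) 1 c p) (pp : primitive (-1) 1 p g)
  (p_1 : p 1 = 0) (p_N1 : p (-1) = 0)
  (L_ge0 : 0 <= L) (G_ge0 : 0 <= G)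
  (gG : forall x, -1 <= x <= 1 -> `|g x| <= G)
  (gL : forall x y, -1 <= x <= 1 -> -1 <= y <= 1 -> `|g x - g y| <= L * `|x - y|)
  (m_le : a ^+ 2 * m <= mu) (M_gt0 : 0 < M) (C1E : C1 = 2 / M).

(** The consistency error of the nonlocal operator at c, after the removal of the
    flux p 0 through the interface. *)
Definition resid x :=
  g x - C1 * (oint 0 1 (fun y => j (x - y) * (c y - c x)) - p 0 * kappa x).

Let itg_c : oitg 0 1 c.
Proof. by apply: oitgS (primitive_itg pc) => //; rewrite oppr_le0. Qed.

(** Only |y - x| <= a contributes, so that one factor of the cubic Taylor remainder
    is at most a and the others give the second moment. *)
Lemma nonlocal_expansion x : 0 < x < 1 ->
  `|oint 0 1 (fun y => j (x - y) * (c y - c x)) - p x * mom1 x - g x / 2 * mom2 x|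
    <= L * a * mom2 x.
Proof.
move=> /andP[x0 x1].
have cs : continuous (fun y => y - x).
  by move=> y; apply: cvgB; [exact: cvg_id|exact: cvg_cst].
have i1 : oitg 0 1 (fun y => j (x - y) * (y - x)).
  by apply: itg_conv; apply: oitg_continuous; exact: continuous_subspaceT.
have i2 : oitg 0 1 (fun y => j (x - y) * (y - x) ^+ 2).
  apply: itg_conv; apply: oitg_continuous; apply: continuous_subspaceT => y.
  by apply: (@cvgM _ _ _ _ (fun y => y - x) (fun y => y - x)); exact: cs.
have i0 : oitg 0 1 (fun y => j (x - y) * (c y - c x)).
  by apply: itg_conv; apply: oitgB => //; exact: oitg_cst.
rewrite /mom1 -(ointZ (p x) i1) -(ointZ (g x / 2) i2).
rewrite -ointB//; last exact: oitgZ.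
rewrite -ointB//; [|by apply: oitgB => //; exact: oitgZ|exact: oitgZ].
rewrite -(ointZ (L * a) i2).
have iD := oitgB (oitgB i0 (oitgZ (p x) i1)) (oitgZ (g x / 2) i2).
apply: (le_trans (oint_norm iD)); apply: oint_le; [exact: oitg_norm|exact: oitgZ|].
move=> y /andP[y0 y1].
have -> : j (x - y) * (c y - c x) - p x * (j (x - y) * (y - x)) -
    g x / 2 * (j (x - y) * (y - x) ^+ 2) = j (x - y) *
   (c y - c x - p x * (y - x) - g x / 2 * (y - x) ^+ 2) by ring.
rewrite normrM (ger0_norm (j_ge0 _)) [leRHS]mulrCA.
have [h|h] := leP a `|x - y|; first by rewrite j_out// !mul0r.
rewrite ler_wpM2l//; apply: le_trans.
  apply: (@taylor2 (-1) 1 _ _ _ L) => //; apply/andP; split; lra.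
rewrite -(real_normK (num_real (y - x))) exprS mulrA.
by rewrite ler_wpM2r ?exprn_ge0// ler_wpM2l// distrC ltW.
Qed.

Lemma m_ge0 : 0 <= m.
Proof. by rewrite subr_ge0 j0_mono//; klra. Qed.

Lemma mu_ge0 : 0 <= mu.
Proof. by apply: le_trans m_le; rewrite mulr_ge0 ?sqr_ge0// m_ge0. Qed.

Lemma C1_gt0 : 0 < C1.
Proof. by rewrite C1E divr_gt0. Qed.

Lemma C1M : C1 * M = 2.
Proof. by rewrite C1E divfK// gt_eqF. Qed.

Lemma p_lip x y : -1 <= x <= 1 -> -1 <= y <= 1 -> `|p y - p x| <= G * `|y - x|.
Proof.
move=> xI yI; apply: (primitive_lip pp) => // z /andP[].
rewrite gt_min lt_max => /orP h1 /orP h2; apply: gG; move: xI yI => /andP[? ?] /andP[? ?].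
by apply/andP; split; case: h1; case: h2; lra.
Qed.

Lemma p_bnd x : -1 <= x <= 1 -> `|p x| <= 2 * G.
Proof.
move=> xI; have := @p_lip (-1) x _ xI; rewrite p_N1 subr0 => /(_ _)/le_trans; apply.
  by apply/andP; split; lra.
rewrite mulrC ler_wpM2r//; move: xI => /andP[? ?].
by rewrite ger0_norm; lra.
Qed.

Lemma c_lip x y : -1 <= x <= 1 -> -1 <= y <= 1 -> `|c y - c x| <= 2 * G * `|y - x|.
Proof.
move=> xI yI; apply: (primitive_lip pc) => // z /andP[].
rewrite gt_min lt_max => /orP h1 /orP h2; apply: p_bnd; move: xI yI => /andP[? ?] /andP[? ?].
by apply/andP; split; case: h1; case: h2; lra.
Qed.

Lemma kappa_mu x : 0 <= x -> a * kappa x <= mu.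
Proof.
move=> x0; have /andP[_ h] := kappa_bnd x0.
apply: le_trans m_le; rewrite expr2 -mulrA ler_wpM2l ?(ltW a_gt0)//.
by rewrite (le_trans h)// ler_wpM2l ?(ltW a_gt0)// rho_le.
Qed.

Lemma kappa_ge0 x : 0 <= x -> 0 <= kappa x.
Proof. by move=> /kappa_bnd/andP[]. Qed.

(** Inside the interval the odd moment cancels and the second moment gives g,
    which leaves the Taylor remainder; in the two boundary layers of width a it
    stays bounded, on the left after the subtraction of kappa and on the right
    because p vanishes at 1. *)
Lemma resid_in x : a <= x <= 1 - a -> `|resid x| <= 2 * L * a.
Proof.
move=> xa; have /andP[ax x1a] := xa.
have xI : 0 < x < 1 by apply/andP; split; klra.
have := nonlocal_expansion xI; rewrite mom1_in// mom2_in// mulr0 subr0 => h.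
rewrite /resid kappa_out// mulr0 subr0.
set I := oint 0 1 _ in h *.
have -> : g x - C1 * I = - (C1 * (I - g x / 2 * M)).
  by rewrite mulrBr [C1 * (_ * M)]mulrCA C1M; field.
rewrite normrN normrM (gtr0_norm C1_gt0) (le_trans (ler_wpM2l (ltW C1_gt0) h))//.
by rewrite [L * a * M]mulrC mulrA C1M mulrA.
Qed.

Definition bdry := G + C1 * G * mu + 2 * L.

Lemma resid_out x : 0 < x < 1 -> (x < a) || (1 - a < x) -> `|resid x| <= bdry.
Proof.
move=> xI xo; have /andP[x0 x1] := xI.
have xI' : 0 <= x <= 1 by rewrite !ltW.
have /andP[m2_0 m2_M] := mom2_bnd xI'.
have h := nonlocal_expansion xI.
have C0 := C1_gt0; have CM := C1M.
have a1 : a <= 1 by klra.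
have first : `|C1 * (p x * mom1 x - p 0 * kappa x)| <= C1 * G * mu.
  rewrite normrM (gtr0_norm C0) -mulrA ler_wpM2l ?(ltW C0)//.
  have [xa|ax] := ltP x a.
    rewrite mom1_left// -mulrBl normrM (ger0_norm (kappa_ge0 (ltW x0))).
    apply: (@le_trans _ _ (G * a * kappa x)).
      rewrite ler_wpM2r ?kappa_ge0 ?(ltW x0)//.
      apply: (le_trans (p_lip _ _)); try (apply/andP; split; lra).
      by rewrite subr0 ger0_norm ?(ltW x0)// ler_wpM2l// ltW.
    by rewrite -mulrA ler_wpM2l// kappa_mu// ltW.
  have {}xo : 1 - a < x by move: xo; rewrite ltNge ax.
  rewrite kappa_out// mulr0 subr0 mom1_right// mulrN normrN normrM.
  have x1' : 0 <= 1 - x by lra.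
  rewrite (ger0_norm (kappa_ge0 x1')).
  apply: (@le_trans _ _ (G * a * kappa (1 - x))).
    rewrite ler_wpM2r ?kappa_ge0//.
    have := @p_lip 1 x; rewrite p_1 subr0 => /(_ _ _)/le_trans; apply; try (apply/andP; split; lra).
    by rewrite ler_wpM2l// ler0_norm; lra.
  by rewrite -mulrA ler_wpM2l// kappa_mu.
have second : `|g x * (1 - C1 / 2 * mom2 x)| <= G.
  rewrite normrM -[leRHS]mulr1 ler_pM// ?gG//; first by apply/andP; split; lra.
  by rewrite ler_norml; apply/andP; split; nra.
rewrite /resid; set I := oint 0 1 _ in h *.
have -> : g x - C1 * (I - p 0 * kappa x) =
  g x * (1 - C1 / 2 * mom2 x) - C1 * (p x * mom1 x - p 0 * kappa x)
   - C1 * (I - p x * mom1 x - g x / 2 * mom2 x) by field.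
rewrite /bdry (le_trans (ler_normB _ _))//; apply: lerD.
  by rewrite (le_trans (ler_normB _ _))// lerD.
rewrite normrM (gtr0_norm C0) (le_trans (ler_wpM2l (ltW C0) h))//.
apply: (@le_trans _ _ (C1 * (L * a * M))).
  by rewrite ler_wpM2l ?(ltW C0)// ler_wpM2l// mulr_ge0// ltW.
rewrite [L * a * M]mulrC mulrA CM ler_wpM2l//.
by rewrite ler_piMr.
Qed.

Lemma itg_cs : sq 0 1 c.
Proof. by apply: sqS (primitive_sq pc) => //; rewrite oppr_le0. Qed.

Lemma resid_conv x : resid x = g x - C1 * (conv c x - mass x * c x - p 0 * kappa x).
Proof. by rewrite /resid massP. Qed.

Lemma kappa_meas : measurable_fun `]0, (1 : R)[ kappa.
Proof. by apply: measurable_funTS; apply: continuous_measurable_fun; exact: kappa_cont. Qed.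

Lemma g_meas : measurable_fun `]0, (1 : R)[ g.
Proof. by apply: oitg_meas; apply: oitgS pp.1 => //; rewrite oppr_le0. Qed.

Lemma resid_meas : measurable_fun `]0, (1 : R)[ resid.
Proof.
have -> : resid = fun x => g x - C1 * (conv c x - mass x * c x - p 0 * kappa x).
  by apply/funext => x; exact: resid_conv.
apply: measurable_funB; first exact: g_meas.
apply: measurable_funM => //; apply: measurable_funB.
  apply: measurable_funB; first exact: conv_meas.
  by apply: measurable_funM; [exact: mass_meas|exact: oitg_meas].
by apply: measurable_funM => //; exact: kappa_meas.
Qed.

Lemma bdry_ge0 : 0 <= bdry.
Proof.
by rewrite /bdry !addr_ge0// mulr_ge0// ?mu_ge0// mulr_ge0// ltW// C1_gt0.
Qed.

Lemma resid_sq : sq 0 1 resid.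
Proof.
apply: (@sq_bnd _ _ _ (2 * L * a + bdry)); first exact: resid_meas.
have L2a : 0 <= 2 * L * a by rewrite mulr_ge0 ?(ltW a_gt0)// mulr_ge0.
move=> x xI; have [xo|] := boolP ((x < a) || (1 - a < x)).
  by rewrite (le_trans (resid_out xI xo))// lerDr.
rewrite negb_or -!leNgt => xi; rewrite (le_trans (resid_in xi))// lerDl.
exact: bdry_ge0.
Qed.

(** The layers have total width 2 a, and inside resid is O(a). *)
Lemma resid_norm : oint 0 1 (fun x => resid x ^+ 2) <= 2 * a * (2 * L ^+ 2 + bdry ^+ 2).
Proof.
have [_ r2] := resid_sq.
have a1 : a <= 1 - a by klra.
have sqb b d K : 0 <= b -> b <= d -> d <= 1 -> 0 <= K ->
    (forall x, b < x < d -> `|resid x| <= K) ->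
    oint b d (fun x => resid x ^+ 2) <= K ^+ 2 * (d - b).
  move=> b0 bd d1 K0 rK.
  have rbd : oitg b d (fun x => resid x ^+ 2) by exact: oitgS r2.
  apply: (le_trans (ler_norm _)); apply: oint_bnd => // x xbd.
  by rewrite normrX ler_pXn2r ?nnegrE// rK.
rewrite (@oint_split _ 0 1 a)//; last by apply/andP; split; klra.
rewrite (@oint_split _ a 1 (1 - a))//; last 2 first.
- by apply/andP; split; klra.
- by apply: oitgS r2 => //; exact: ltW.
have h1 : oint 0 a (fun x => resid x ^+ 2) <= bdry ^+ 2 * (a - 0).
  apply: sqb => //; [exact: ltW|klra|exact: bdry_ge0|].
  move=> x /andP[x0 xa]; apply: resid_out; last by rewrite xa.
  by apply/andP; split; klra.
have h2 : oint a (1 - a) (fun x => resid x ^+ 2) <= (2 * L * a) ^+ 2 * (1 - a - a).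
  apply: sqb => //; [exact: ltW|klra| |].
    by rewrite mulr_ge0 ?(ltW a_gt0)// mulr_ge0.
  by move=> x /andP[xa xb]; apply: resid_in; rewrite !ltW.
have h3 : oint (1 - a) 1 (fun x => resid x ^+ 2) <= bdry ^+ 2 * (1 - (1 - a)).
  apply: sqb => //; [klra|klra|exact: bdry_ge0|].
  move=> x /andP[xa xb]; apply: resid_out; last by rewrite xa orbT.
  by apply/andP; split; klra.
have h4 : (2 * L * a) ^+ 2 * (1 - a - a) <= 4 * a * L ^+ 2.
  rewrite (_ : (2 * L * a) ^+ 2 * (1 - a - a) = (4 * a * L ^+ 2) * (a * (1 - a - a))).
    rewrite ler_piMr//; first by rewrite mulr_ge0 ?sqr_ge0// mulr_ge0 ?(ltW a_gt0).
    by move: (a_gt0) (a_lt) => ? ?; nra.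
  by ring.
lra.
Qed.

Lemma rho_meas : measurable_fun `]0, (1 : R)[ rho.
Proof.
apply: measurable_funTS; apply: continuous_measurable_fun => x.
have d x' : is_derive x' 1 (fun x => j0 (1 * x + 1) - j0 x) (1 * j (1 * x' + 1) - j x').
  by apply: is_deriveB; exact: is_derive_affine.
have -> : rho = fun x => j0 (1 * x + 1) - j0 x.
  by apply/funext => y; rewrite rhoE mul1r.
apply: differentiable_continuous; apply/derivable1_diffP.
exact: (@ex_derive _ _ _ _ _ _ _ (d x)).
Qed.

Lemma rho_bnd x : 0 < x < 1 -> `|rho x| <= m.
Proof. by move=> /andP[x0 _]; rewrite ger0_norm ?rho_ge0// rho_le// ltW. Qed.

Lemma rho_int : oint 0 1 rho <= m * a.
Proof.
have ir : oitg 0 1 rho by apply: (@oitg_bnd _ _ _ m); [exact: rho_meas|exact: rho_bnd].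
rewrite (@oint_split _ 0 1 a)//; last by apply/andP; split; klra.
rewrite [X in _ + X]oint_eq0 ?addr0; last first.
  by move=> x /andP[ax _]; rewrite rho_out// ltW.
rewrite (le_trans (ler_norm _))// -[X in _ * X]subr0; apply: oint_bnd.
- exact: ltW.
- by apply: oitgS ir => //; klra.
- by move=> x /andP[x0 xa]; apply: rho_bnd; apply/andP; split; klra.
Qed.

Section Energy.
Context (V U P q : R -> R).
Hypotheses (pU : primitive (-1) 0 U P) (pP : primitive (-1) 0 P q)
  (P_N1 : P (-1) = 0) (sV : sq 0 1 V)
  (P_0 : P 0 = oint 0 1 (fun y => rho y * (V y - U 0))).

Definition nonlocal_part x := - C1 * oint 0 1 (fun y => j (x - y) * (V y - V x))
  + rho x * (V x - U 0).

(** Bounds, in units of a / s, what remains after the squares are completed; mu is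
    a bound for a^2 m, which is invariant under rescaling of the kernel. *)
Definition energy_const := G ^+ 2 * (1 + C1) ^+ 2 * mu + 2 * L ^+ 2 + bdry ^+ 2.

Let phi x := V x - c x.
Let phi0 := U 0 - c 0.

Lemma sq_phi : sq 0 1 phi.
Proof. by apply: sqB => //; exact: itg_cs. Qed.

(** The nonlocal operator at V is the sum of its quadratic part in phi = V - c, of
    the coupling, and of its value at c, where resid enters. *)
Lemma nonlocal_split x : 0 < x < 1 -> (nonlocal_part x + g x) * phi x =
  - C1 * (phi x * (conv phi x - mass x * phi x)) +
  (rho x * (V x - U 0) * phi x + (resid x - C1 * p 0 * kappa x) * phi x).
Proof.
move=> xI; have iV := sq_itg sV.
have ec : conv phi x = conv V x - conv c x.
  rewrite /conv -ointB; [|exact: itg_conv|exact: itg_conv].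
  by apply: eq_oint => y _; rewrite /phi; ring.
by rewrite /nonlocal_part massP// resid_conv ec /phi; ring.
Qed.

(** On the left the boundary term of the integration by parts, which carries the
    flux P 0 through the interface, completes the coupling term on the right to
    the square rho (phi - phi0)^2. The flux p 0 of the local problem is spread
    over the boundary layer by means of C1 * kappa, which has mass 1; since
    kappa <= a * rho, the square absorbs it. *)
Lemma energy_lower_bound s : 0 < s -> s <= 1 ->
  oitg 0 1 (fun x => (nonlocal_part x + g x) * (V x - c x)) /\
  - (energy_const * a / s + s / 2 * oint 0 1 (fun x => (V x - c x) ^+ 2)) <=
  oint (-1) 0 (fun x => (- q x + g x) * (U x - c x)) +
  oint 0 1 (fun x => (nonlocal_part x + g x) * (V x - c x)).
Proof.
move=> s0 s1; have sphi := sq_phi; have iphi := sq_itg sphi.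
have iA := itg_phi_conv sphi.
have C0 := C1_gt0; have mu0 := mu_ge0; have m0 := m_ge0.
have sU : sq 0 1 (fun x => V x - U 0).
  apply: sqB => //; apply: (@sq_bnd _ _ _ `|U 0|) => //.
have iVU := sq_itg sU.
have iVUphi := sq_mul sU sphi.
have irV f : oitg 0 1 f -> oitg 0 1 (fun x => rho x * f x).
  move=> itf; apply: (@oitg_mulb _ _ _ m) => //; [exact: rho_meas|exact: rho_bnd].
have ik : oitg 0 1 kappa.
  by apply: oitg_continuous; apply: continuous_subspaceT; exact: kappa_cont.
have ikphi : oitg 0 1 (fun x => kappa x * phi x).
  apply: (@oitg_mulb _ _ _ (a * m)) => //; first exact: kappa_meas.
  move=> x xI; have /andP[x0 x1] := xI; have /andP[k0 k1] := kappa_bnd (ltW x0).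
  by rewrite ger0_norm// (le_trans k1)// ler_wpM2l ?(ltW a_gt0)// rho_le// ltW.
have irphi : oitg 0 1 (fun x => resid x * phi x) by apply: sq_mul => //; exact: resid_sq.
pose Q x := rho x * (V x - U 0) * phi x + (resid x - C1 * p 0 * kappa x) * phi x.
have iQ : oitg 0 1 Q.
  apply: oitgD.
    by apply: eq_oitg (irV _ iVUphi) => x _; rewrite mulrA.
  apply: (@eq_oitg _ _ _ (fun x => resid x * phi x - C1 * p 0 * (kappa x * phi x))).
    by move=> x _; ring.
  by apply: oitgB => //; exact: oitgZ.
have iT : oitg 0 1 (fun x => (nonlocal_part x + g x) * (V x - c x)).
  apply: eq_oitg (oitgD (oitgZ (- C1) iA) iQ) => x xI.
  by rewrite -/(phi x) nonlocal_split.
split => //.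
have -> : oint 0 1 (fun x => (nonlocal_part x + g x) * (V x - c x)) =
    - C1 * oint 0 1 (fun x => phi x * (conv phi x - mass x * phi x)) + oint 0 1 Q.
  rewrite -ointZ// -ointD//; last exact: oitgZ.
  by apply: eq_oint => x xI; rewrite -/(phi x) nonlocal_split.
have accr : 0 <= - C1 * oint 0 1 (fun x => phi x * (conv phi x - mass x * phi x)).
  by rewrite mulNr oppr_ge0 pmulr_rle0// conv_accretive.
have left_part : - ((P 0 - p 0) * phi0) <=
    oint (-1) 0 (fun x => (- q x + g x) * (U x - c x)).
  have pc' : primitive (-1) 0 c p by apply: primitiveS pc.
  have pp' : primitive (-1) 0 p g by apply: primitiveS pp.
  have N10 : (-1 : R) <= 0 by rewrite oppr_le0.
  have pE := primitiveB pU pc'; have pF := primitiveB pP pp'.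
  have := primitive_by_parts N10 pE pF.
  rewrite P_N1 p_N1 subrr mul0r subr0 -/phi0 => E.
  have -> : oint (-1) 0 (fun x => (- q x + g x) * (U x - c x)) =
      - oint (-1) 0 (fun x => (q x - g x) * (U x - c x)).
    rewrite -ointN; last exact: (primitive_mul_itg pE pF.1).
    by apply: eq_oint => x _; ring.
  have F2 : 0 <= oint (-1) 0 (fun x => (P x - p x) ^+ 2).
    by apply: oint_ge0 => x _; exact: sqr_ge0.
  by rewrite E; lra.
(* Z distributes the boundary terms of the left half over ]0, 1[: the coupling
   integrates to P 0, and C1 * kappa to 1. *)
pose Z x := rho x * (V x - U 0) * (phi x - phi0) - C1 * p 0 * kappa x * (phi x - phi0)
  + resid x * phi x.
have iZ1 : oitg 0 1 (fun x => phi0 * (rho x * (V x - U 0))).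
  by apply: oitgZ; exact: irV.
have iZ2 : oitg 0 1 (fun x => C1 * p 0 * phi0 * kappa x) by exact: oitgZ.
have iZ : oitg 0 1 Z.
  apply: eq_oitg (oitgD (oitgB iQ iZ1) iZ2) => x _.
  by rewrite /Z /Q; ring.
have ZE : oint 0 1 Z = oint 0 1 Q - P 0 * phi0 + p 0 * phi0.
  have -> : p 0 * phi0 = oint 0 1 (fun x => C1 * p 0 * phi0 * kappa x).
    rewrite ointZ// kappa_mass (_ : _ * (M / 2) = p 0 * phi0 * (C1 * M) / 2); last by field.
    by rewrite C1M; field.
  rewrite P_0 [_ * phi0]mulrC -ointZ; last exact: irV.
  rewrite -ointB// -ointD//; last exact: oitgB.
  by apply: eq_oint => x _; rewrite /Z /Q; ring.
suff : - (energy_const * a / s + s / 2 * oint 0 1 (fun x => (V x - c x) ^+ 2)) <= oint 0 1 Z.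
  by rewrite ZE; lra.
have [_ phi2] := sphi; have [_ r2] := resid_sq.
have ir : oitg 0 1 rho by apply: (@oitg_bnd _ _ _ m); [exact: rho_meas|exact: rho_bnd].
pose W x := - (a ^+ 2 * G ^+ 2 * (1 + C1) ^+ 2 * rho x) - (2 * s)^-1 * resid x ^+ 2
   - s / 2 * phi x ^+ 2.
have iW1 := oitgZ (a ^+ 2 * G ^+ 2 * (1 + C1) ^+ 2) ir.
have iW2 := oitgZ ((2 * s)^-1) r2.
have iW3 := oitgZ (s / 2) phi2.
have iW : oitg 0 1 W by apply: oitgB => //; apply: oitgB => //; exact: oitgN.
apply: (@le_trans _ _ (oint 0 1 W)); last first.
  apply: oint_le => // x /andP[x0 x1].
  have xI : -1 <= x <= 1 by apply/andP; split; lra.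
  have /andP[k0 k1] := kappa_bnd (ltW x0); have r0 := rho_ge0 x.
  have h1 : - (2 * s)^-1 * resid x ^+ 2 - s / 2 * phi x ^+ 2 <= resid x * phi x.
    rewrite -subr_ge0 (_ : _ - _ = (2 * s)^-1 * (resid x + s * phi x) ^+ 2).
      by rewrite mulr_ge0 ?sqr_ge0// invr_ge0 mulr_ge0 ?(ltW s0).
    by field; rewrite gt_eqF.
  have h2 : - (a ^+ 2 * G ^+ 2 * (1 + C1) ^+ 2 * rho x) <=
      rho x * (V x - U 0) * (phi x - phi0) - C1 * p 0 * kappa x * (phi x - phi0).
    have -> : V x - U 0 = (phi x - phi0) + (c x - c 0) by rewrite /phi /phi0; ring.
    set t := phi x - phi0.
    have [ax|xa] := leP a x.
      by rewrite kappa_out// rho_out// !(mulr0, mul0r) oppr0 addr0.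
    have I0 : -1 <= 0 :> R by rewrite oppr_le0.
    have I0' : -1 <= (0 : R) <= 1 by rewrite I0 ler01.
    have e1 : `|c x - c 0| <= 2 * G * a.
      rewrite (le_trans (c_lip I0' xI))// subr0 (gtr0_norm x0).
      by rewrite ler_wpM2l ?(ltW xa)// mulr_ge0.
    have e2 : `|C1 * p 0 * kappa x| <= C1 * (2 * G) * (a * rho x).
      rewrite !normrM (gtr0_norm C0) (ger0_norm k0) ler_pM//.
        by rewrite mulr_ge0 ?(ltW C0).
      by rewrite ler_wpM2l ?(ltW C0)// p_bnd.
    set e := c x - c 0 in e1 *; set K := C1 * p 0 * kappa x in e2 *.
    have t2 : t ^+ 2 = `|t| ^+ 2 by rewrite real_normK// num_real.
    have h3 : - (e * t) <= 2 * G * a * `|t|.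
      by rewrite (le_trans (ler_norm _))// normrN normrM ler_wpM2r.
    have h4 : K * t <= C1 * (2 * G) * (a * rho x) * `|t|.
      by rewrite (le_trans (ler_norm _))// normrM ler_wpM2r.
    have h5 : 0 <= rho x * (`|t| - G * a * (1 + C1)) ^+ 2 by rewrite mulr_ge0 ?sqr_ge0.
    have h6 := ler_wpM2l r0 h3.
    have -> : rho x * (t + e) * t - K * t = rho x * t ^+ 2 - rho x * (- (e * t)) - K * t.
      by ring.
    rewrite t2.
    have -> : a ^+ 2 * G ^+ 2 * (1 + C1) ^+ 2 * rho x =
      rho x * (`|t| - G * a * (1 + C1)) ^+ 2 - rho x * `|t| ^+ 2
      + rho x * (2 * G * a * `|t|) + C1 * (2 * G) * (a * rho x) * `|t| by ring.
    lra.
  by rewrite /W /Z; lra.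
rewrite /W ointB//; last by apply: oitgB => //; exact: oitgN.
rewrite ointB//; last exact: oitgN.
rewrite ointN// !ointZ//.
have n1 := rho_int; have n2 := resid_norm.
set r := oint 0 1 rho in n1 *; set rr := oint 0 1 (fun x => resid x ^+ 2) in n2 *.
have c0 : 0 <= a ^+ 2 * G ^+ 2 * (1 + C1) ^+ 2.
  by apply: mulr_ge0; [apply: mulr_ge0|]; exact: sqr_ge0.
have c1 : 0 <= G ^+ 2 * (1 + C1) ^+ 2 * a by apply: mulr_ge0; [apply: mulr_ge0; exact: sqr_ge0|exact: ltW].
have sv : 0 <= (2 * s)^-1 by rewrite invr_ge0 mulr_ge0// ltW.
have b1 : a ^+ 2 * G ^+ 2 * (1 + C1) ^+ 2 * r <= G ^+ 2 * (1 + C1) ^+ 2 * mu * a / s.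
  apply: (le_trans (ler_wpM2l c0 n1)).
  rewrite (_ : _ * (m * a) = (G ^+ 2 * (1 + C1) ^+ 2 * a) * (a ^+ 2 * m)); last by ring.
  apply: (le_trans (ler_wpM2l c1 m_le)).
  rewrite (_ : _ * mu * a = G ^+ 2 * (1 + C1) ^+ 2 * a * mu); last by ring.
  by rewrite ler_pdivlMr// ler_piMr// mulr_ge0.
have b2 : (2 * s)^-1 * rr <= (2 * L ^+ 2 + bdry ^+ 2) * a / s.
  apply: (le_trans (ler_wpM2l sv n2)).
  by rewrite le_eqVlt; apply/orP; left; apply/eqP; field; rewrite gt_eqF.
have -> : energy_const * a / s = G ^+ 2 * (1 + C1) ^+ 2 * mu * a / s +
   (2 * L ^+ 2 + bdry ^+ 2) * a / s by rewrite /energy_const; ring.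
rewrite -/(phi _); lra.
Qed.

End Energy.

End Consistency.

End Kernel.

(** * The two operators *)

Section Link.
Context {R : realType}.
Local Notation mu := (@lebesgue_measure R).
Implicit Types (a b x y z t s h eps L G K : R) (f g c p u V W J : R -> R).

Lemma sq_glue a b d f : a <= b <= d -> sq a b f -> sq b d f -> sq a d f.
Proof.
move=> /andP[]; rewrite le_eqVlt => /predU1P[<- //|ab].
rewrite le_eqVlt => /predU1P[<- //|bd] [mf f2] [mf' f2'].
have E : `]a, d[%classic = `]a, b] `|` `]b, d[ :> set R.
  rewrite -itv_bndbnd_setU// bnd_simp ?ltW//.
have mf1 : measurable_fun `]a, b] f by apply/measurable_fun_itv_bndo_bndcP.
have mfad : measurable_fun `]a, d[ f by rewrite E; apply/measurable_funU.
split => //; apply/integrableP; split.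
  by apply/measurable_EFinP; exact: measurable_funX.
rewrite E ge0_integral_setU//=; last 2 first.
- rewrite -E; apply/measurable_EFinP; apply: measurableT_comp => //.
  exact: measurable_funX.
- apply/disj_setPS => y [/=]; rewrite 2!in_itv/= => /andP[_ yc] /andP[].
  by rewrite ltNge yc.
rewrite -integral_itv_bndo_bndc; last first.
  apply/measurable_EFinP; apply: measurableT_comp => //; exact: measurable_funX.
have /integrableP[_ ?] := f2; have /integrableP[_ ?] := f2'.
exact: lte_add_pinfty.
Qed.

Lemma H2_data a b W : a < b -> H2 a b W ->
  let w := weak_derivative a b W in
  let c := continuous_representative a b W in
  let p := continuous_representative a b w in
  let g := weak_derivative a b w in
  [/\ sq a b W, c = W %[ae mu in `]a, b[%classic], primitive a b c p,
     primitive a b p g & sq a b g].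
Proof.
move=> ab [h1 h2] w c p g.
have [sW sw pc cW] := H1_representative ab h1.
have [_ sg pp pw] := H1_representative ab h2.
split => //; split; first exact: primitive_itg pp.
move=> x y ax xy yb; rewrite pc.2//.
have S : (`]x, y[%classic : set R) `<=` `]a, b[%classic.
  by apply: subset_itvSoo; rewrite bnd_simp.
apply: oint_ae.
- by apply: measurable_funS S (oitg_meas pc.1).
- by apply: measurable_funS S (primitive_meas pp).
- by apply: ae_imp pw => z h /S /h; rewrite -/p => ->.
Qed.

(** Classical regularity of W. The function c and its derivatives p and g are
    explicit because W itself is only determined almost everywhere. *)
Definition C2_neumann W c p g L G :=
  [/\ sq (-1) 1 W /\ c = W %[ae mu in `]-1, 1[%classic],
      primitive (-1) 1 c p /\ primitive (-1) 1 p g,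
      p (-1) = 0 /\ p 1 = 0,
      (0 <= G /\ forall x, -1 <= x <= 1 -> `|g x| <= G) &
      (0 <= L /\ forall x y, -1 <= x <= 1 -> -1 <= y <= 1 ->
         `|g x - g y| <= L * `|x - y|)].

Let N11 : (-1 : R) < 1. Proof. by rewrite (lt_trans _ ltr01)// oppr_lt0. Qed.

(** The case of a square integrable second derivative, shared by all elements of
    the domain of A. *)
Definition neumann_data W c p g :=
  [/\ sq (-1) 1 W /\ c = W %[ae mu in `]-1, 1[%classic],
     primitive (-1) 1 c p /\ primitive (-1) 1 p g,
     p (-1) = 0 /\ p 1 = 0 & sq (-1) 1 g].

Lemma dom_A_data W : dom_A W ->
  exists c p, neumann_data W c p (fun x => - op_A W x).
Proof.
move=> [h pN1 p1]; have [sW cW pc pp sg] := H2_data N11 h.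
have gE : (fun x => - op_A W x) = weak_derivative (-1) 1 (weak_derivative (-1) 1 W).
  by apply/funext => x; rewrite /op_A opprK.
by exists (continuous_representative (-1) 1 W), (continuous_representative (-1) 1
  (weak_derivative (-1) 1 W)); rewrite /neumann_data gE.
Qed.

(** Integration by parts; the Neumann conditions remove the boundary term. *)
Lemma neumann_accretive V c p g W c' p' g' :
  neumann_data V c p g -> neumann_data W c' p' g' ->
  oint (-1) 1 (fun x => (g x - g' x) * (V x - W x)) <= 0.
Proof.
move=> [[sV cV] [pc pp] [pN1 p1] sg] [[sW cW] [pc' pp'] [pN1' p1'] sg'].
have pE := primitiveB pc pc'; have pF := primitiveB pp pp'.
have := primitive_by_parts (ltW N11) pE pF.
rewrite pN1 pN1' p1 p1' !subrr !mul0r !sub0r oppr0 => E.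
have mm := primitive_mul_itg pE pF.1.
rewrite (@oint_ae _ _ _ _ (fun x => (g x - g' x) * (c x - c' x))).
- by rewrite E sub0r oppr_le0; apply: oint_ge0 => x _; exact: sqr_ge0.
- apply: measurable_funM; apply: measurable_funB.
  + by have [] := sg.
  + by have [] := sg'.
  + by have [] := sV.
  + by have [] := sW.
- exact: oitg_meas mm.
- by apply: ae_imp (ae_and cV cW) => x [h1 h2] xI; rewrite (h1 xI) (h2 xI).
Qed.

Lemma C2_neumann_data W c p g L G : C2_neumann W c p g L G -> neumann_data W c p g.
Proof.
move=> [h1 [pc pp] h3 [G0 gG] h5]; split => //.
apply: (@sq_bnd _ _ _ G); first exact: oitg_meas pp.1.
by move=> x /andP[x0 x1]; rewrite gG// !ltW.
Qed.

(** In an implicit Euler step the second derivative of the new value is a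
    difference quotient of two functions of class C1. *)
Lemma euler_C2_neumann V W h : dom_A V -> dom_A W -> 0 < h ->
  {ae mu, forall x, `]-1, 1[%classic x -> (W x - V x) / h + op_A W x = 0} ->
  exists c p g L G, C2_neumann W c p g L G /\
    (fun x => - op_A W x) = g %[ae mu in `]-1, 1[%classic].
Proof.
move=> /dom_A_data[c' [p' [[sV cV] [pc' pp'] _ _]]].
move=> /[dup] DW /dom_A_data[c [p [[sW cW] [pc pp] [pN1 p1] sg]]] h0 eqn.
pose g x := h^-1 * (c x - c' x).
have gE : (fun x => - op_A W x) = g %[ae mu in `]-1, 1[%classic].
  apply: ae_imp (ae_and eqn (ae_and cV cW)) => x [h1 [h2 h3]] xI.
  rewrite /g h2// h3//; have := h1 xI; rewrite addrC => /eqP; rewrite addr_eq0 => /eqP ->.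
  by rewrite opprK mulrC.
have pD := primitiveB pc pc'.
have mg : measurable_fun `](-1 : R), 1[ g.
  by apply: measurable_funM => //; exact: primitive_meas pD.
have [k k0 kb] := primitive_bnd pD.
have [k' k0' kb'] := primitive_bnd (primitiveB pp pp').
have hv : 0 < h^-1 by rewrite invr_gt0.
exists c, p, g, (h^-1 * k'), (h^-1 * k); split => //; split => //.
- split => //; split; first exact: oitg_ae gE pp.1.
  move=> x y ax xy yb; rewrite pp.2//.
  have S : (`]x, y[%classic : set R) `<=` `]-1, 1[%classic.
    by apply: subset_itvSoo; rewrite bnd_simp.
  apply: oint_ae.
  + exact: measurable_funS S (oitg_meas pp.1).
  + exact: measurable_funS S mg.
  + by apply: ae_imp gE => z hz /S /hz.
- split; first by rewrite mulr_ge0// ltW.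
  by move=> x xI; rewrite normrM (gtr0_norm hv) ler_wpM2l ?kb// ltW.
- split; first by rewrite mulr_ge0// ltW.
  move=> x y xI yI; rewrite /g -mulrBr normrM (gtr0_norm hv) -mulrA ler_wpM2l ?(ltW hv)//.
  apply: (primitive_lip pD) => // z /andP[].
  rewrite gt_min lt_max => /orP h1 /orP h2; apply: kb'; move: xI yI => /andP[? ?] /andP[? ?].
  by apply/andP; split; case: h1; case: h2; lra.
Qed.

Lemma C2_neumann0 : C2_neumann (fun=> 0) (fun=> 0) (fun=> 0) (fun=> 0) 0 0.
Proof.
have p0 : primitive (-1) 1 (fun=> 0 : R) (fun=> 0).
  by split; [exact: oitg_cst|move=> x y _ xy _; rewrite oint_cst// mul0r subrr].
split => //; split => //.
- by split => //; apply: eq_oitg (oitg_cst _ _ 0) => x _; rewrite expr0n.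
- exact: aeW.
- by move=> x _; rewrite normr0.
- by move=> x y _ _; rewrite subrr normr0 mul0r.
Qed.

Lemma sq_le_sub a b d e f : a <= b -> d <= e -> sq a e f ->
  oint b d (fun x => f x ^+ 2) <= oint a e (fun x => f x ^+ 2).
Proof.
move=> ab de [_ f2]; have [bd|db] := leP b d; last first.
  by rewrite (oint_empty _ (ltW db)) oint_ge0// => x _; exact: sqr_ge0.
have pos x y : 0 <= oint x y (fun x => f x ^+ 2) by apply: oint_ge0 => z _; exact: sqr_ge0.
rewrite (@oint_split _ a e b) ?ab ?(le_trans bd)//.
rewrite (@oint_split _ b e d) ?bd//; last exact: oitgS f2.
by have := pos a b; have := pos d e; lra.
Qed.

Section Rescaled.
Context (J : R -> R) (r : R).
Hypotheses (J_ge0 : forall z, 0 <= J z) (J_cont : continuous J)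
  (J_sym : forall z, J (- z) = J z) (r_gt0 : 0 < r)
  (J_out : forall z, r <= `|z| -> J z = 0)
  (J_int : (\int[mu]_z (J z)%:E = 1)%E).

Lemma J_bounded : exists2 k : R, 0 <= k & forall z, J z <= k.
Proof.
have [c _ Jc] := @EVT_max _ J (- r) r (ge0_cp (ltW r_gt0)).2 (continuous_subspaceT J_cont).
exists (J c) => // z; have [zr|rz] := leP r `|z|; first by rewrite J_out.
by apply: Jc; rewrite in_itv/=; have := ltW rz; rewrite ler_norml.
Qed.

Lemma J_oint : oint (- r) r J = 1.
Proof.
have -> : 1 = fine (\int[mu]_z (J z)%:E)%E by rewrite J_int.
rewrite /oint Rintegral_mkcond; apply: eq_Rintegral => z _.
rewrite patchE; case: ifPn => //; rewrite notin_setE/= in_itv/= => /negP h.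
by rewrite J_out// leNgt; apply: contraNN h; rewrite ltr_norml.
Qed.

(** J2 is nondecreasing. If it had no increment over [- r, r], then J would vanish
    off 0 and have integral 0; hence the second moment is positive. *)
Lemma moment_antiderivatives : exists J0 J1 J2 : R -> R,
  [/\ forall z : R, is_derive z 1 J0 (J z), forall z : R, is_derive z 1 J1 (z * J z),
    forall z : R, is_derive z 1 J2 (z ^+ 2 * J z),
    second_moment J = J2 r - J2 (- r) & 0 < second_moment J].
Proof.
have c1 : continuous (fun z => z * J z).
  by move=> z; apply: cvgM; [exact: cvg_id|exact: J_cont].
have c2 : continuous (fun z => z ^+ 2 * J z).
  by move=> z; apply: cvgM; [exact: exprn_continuous|exact: J_cont].
have [J0 d0] := antiderivative J_cont J_out.
have [|J1 d1] := antiderivative (a := r) c1; first by move=> z /J_out ->; rewrite mulr0.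
have [|J2 d2] := antiderivative (a := r) c2; first by move=> z /J_out ->; rewrite mulr0.
have Nr : - r <= r by rewrite (ge0_cp (ltW r_gt0)).2.
have p2 := primitive_of_derive (- r) r d2 c2.
have E : second_moment J = J2 r - J2 (- r).
  rewrite p2.2// /second_moment /oint Rintegral_mkcond [RHS]Rintegral_mkcond.
  apply: eq_Rintegral => z _; rewrite patchE in_setT.
  rewrite real_normK ?num_real// patchE; case: ifPn => [_|]; first by rewrite mulrC.
  rewrite notin_setE/= in_itv/= => /negP h; rewrite J_out ?mul0r//.
  by rewrite leNgt; apply: contraNN h; rewrite ltr_norml.
exists J0, J1, J2; split => //; rewrite E lt_neqAle eq_sym subr_eq0.
have mono x y : x <= y -> J2 x <= J2 y.
  move=> xy; rewrite -subr_ge0 (primitive_of_derive x y d2 c2).2//.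
  by apply: oint_ge0 => z _; rewrite mulr_ge0 ?sqr_ge0.
rewrite subr_ge0 mono// andbT; apply/eqP => J2E.
suff : oint (- r) r J = 0 by rewrite J_oint => /eqP; rewrite oner_eq0.
have cst2 z : - r < z < r -> z ^+ 2 * J z = 0.
  move=> /andP[rz zr]; have dz : is_derive z 1 J2 0.
    apply: (@near_eq_is_derive _ _ _ (cst (J2 r))).
    near=> y; apply/eqP; rewrite eq_le {1}J2E !mono//; apply: ltW; near: y.
      exact: lt_nbhsl.
    exact: lt_nbhsr.
  by rewrite -(derive_val (is_derive := d2 z)) derive_val.
have J0z z : - r < z < r -> z != 0 -> J z = 0.
  move=> zr z0; have /eqP := cst2 z zr; rewrite mulf_eq0 expf_eq0/= (negbTE z0)/=.
  by move=> /eqP.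
rewrite (@oint_split _ (- r) r 0).
- rewrite !oint_eq0 ?addr0// => z /andP[z1 z2]; apply: J0z.
  + by rewrite z2 (lt_trans _ z1)// oppr_lt0.
  + by rewrite gt_eqF.
  + by rewrite z1 (lt_trans z2).
  + by rewrite lt_eqF.
- by rewrite oppr_le0 !ltW.
- by apply: oitg_continuous; exact: continuous_subspaceT.
Unshelve. all: by end_near. Qed.

Let C1 := 2 / second_moment J.

Lemma dom_B_sq eps V : dom_B J 1 eps V -> sq (-1) 1 V.
Proof.
move=> [h2 /L2P sV _ _]; have N10 : (-1 : R) < 0 by rewrite oppr_lt0.
have [sV' _ _ _ _] := H2_data N10 h2.
by apply: sq_glue sV' sV; rewrite (ltW N10) ler01.
Qed.

(** energy_lower_bound for the rescaled kernel. Its range is a = r eps, its second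
    moment is that of J, and a^2 times its mass is r^2, so that eps enters through
    a only. *)
Lemma op_B_consistency eps V (b : R -> R) W c p g L G s : 0 < eps -> 2 * (r * eps) < 1 ->
  dom_B J 1 eps V -> sq (-1) 1 b ->
  b = op_B J C1 1 eps V %[ae mu in `]-1, 1[%classic] ->
  C2_neumann W c p g L G -> 0 < s -> s <= 1 ->
  - (energy_const L G (r ^+ 2) C1 * (r * eps) / s
     + s / 2 * oint (-1) 1 (fun x => (V x - W x) ^+ 2)) <=
  oint (-1) 1 (fun x => (b x + g x) * (V x - W x)).
Proof.
move=> e0 are /[dup] DV [h2 /L2P sV PN1 P0] sb bE
  [[sW cW] [pc pp] [pN1 p1] [G0 gG] [L0 gL]] s0 s1.
have [k k0 Jk] := J_bounded.
have [J0 [J1 [J2 [d0 d1 d2 ME M0]]]] := moment_antiderivatives.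
have N10 : (-1 : R) < 0 by rewrite oppr_lt0.
have [sV' UV pU pP sq_q] := H2_data N10 h2.
set U := continuous_representative (-1) 0 V in UV pU *.
set P := continuous_representative (-1) 0 _ in pU pP PN1 P0.
set q := weak_derivative (-1) 0 _ in pP sq_q.
have en0 : eps != 0 by rewrite gt_eqF.
have ev : 0 < eps^-1 by rewrite invr_gt0.
pose j := rescale J eps; pose a := r * eps.
have a0 : 0 < a by rewrite mulr_gt0.
have e3 : 0 < (eps ^+ 3)^-1 by rewrite invr_gt0 exprn_gt0.
(* The antiderivatives for the kernel j follow from those for J by scaling. *)
have scaled (F f : R -> R) (d : R) : (forall z : R, is_derive z 1 F (f z)) ->
    forall z : R, is_derive z 1 (fun z => d * F (eps^-1 * z + 0))
      (d * (eps^-1 * f (eps^-1 * z + 0))).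
  move=> dF z; have h := @is_derive_affine _ F f eps^-1 0 z dF.
  by apply: is_derive_eq; rewrite /GRing.scale/=; ring.
pose j0 z := (eps ^+ 2)^-1 * J0 (eps^-1 * z + 0).
pose j1 z := eps^-1 * J1 (eps^-1 * z + 0).
pose j2 z := 1 * J2 (eps^-1 * z + 0).
have dj0 z : is_derive z 1 j0 (j z).
  by apply: (is_derive_eq (scaled _ _ _ d0 z)); rewrite /j /rescale addr0 mulrC -[z / eps]mulrC; field.
have dj1 z : is_derive z 1 j1 (z * j z).
  by apply: (is_derive_eq (scaled _ _ _ d1 z)); rewrite /j /rescale addr0 -[z / eps]mulrC; field.
have dj2 z : is_derive z 1 j2 (z ^+ 2 * j z).
  by apply: (is_derive_eq (scaled _ _ _ d2 z)); rewrite /j /rescale addr0 -[z / eps]mulrC; field.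
have j_ge0 z : 0 <= j z by rewrite mulr_ge0// ltW.
have j_even z : j (- z) = j z by rewrite /j /rescale mulNr J_sym.
have j_cont : continuous j.
  move=> z; apply: cvgM; first exact: cvg_cst.
  apply: continuous_comp; last exact: J_cont.
  by apply: cvgM; [exact: cvg_id|exact: cvg_cst].
have j_out z : a <= `|z| -> j z = 0.
  move=> az; rewrite /j /rescale J_out ?mulr0// normrM [`|eps^-1|]gtr0_norm//.
  by rewrite ler_pdivlMr.
have j_le z : j z <= (eps ^+ 3)^-1 * k by rewrite ler_wpM2l// ltW.
have aE : eps^-1 * a = r by rewrite /a; field.
have m_le : a ^+ 2 * (j0 a - j0 (- a)) <= r ^+ 2.
  rewrite /j0 -mulrBr mulrN aE !addr0.
  rewrite (primitive_of_derive (- r) r d0 J_cont).2//; last by rewrite (ge0_cp (ltW r_gt0)).2.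
  by rewrite J_oint mulr1 /a exprMn -mulrA mulfV ?mulr1// expf_neq0.
have ME' : j2 a - j2 (- a) = second_moment J.
  by rewrite ME /j2 mulrN aE !addr0 !mul1r.
have M0' : 0 < j2 a - j2 (- a) by rewrite ME'.
have C1E : C1 = 2 / (j2 a - j2 (- a)) by rewrite ME'.
have P_0 : P 0 = oint 0 1 (fun y => rho j y * (V y - U 0)).
  have iVU : oitg 0 1 (fun y => V y - U 0).
    by apply: oitgB; [exact: sq_itg|exact: oitg_cst].
  have jk z : `|j z| <= (eps ^+ 3)^-1 * k by rewrite ger0_norm.
  rewrite P0 mul1r; have [_ E] := convolution_Fubini (-1) 0 j_cont jk iVU.
  rewrite [LHS]E; apply: eq_oint => y _; congr (_ * _).
  by apply: eq_oint => x _; rewrite -j_even opprB.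
have [iR H] := energy_lower_bound j_ge0 j_even j_cont j_out j_le dj0 dj1 dj2 a0 are
  pc pp p1 pN1 L0 G0 gG gL m_le M0' C1E pU pP PN1 sV P_0 s0 s1.
have sVW : sq (-1) 1 (fun x => V x - W x) by apply: sqB => //; exact: dom_B_sq DV.
have mg : measurable_fun `](-1 : R), 1[ g by exact: oitg_meas pp.1.
have mb : measurable_fun `](-1 : R), 1[ b by have [] := sb.
have iT : oitg (-1) 1 (fun x => (b x + g x) * (V x - W x)).
  apply: sq_mul => //; apply: sqD => //.
  by apply: (@sq_bnd _ _ _ G) => // x /andP[x0 x1]; rewrite gG// !ltW.
rewrite [leRHS](@oint_split _ (-1) 1 0) ?ler01 ?(ltW N10)//.
have SL : (`]-1, 0[%classic : set R) `<=` `]-1, 1[%classic.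
  by apply: subset_itvSoo; rewrite bnd_simp.
have SR : (`]0, 1[%classic : set R) `<=` `]-1, 1[%classic.
  by apply: subset_itvSoo; rewrite bnd_simp// ltW.
have left_eq : oint (-1) 0 (fun x => (b x + g x) * (V x - W x)) =
    oint (-1) 0 (fun x => (- q x + g x) * (U x - c x)).
  have pc' : primitive (-1) 0 c p by apply: primitiveS pc.
  have ig : oitg (-1) 0 g by apply: oitgS pp.1.
  apply: oint_ae.
  - exact: measurable_funS SL (oitg_meas iT).
  - apply: oitg_meas; apply: (primitive_mul_itg (primitiveB pU pc')).
    by apply: oitgD => //; apply: oitgN; exact: pP.1.
  - apply: ae_imp (ae_and (ae_and bE cW) UV) => x [[hb hc] hU] xI.
    rewrite (hb (SL _ xI)) (hc (SL _ xI)) (hU xI) /op_B.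
    by move: xI; rewrite /= in_itv/= => /andP[_ ->].
have right_eq : oint 0 1 (fun x => (b x + g x) * (V x - W x)) =
    oint 0 1 (fun x => (nonlocal_part j C1 V U x + g x) * (V x - c x)).
  apply: oint_ae.
  - exact: measurable_funS SR (oitg_meas iT).
  - exact: oitg_meas iR.
  - apply: ae_imp (ae_and bE cW) => x [hb hc] xI.
    rewrite (hb (SR _ xI)) (hc (SR _ xI)) /op_B.
    move: xI; rewrite /= in_itv/= => /andP[x0 _]; rewrite ltNge (ltW x0)/= mul1r.
    by [].
rewrite left_eq right_eq; apply: (le_trans _ H).
rewrite lerN2 lerD2l ler_wpM2l ?divr_ge0 ?(ltW s0)//.
rewrite (@oint_ae _ _ _ _ (fun x => (V x - W x) ^+ 2)).
- by apply: sq_le_sub sVW => //; exact: ltW.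
- have [mV _] := sV; apply: measurable_funX; apply: measurable_funB => //.
  exact: measurable_funS SR (primitive_meas pc).
- by apply: measurable_funX; apply: measurable_funS SR _ => //; case: sVW.
- by apply: ae_imp cW => x hc /SR /hc ->.
Qed.

End Rescaled.

End Link.

(** * Comparison of Euler schemes *)

Section Discrete.
Context {R : realType}.
Local Notation mu := (@lebesgue_measure R).
Implicit Types (f g u v w z : R -> R) (h k x y d e th : R).

Definition dist2 f g := oint (-1) 1 (fun x => (f x - g x) ^+ 2).
Definition dotp f g := oint (-1) 1 (fun x => f x * g x).
Local Notation sq2 := (sq (-1 : R) 1).
Local Notation zero := (fun _ : R => 0 : R).

Lemma sq_zero : sq2 zero.
Proof. by split => //; apply: eq_oitg (oitg_cst _ _ 0) => x _; rewrite expr0n. Qed.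

Lemma dist2_ge0 f g : 0 <= dist2 f g.
Proof. by apply: oint_ge0 => x _; exact: sqr_ge0. Qed.

Lemma dist2C f g : dist2 f g = dist2 g f.
Proof. by apply: eq_oint => x _; ring. Qed.

Lemma dist2_tri f g u : sq2 f -> sq2 g -> sq2 u ->
  dist2 f u <= 2 * dist2 f g + 2 * dist2 g u.
Proof.
move=> sf sg su; have [_ i1] := sqB sf sg; have [_ i2] := sqB sg su.
have [_ i3] := sqB sf su.
rewrite /dist2 -!ointZ// -ointD; [|exact: oitgZ|exact: oitgZ].
apply: oint_le => //; first by apply: oitgD; exact: oitgZ.
by move=> x _; have := sqr_ge0 ((f x - g x) - (g x - u x)); nra.
Qed.

Lemma dotp_young f g : sq2 f -> sq2 g ->
  `|dotp f g| <= (dist2 f zero + dist2 g zero) / 2.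
Proof.
move=> sf sg; have ifg := sq_mul sf sg; have [_ f2] := sf; have [_ g2] := sg.
apply: (le_trans (oint_norm ifg)); rewrite mulrC.
have eqz u : dist2 u zero = oint (-1) 1 (fun x => u x ^+ 2).
  by apply: eq_oint => x _; rewrite subr0.
rewrite !eqz -ointD// -ointZ; last exact: oitgD.
apply: oint_le; [exact: oitg_norm|by apply: oitgZ; exact: oitgD|].
move=> x _; rewrite normrM -(real_normK (num_real (f x))) -(real_normK (num_real (g x))).
by have := sqr_ge0 (`|f x| - `|g x|); lra.
Qed.

(** The value of the operator at u in an implicit Euler step from v to u. *)
Definition euler u v h : R -> R := fun x => - ((u x - v x) / h).

Lemma euler_sq u v h : sq2 u -> sq2 v -> sq2 (euler u v h).
Proof.
move=> su sv; apply: sqN.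
have := sqZ h^-1 (sqB su sv); congr sq; apply/funext => x; by rewrite mulrC.
Qed.

Lemma euler_step u v z h : 0 < h -> sq2 u -> sq2 v -> sq2 z ->
  dist2 u z <= dist2 v z - 2 * h * dotp (euler u v h) (fun x => u x - z x).
Proof.
move=> h0 su sv sz; have [_ i1] := sqB su sz; have [_ i2] := sqB sv sz.
have i3 := sq_mul (euler_sq h su sv) (sqB su sz).
rewrite /dist2 /dotp -ointZ// -ointB//; last exact: oitgZ.
apply: oint_le => //; first by apply: oitgB => //; exact: oitgZ.
move=> x _; rewrite -subr_ge0 /euler.
rewrite (_ : _ - _ = (u x - v x) ^+ 2); first exact: sqr_ge0.
by field; rewrite gt_eqF.
Qed.

(** Convexity of the square; the right-hand side exceeds the left-hand side by the
    integral of h |u - v|^2 + k |w - z|^2. *)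
Lemma cross_step u v w z h k : 0 < h -> 0 < k -> sq2 u -> sq2 v -> sq2 w -> sq2 z ->
  (h + k) * dist2 u w <= h * dist2 v w + k * dist2 u z
   - 2 * h * k * dotp (fun x => euler u v k x - euler w z h x) (fun x => u x - w x).
Proof.
move=> h0 k0 su sv sw sz; have [_ i1] := sqB su sw; have [_ i2] := sqB sv sw.
have [_ i3] := sqB su sz.
have i4 := sq_mul (sqB (euler_sq k su sv) (euler_sq h sw sz)) (sqB su sw).
have i5 := oitgD (oitgZ h i2) (oitgZ k i3).
have i6 := oitgZ (2 * h * k) i4.
rewrite /dist2 /dotp -!ointZ// -ointD; [|exact: oitgZ|exact: oitgZ].
rewrite -ointB//; apply: oint_le; [exact: oitgZ|exact: oitgB|].
move=> x _; rewrite -subr_ge0 /euler.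
rewrite (_ : _ - _ = h * (u x - v x) ^+ 2 + k * (w x - z x) ^+ 2).
  by rewrite addr_ge0// mulr_ge0 ?sqr_ge0// ltW.
by field; rewrite !gt_eqF.
Qed.

Lemma dotp_ae f g u : sq2 f -> sq2 g -> sq2 u ->
  f = g %[ae mu in `]-1, 1[%classic] -> dotp f u = dotp g u.
Proof.
move=> sf sg su fg; apply: oint_ae.
- exact: oitg_meas (sq_mul sf su).
- exact: oitg_meas (sq_mul sg su).
- by apply: ae_imp fg => x h /h ->.
Qed.

Lemma dotpD f g u : sq2 f -> sq2 g -> sq2 u ->
  dotp (fun x => f x + g x) u = dotp f u + dotp g u.
Proof.
move=> sf sg su; rewrite /dotp -ointD; [|exact: sq_mul|exact: sq_mul].
by apply: eq_oint => x _; rewrite mulrDl.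
Qed.

Lemma dotpN f u : sq2 f -> sq2 u -> dotp (fun x => - f x) u = - dotp f u.
Proof.
move=> sf su; rewrite /dotp -ointN; last exact: sq_mul.
by apply: eq_oint => x _; rewrite mulNr.
Qed.

(** (t - s)^2 plus the sums of the squared steps, together with 2 eta s, solve the
    recursion with equality; the steps being at most d, these sums are at most
    d t and d s. *)
Lemma kobayashi (N M : nat) (t s : nat -> R) (S : nat -> nat -> R) (c0 C d eta : R) :
  0 <= C -> 0 <= eta -> t 0%N = 0 -> s 0%N = 0 ->
  (forall i, (i < N)%N -> t i < t i.+1 /\ t i.+1 - t i <= d) ->
  (forall i, (i < M)%N -> s i < s i.+1 /\ s i.+1 - s i <= d) ->
  (forall i, (i <= N)%N -> S i 0%N <= c0 + C * t i ^+ 2) ->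
  (forall j, (j <= M)%N -> S 0%N j <= c0 + C * s j ^+ 2) ->
  (forall i j, (i < N)%N -> (j < M)%N ->
    let h := t i.+1 - t i in let k := s j.+1 - s j in
    (h + k) * S i.+1 j.+1 <= h * S i.+1 j + k * S i j.+1 + 2 * h * k * eta) ->
  forall i j, (i <= N)%N -> (j <= M)%N ->
  S i j <= c0 + C * ((t i - s j) ^+ 2 + d * t i + d * s j) + 2 * eta * s j.
Proof.
move=> C0 eta0 t0 s0 dt ds St Ss step.
have tpos i : (i <= N)%N -> 0 <= t i /\ 0 <= d * t i.
  elim: i => [|i IH] iN; first by rewrite t0 mulr0.
  have [h1 h2] := dt i iN; have [p1 p2] := IH (ltnW iN).
  have t1 : 0 <= t i.+1 by apply: le_trans p1 (ltW h1).
  by split => //; rewrite mulr_ge0//; lra.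
have spos j : (j <= M)%N -> 0 <= s j /\ 0 <= d * s j.
  elim: j => [|i IH] iN; first by rewrite s0 mulr0.
  have [h1 h2] := ds i iN; have [p1 p2] := IH (ltnW iN).
  have t1 : 0 <= s i.+1 by apply: le_trans p1 (ltW h1).
  by split => //; rewrite mulr_ge0//; lra.
elim=> [|i IHi]; elim=> [|j IHj] iN jM.
- by have := St 0%N isT; rewrite t0 s0; nra.
- apply: (le_trans (Ss _ jM)); have [p1 p2] := spos _ jM; rewrite t0 mulr0 addr0 sub0r sqrrN.
  by rewrite -addrA lerD2l mulrDr -addrA lerDl addr_ge0// mulr_ge0// mulr_ge0.
- apply: (le_trans (St _ iN)); have [p1 p2] := tpos _ iN; rewrite s0 !mulr0 !addr0 subr0.
  by rewrite lerD2l mulrDr lerDl mulr_ge0.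
have [h0 hd] := dt i iN; have [k0 kd] := ds j jM.
have := step i j iN jM; have := IHi j.+1 (ltnW iN) jM; have := IHj iN (ltnW jM).
rewrite /=; set h := t i.+1 - t i in hd *; set k := s j.+1 - s j in kd *.
have hp : 0 < h by rewrite subr_gt0.
have kp : 0 < k by rewrite subr_gt0.
have -> : t i = t i.+1 - h by rewrite /h; ring.
have -> : s j = s j.+1 - k by rewrite /k; ring.
set x := t i.+1; set y := s j.+1 => H1 H2 H3.
have hk : 0 < h + k by rewrite addr_gt0.
rewrite -(ler_pM2l hk); apply: (le_trans H3).
have H1' := ler_wpM2l (ltW hp) H1; have H2' := ler_wpM2l (ltW kp) H2.
have e1 : 0 <= C * (h * k * (d - h)) by rewrite !mulr_ge0 ?subr_ge0// ltW.
have e2 : 0 <= C * (h * k * (d - k)) by rewrite !mulr_ge0 ?subr_ge0// ltW.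
apply: (le_trans (lerD (lerD H1' H2') (lexx _))).
rewrite -subr_ge0 (_ : _ - _ = C * (h * k * (d - h)) + C * (h * k * (d - k))).
  by rewrite addr_ge0.
by ring.
Qed.

Lemma uniform_bound (N : nat) (Q : nat -> R -> Prop) :
  (forall i k k', Q i k -> k <= k' -> Q i k') ->
  (forall i, (i < N)%N -> exists k, Q i k) ->
  exists k, forall i, (i < N)%N -> Q i k.
Proof.
move=> Qm; elim: N => [_|N IH H]; first by exists 0.
have [k Hk] := IH (fun i iN => H i (ltnW iN)); have [k' Hk'] := H N (leqnn _).
exists (Num.max k k') => i; rewrite ltnS leq_eqVlt => /predU1P[->|iN].
  by apply: Qm Hk' _; rewrite le_max lexx orbT.
by apply: Qm (Hk i iN) _; rewrite le_max lexx.
Qed.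

Section Comparison.
Context (J : R -> R) (r eps s d eta E B : R).
Hypotheses (J_ge0 : forall z : R, 0 <= J z) (J_cont : continuous J)
  (J_sym : forall z : R, J (- z) = J z) (r_gt0 : 0 < r)
  (J_out : forall z : R, r <= `|z| -> J z = 0)
  (J_int : (\int[mu]_z (J z)%:E = 1)%E).
Hypotheses (eps_gt0 : 0 < eps) (eps_lt : 2 * (r * eps) < 1)
  (s_gt0 : 0 < s) (s_le1 : s <= 1)
  (etaE : eta = E * (r * eps) / s + 2 * s * B).

Let C1 := 2 / second_moment J.
Let econst L G := energy_const L G (r ^+ 2) C1.

Lemma op_B_energy V V' k W c p g L G : 0 < k -> sq2 V' -> dom_B J 1 eps V ->
  {ae mu, forall x, `]-1, 1[%classic x ->
    (V x - V' x) / k + op_B J C1 1 eps V x = 0} ->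
  C2_neumann W c p g L G -> econst L G <= E -> dist2 V W <= 4 * B ->
  - eta <= dotp (fun x => euler V V' k x + g x) (fun x => V x - W x).
Proof.
move=> k0 sV' DV eqn CW eE VW; have sV := dom_B_sq DV.
have bE : euler V V' k = op_B J C1 1 eps V %[ae mu in `]-1, 1[%classic].
  apply: ae_imp eqn => x h /h /eqP; rewrite addrC addr_eq0 /euler => /eqP ->.
  by [].
have H := op_B_consistency J_ge0 J_cont J_sym r_gt0 J_out J_int eps_gt0 eps_lt
  DV (euler_sq k sV sV') bE CW s_gt0 s_le1.
apply: (le_trans _ H); rewrite lerN2 etaE lerD//.
  by rewrite ler_wpM2r ?invr_ge0 ?(ltW s_gt0)// ler_wpM2r// mulr_ge0// ltW.
rewrite (_ : 2 * s * B = s / 2 * (4 * B)); last by field.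
by rewrite ler_wpM2l// divr_ge0// ltW.
Qed.

(** For W = 0 the energy constant vanishes, and the parameter e in the lower bound
    can be sent to 0. *)
Lemma op_B_monotone V V' k : 0 < k -> sq2 V' -> dom_B J 1 eps V ->
  {ae mu, forall x, `]-1, 1[%classic x ->
    (V x - V' x) / k + op_B J C1 1 eps V x = 0} ->
  0 <= dotp (euler V V' k) (fun x => V x - 0).
Proof.
move=> k0 sV' DV eqn; have sV := dom_B_sq DV.
have bE : euler V V' k = op_B J C1 1 eps V %[ae mu in `]-1, 1[%classic].
  apply: ae_imp eqn => x h /h /eqP; rewrite addrC addr_eq0 /euler => /eqP ->.
  by [].
set X := dotp _ _; rewrite leNgt; apply/negP => X0.
set D := dist2 V zero; have D0 : 0 <= D by exact: dist2_ge0.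
have D1 : 0 < D + 1 by lra.
pose e := Num.min 1 (- X / (D + 1)).
have e0 : 0 < e by rewrite lt_min ltr01 divr_gt0// oppr_gt0.
have e1 : e <= 1 by rewrite ge_min lexx.
have eX : e * (D + 1) <= - X by rewrite -ler_pdivlMr// ge_min lexx orbT.
have := op_B_consistency J_ge0 J_cont J_sym r_gt0 J_out J_int eps_gt0 eps_lt
  DV (euler_sq k sV sV') bE C2_neumann0 e0 e1.
rewrite /energy_const /bdry -/(dist2 V zero) -/D.
have -> : oint (-1) 1 (fun x => (euler V V' k x + 0) * (V x - 0)) = X.
  by apply: eq_oint => x _; rewrite addr0.
rewrite !(expr0n, mulr0, mul0r, addr0, add0r)/=.
have : 0 <= e * D by rewrite mulr_ge0// ltW.
lra.
Qed.

Context (M N : nat) (tv tw : nat -> R) (V W : nat -> R -> R).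
Hypotheses (tv0 : tv 0%N = 0) (tw0 : tw 0%N = 0)
  (dtv : forall j, (j < M)%N -> tv j < tv j.+1 /\ tv j.+1 - tv j <= d)
  (dtw : forall i, (i < N)%N -> tw i < tw i.+1 /\ tw i.+1 - tw i <= d)
  (sV0 : sq2 (V 0%N)) (sW0 : sq2 (W 0%N))
  (VB : forall j, (j < M)%N -> dom_B J 1 eps (V j.+1) /\
    {ae mu, forall x, `]-1, 1[%classic x ->
    (V j.+1 x - V j x) / (tv j.+1 - tv j) + op_B J C1 1 eps (V j.+1) x = 0})
  (WA : forall i, (i < N)%N -> exists c p g L G,
    [/\ C2_neumann (W i.+1) c p g L G, econst L G <= E &
     euler (W i.+1) (W i) (tw i.+1 - tw i) = (fun x => - g x) %[ae mu in `]-1, 1[%classic]])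
  (V0B : dist2 (V 0%N) zero <= B) (W0B : dist2 (W 0%N) zero <= B).
Context (u cu pu gu : R -> R) (Lu Gu : R).
Hypotheses (Cu : C2_neumann u cu pu gu Lu Gu) (Eu : econst Lu Gu <= E)
  (uB : dist2 u zero <= B).

Let K := eta + (dist2 gu zero + 4 * B) / 2.

Lemma V_sq j : (j <= M)%N -> sq2 (V j).
Proof. by case: j => [//|j] /VB[/dom_B_sq]. Qed.

Lemma W_sq i : (i <= N)%N -> sq2 (W i).
Proof. by case: i => [//|i] /WA[c [p [g [L [G [[[]]]]]]]]. Qed.

Let u_sq : sq2 u. Proof. by have [[]] := Cu. Qed.
Let gu_sq : sq2 gu. Proof. by have [] := C2_neumann_data Cu. Qed.

Lemma W_step i : (i < N)%N -> exists c p g, neumann_data (W i.+1) c p g /\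
  forall f, sq2 f -> dotp (euler (W i.+1) (W i) (tw i.+1 - tw i)) f = - dotp g f.
Proof.
move=> iN; have [c [p [g [L [G [CW _ gE]]]]]] := WA iN.
exists c, p, g; have ND := C2_neumann_data CW; split => // f sf.
have [_ _ _ sg] := ND; rewrite -dotpN//; apply: dotp_ae => //; last exact: sqN.
by apply: euler_sq; apply: W_sq => //; exact: ltnW.
Qed.

Lemma V_bnd j : (j <= M)%N -> dist2 (V j) zero <= B.
Proof.
elim: j => [//|j IH] jM; apply: le_trans (IH (ltnW jM)).
have [k0 _] := dtv jM; have [DV eqn] := VB jM; have sj := V_sq (ltnW jM).
rewrite -subr_gt0 in k0; have := op_B_monotone k0 sj DV eqn => H.
apply: (le_trans (euler_step k0 (V_sq jM) sj sq_zero)).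
by rewrite gerBl mulr_ge0// mulr_ge0// ltW.
Qed.

Lemma W_bnd i : (i <= N)%N -> dist2 (W i) zero <= B.
Proof.
elim: i => [//|i IH] iN; apply: le_trans (IH (ltnW iN)).
have [h0 _] := dtw iN; have si := W_sq (ltnW iN); have si' := W_sq iN.
rewrite -subr_gt0 in h0; have [c [p [g [ND eE]]]] := W_step iN.
apply: (le_trans (euler_step h0 si' si sq_zero)).
rewrite gerBl mulr_ge0 ?(mulr_ge0 _ (ltW h0))// eE; last exact: sqB si' sq_zero.
rewrite oppr_ge0; have := neumann_accretive ND (C2_neumann_data C2_neumann0).
by congr (_ <= _); apply: eq_oint => x _; rewrite subr0.
Qed.

Let VW_bnd f g : sq2 f -> sq2 g -> dist2 f zero <= B -> dist2 g zero <= B ->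
  dist2 f g <= 4 * B.
Proof.
move=> sf sg fB gB; apply: (le_trans (dist2_tri sf sq_zero sg)).
by rewrite (dist2C zero g); lra.
Qed.

Let gu_young f : sq2 f -> dist2 f zero <= B ->
  `|dotp gu (fun x => f x - u x)| <= (dist2 gu zero + 4 * B) / 2.
Proof.
move=> sf fB; apply: (le_trans (dotp_young gu_sq (sqB sf u_sq))).
rewrite ler_wpM2r// lerD2l (_ : dist2 _ _ = dist2 f u); first exact: VW_bnd.
by apply: eq_oint => x _; rewrite subr0.
Qed.

(** The regular function u moves away from equilibrium at the bounded speed gu, so
    by accretivity the distance of a scheme to u grows at most linearly. *)
Lemma V_drift j : (j <= M)%N -> dist2 (V j) u <= dist2 (V 0%N) u + 2 * K * tv j.
Proof.
elim: j => [|j IH] jM; first by rewrite tv0 mulr0 addr0.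
have [k0 _] := dtv jM; have [DV eqn] := VB jM; have sj := V_sq (ltnW jM).
have sj' := V_sq jM; have {}IH := IH (ltnW jM).
rewrite -subr_gt0 in k0; apply: (le_trans (euler_step k0 sj' sj u_sq)).
have H := op_B_energy k0 sj DV eqn Cu Eu (VW_bnd sj' u_sq (V_bnd jM) uB).
have := gu_young sj' (V_bnd jM); rewrite ler_norml => /andP[_ Y].
rewrite (dotpD (euler_sq _ sj' sj) gu_sq (sqB sj' u_sq)) in H.
set X := dotp (euler _ _ _) _ in H *; set Z := dotp gu _ in H Y.
have : - K <= X by rewrite /K; lra.
move=> /(ler_wpM2l (ltW k0)); nra.
Qed.

Lemma W_drift i : (i <= N)%N -> 0 <= eta ->
  dist2 (W i) u <= dist2 (W 0%N) u + 2 * K * tw i.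
Proof.
move=> + eta0; elim: i => [|i IH] iN; first by rewrite tw0 mulr0 addr0.
have [h0 _] := dtw iN; have si := W_sq (ltnW iN); have si' := W_sq iN.
have {}IH := IH (ltnW iN).
rewrite -subr_gt0 in h0; have [c [p [g [ND eE]]]] := W_step iN.
apply: (le_trans (euler_step h0 si' si u_sq)); rewrite eE; last exact: sqB.
have := gu_young si' (W_bnd iN); rewrite ler_norml => /andP[_ Y].
have := neumann_accretive ND (C2_neumann_data Cu).
have [_ _ _ sg] := ND.
rewrite -/(dotp (fun x => g x - gu x) (fun x => W i.+1 x - u x)).
rewrite dotpD ?dotpN//; [|exact: sqB|exact: sqN|exact: sqB].
set X := dotp g _; set Z := dotp gu _ in Y * => A.
have : X <= K by rewrite /K; lra.
move=> /(ler_wpM2l (ltW h0)); nra.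
Qed.

(** kobayashi asks for boundary values that are quadratic in time. The linear bounds
    of the drift lemmas become quadratic by Young's inequality, at the price of the
    small constant 4 K th. *)
Lemma schemes_close th i j : 0 <= eta -> 0 < th -> (i <= N)%N -> (j <= M)%N ->
  dist2 (V j) (W i) <= 2 * dist2 (V 0%N) u + 2 * dist2 (W 0%N) u + 4 * K * th
   + K / th * ((tw i - tv j) ^+ 2 + d * tw i + d * tv j) + 2 * eta * tv j.
Proof.
move=> eta0 th0 iN jM.
have B0 : 0 <= B by apply: le_trans V0B; exact: dist2_ge0.
have K0 : 0 <= K by rewrite /K addr_ge0// divr_ge0// addr_ge0 ?dist2_ge0// mulr_ge0.
have lin x : 4 * K * x <= 4 * K * th + K / th * x ^+ 2.
  rewrite -subr_ge0 (_ : _ - _ = K / th * (2 * th - x) ^+ 2).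
    by rewrite mulr_ge0 ?sqr_ge0// divr_ge0// ltW.
  by field; rewrite gt_eqF.
apply: (@kobayashi N M tw tv (fun i j => dist2 (V j) (W i)) _ _ d eta _ eta0 tw0 tv0 dtw dtv) => //.
- by rewrite divr_ge0// ltW.
- move=> {}i {}iN; have := dist2_tri sV0 u_sq (W_sq iN); rewrite (dist2C u).
  by have := W_drift iN eta0; have := lin (tw i); lra.
- move=> {}j {}jM; have := dist2_tri (V_sq jM) u_sq sW0; rewrite (dist2C u).
  by have := V_drift jM; have := lin (tv j); lra.
- move=> {}i {}j {}iN {}jM /=.
  have [h0 _] := dtw iN; have [k0 _] := dtv jM.
  rewrite -subr_gt0 in h0; rewrite -subr_gt0 in k0.
  have sj := V_sq (ltnW jM); have sj' := V_sq jM.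
  have si := W_sq (ltnW iN); have si' := W_sq iN.
  have [DV eqn] := VB jM; have [c [p [g [L [G [CW LE gE]]]]]] := WA iN.
  have [_ _ _ sg] := C2_neumann_data CW.
  apply: (le_trans (cross_step h0 k0 sj' sj si' si)); rewrite lerD2l.
  have H := op_B_energy k0 sj DV eqn CW LE (VW_bnd sj' si' (V_bnd jM) (W_bnd iN)).
  rewrite (@dotp_ae _ (fun x => euler (V j.+1) (V j) (tv j.+1 - tv j) x + g x)).
  + rewrite -mulrN ler_wpM2l//; first by rewrite !mulr_ge0// ltW.
    by rewrite lerNl.
  + by apply: sqB; exact: euler_sq.
  + by apply: sqD => //; exact: euler_sq.
  + exact: sqB.
  + by apply: ae_imp gE => x hx /hx ->; rewrite opprK.
Qed.

End Comparison.

End Discrete.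

(** * Mild solutions *)

Section Mild.
Context {R : realType}.
Local Notation mu := (@lebesgue_measure R).
Implicit Types (f g u : R -> R) (v w W : R -> R -> R) (t s d e T : R).
Local Notation sq2 := (sq (-1 : R) 1).
Local Notation zero := (fun _ : R => 0 : R).

Lemma L2norm_dist2 f g : sq2 f -> sq2 g ->
  L2norm (-1) 1 (f \- g) = (Num.sqrt (dist2 f g))%:E.
Proof. by move=> sf sg; rewrite L2normE//; exact: sqB. Qed.

Lemma L2norm_le_dist2 f g d : 0 <= d -> sq2 f -> sq2 g ->
  (L2norm (-1) 1 (f \- g)%R <= d%:E)%E = (dist2 f g <= d ^+ 2).
Proof. by move=> d0 sf sg; rewrite L2norm_le//; exact: sqB. Qed.

Lemma locate (N : nat) (t : nat -> R) T s : t 0%N = 0 -> t N = T -> 0 < s <= T ->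
  exists2 i, (i < N)%N & t i < s <= t i.+1.
Proof.
move=> t0 <- /andP[s0]; elim: N => [|N IH]; first by rewrite t0 leNgt s0.
have [sN _|Ns sN] := leP s (t N).
  by have [i iN H] := IH sN; exists i => //; exact: ltnW.
by exists N => //; rewrite Ns sN.
Qed.

(** F^2 - F'^2 = (F - F') (F + F') for F = f - g and F' = f' - g', and Young's
    inequality with parameter e. *)
Lemma dist2_variation f g f' g' e : 0 < e -> sq2 f -> sq2 g -> sq2 f' -> sq2 g' ->
  `|dist2 f g - dist2 f' g'| <=
  (e^-1 + 2 * e) * (dist2 f f' + dist2 g g') + 4 * e * dist2 f' g'.
Proof.
move=> e0 sf sg sf' sg'.
have [_ i1] := sqB sf sg; have [_ i2] := sqB sf' sg'.
have [_ i3] := sqB sf sf'; have [_ i4] := sqB sg sg'.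
have i34 := oitgD i3 i4.
have i5 := oitgZ (e^-1 + 2 * e) i34.
have i6 := oitgZ (4 * e) i2.
rewrite /dist2 -(ointB i1 i2) -(ointD i3 i4) -(ointZ _ i34) -(ointZ _ i2) -(ointD i5 i6).
apply: (le_trans (oint_norm (oitgB i1 i2))).
apply: oint_le; [exact/oitg_norm/oitgB|exact: oitgD|] => x _.
set F := f x - g x; set F' := f' x - g' x; set p := f x - f' x; set q := g x - g' x.
have -> : F = F' + (p - q) by rewrite /F /F' /p /q; ring.
set z := p - q; have zpq : z ^+ 2 <= 2 * (p ^+ 2 + q ^+ 2).
  by have := sqr_ge0 (p + q); rewrite /z; nra.
have ie0 : 0 < e^-1 by rewrite invr_gt0.
have H : `|(F' + z) ^+ 2 - F' ^+ 2| <= e^-1 / 2 * z ^+ 2 + e / 2 * (2 * F' + z) ^+ 2.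
  rewrite (_ : _ - _ = z * (2 * F' + z)); last by ring.
  set y := 2 * F' + z; have ee : e^-1 * e = 1 by rewrite mulVf// gt_eqF.
  rewrite ler_norml; apply/andP; split; rewrite -subr_ge0.
    rewrite (_ : _ - _ = e^-1 / 2 * (z + e * y) ^+ 2).
      by rewrite mulr_ge0 ?sqr_ge0// divr_ge0// ltW.
    by field; rewrite gt_eqF.
  rewrite (_ : _ - _ = e^-1 / 2 * (z - e * y) ^+ 2).
    by rewrite mulr_ge0 ?sqr_ge0// divr_ge0// ltW.
  by field; rewrite gt_eqF.
apply: (le_trans H).
have H2 : (2 * F' + z) ^+ 2 <= 8 * F' ^+ 2 + 2 * z ^+ 2.
  by have := sqr_ge0 (2 * F' - z); nra.
have := ler_wpM2l (ltW e0) H2; have := ler_wpM2l (ltW ie0) zpq.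
have := ler_wpM2l (ltW e0) zpq.
nra.
Qed.

Definition euler_scheme (D : set (R -> R)) (A : (R -> R) -> R -> R) T d
    (N : nat) (t : nat -> R) (W : nat -> R -> R) :=
  [/\ t 0%N = 0 /\ t N = T,
      forall i, (i < N)%N -> t i < t i.+1 /\ t i.+1 - t i <= d,
      sq2 (W 0%N) &
      forall i, (i < N)%N -> D (W i.+1) /\
        {ae mu, forall x, `]-1, 1[%classic x ->
          (W i.+1 x - W i x) / (t i.+1 - t i) + A (W i.+1) x = 0}].

Definition approximable D A T (w0 : R -> R) w := forall d, 0 < d ->
  exists (N : nat) (t : nat -> R) (W : nat -> R -> R),
  [/\ euler_scheme D A T d N t W, dist2 (W 0%N) w0 <= d ^+ 2 &
      forall i s, (i < N)%N -> t i < s <= t i.+1 -> dist2 (w s) (W i.+1) <= d ^+ 2].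

Lemma dist2_ae f g : sq2 f -> sq2 g -> f = g %[ae mu in `]-1, 1[%classic] ->
  dist2 f g = 0.
Proof.
move=> sf sg fg; have [mf _] := sqB sf sg.
have <- : dist2 g g = 0.
  by rewrite /dist2 (_ : (fun x => _) = zero) ?oint_cst ?mul0r//; apply/funext => x; rewrite subrr expr0n.
apply: oint_ae.
- by have [_ /oitg_meas] := sqB sf sg.
- by have [_ /oitg_meas] := sqB sg sg.
- by apply: ae_imp fg => x h /h ->.
Qed.

Section Consequences.
Context (D : set (R -> R)) (A : (R -> R) -> R -> R) (w0 : R -> R) (w : R -> R -> R).
Hypotheses (Dsq : forall f, D f -> sq2 f) (w0sq : sq2 w0) (sol : mild_solution D A w0 w).

Lemma mild_sq t : 0 <= t -> sq2 (w t).
Proof. by have [H _ _ _] := sol => /H /L2P. Qed.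

Lemma mild_initial : dist2 (w 0) w0 = 0.
Proof. by have [_ _ H _] := sol; apply: dist2_ae => //; exact: mild_sq. Qed.

Lemma mild_continuous t e : 0 <= t -> 0 < e ->
  exists2 q, 0 < q & forall s, 0 <= s -> `|s - t| < q -> dist2 (w s) (w t) <= e.
Proof.
move=> t0 e0; have [_ C _ _] := sol.
have /fine_cvgP[_ /cvgrPdist_le/(_ (Num.sqrt e))] := C t t0.
rewrite sqrtr_gt0 => /(_ e0); rewrite near_withinE => -[q /= q0 H].
exists q => // s s0 st; have := H s.
rewrite /= in_itv/= s0 distrC => /(_ st isT).
rewrite /= (L2norm_dist2 (mild_sq s0) (mild_sq t0))/= sub0r normrN.
rewrite ger0_norm ?sqrtr_ge0// => h.
by rewrite -ler_sqrt ?(ltW e0)//.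
Qed.

Lemma mild_approximable T : 0 < T -> approximable D A T w0 w.
Proof.
move=> T0 d d0; have [_ _ _ /(_ T d T0 d0)[N [t [W [tT dt [LW W0] DW wW]]]]] := sol.
have sW0 : sq2 (W 0%N) by exact/L2P.
exists N, t, W; split => //.
  by rewrite -L2norm_le_dist2// ltW.
move=> i s iN ts; have [DW1 _] := DW i iN.
rewrite -L2norm_le_dist2 ?(ltW d0)//; [exact: wW| |exact: Dsq].
have tpos j : (j <= N)%N -> 0 <= t j.
  elim: j => [|j IH] jN; first by have [-> _] := tT.
  by have [h _] := dt j jN; apply: le_trans (IH (ltnW jN)) (ltW h).
by apply: mild_sq; case/andP: ts => h _; apply: le_trans (ltW h); exact/tpos/ltnW.
Qed.

End Consequences.

Lemma dist2_continuous T v w : 0 < T ->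
  (forall t, 0 <= t -> sq2 (v t)) -> (forall t, 0 <= t -> sq2 (w t)) ->
  (forall t e, 0 <= t -> 0 < e ->
    exists2 q, 0 < q & forall s, 0 <= s -> `|s - t| < q -> dist2 (v s) (v t) <= e) ->
  (forall t e, 0 <= t -> 0 < e ->
    exists2 q, 0 < q & forall s, 0 <= s -> `|s - t| < q -> dist2 (w s) (w t) <= e) ->
  {within `[0, T], continuous (fun t => dist2 (v t) (w t))}.
Proof.
move=> T0 sv sw cv cw; apply/subspace_continuousP => t /=.
rewrite in_itv/= => /andP[t0 tT]; apply/cvgrPdist_le => e e0.
have D0 : 0 <= dist2 (v t) (w t) by exact: dist2_ge0.
set D := dist2 (v t) (w t) in D0 *.
pose k := e / (8 * (D + 1)).
have k0 : 0 < k by rewrite divr_gt0//; lra.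
pose a := k^-1 + 2 * k.
have a0 : 0 < a by rewrite addr_gt0 ?invr_gt0// mulr_gt0.
have ea : 0 < e / (4 * a) by rewrite divr_gt0// mulr_gt0.
have [q1 q10 H1] := cv t _ t0 ea; have [q2 q20 H2] := cw t _ t0 ea.
rewrite near_withinE; exists (Num.min q1 q2); first by rewrite /= lt_min q10.
move=> s /=; rewrite lt_min distrC => /andP[s1 s2]; rewrite in_itv/= => /andP[s0 _].
rewrite distrC; apply: (le_trans (dist2_variation k0 (sv s s0) (sw s s0) (sv t t0) (sw t t0))).
have h1 := H1 s s0 s1; have h2 := H2 s s0 s2.
have h3 : a * (dist2 (v s) (v t) + dist2 (w s) (w t)) <= e / 2.
  apply: (@le_trans _ _ (a * (e / (4 * a) + e / (4 * a)))).
    by rewrite ler_wpM2l ?(ltW a0)// lerD.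
  by rewrite le_eqVlt; apply/orP; left; apply/eqP; field; rewrite gt_eqF.
have h4 : 4 * k * D <= e / 2.
  rewrite (_ : e / 2 = 4 * k * (D + 1)); last by rewrite /k; field; rewrite gt_eqF//; lra.
  by rewrite ler_wpM2l ?lerDl// mulr_ge0// ltW.
by rewrite -/D -/a; lra.
Qed.

Lemma maximum_of_dist2 T v w : 0 < T ->
  (forall t, 0 <= t -> sq2 (v t)) -> (forall t, 0 <= t -> sq2 (w t)) ->
  {within `[0, T], continuous (fun t => dist2 (v t) (w t))} ->
  exists2 t, 0 <= t <= T &
    is_max [set L2norm (-1) 1 (v t \- w t) | t in `[0, T]]
      (Num.sqrt (dist2 (v t) (w t)))%:E.
Proof.
move=> T0 sv sw cvw; have [t tT H] := EVT_max (ltW T0) cvw.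
have := tT; rewrite in_itv/= => /andP[t0 tT'].
exists t; first by rewrite t0.
split; first by exists t => //; rewrite L2norm_dist2//; [exact: sv|exact: sw].
move=> _ [s sT <-]; have := sT; rewrite /= in_itv/= => /andP[s0 _].
rewrite L2norm_dist2; [|exact: sv|exact: sw].
by rewrite lee_fin ler_wsqrtr// H.
Qed.

Lemma small_squares (e q : R) : 0 < e -> 0 < q ->
  exists d0, [/\ 0 < d0, d0 <= 1, d0 < q & forall d, 0 < d -> d <= d0 -> d ^+ 2 <= e].
Proof.
move=> e0 q0; exists (Num.min 1 (Num.min (q / 2) e)).
have q2 : 0 < q / 2 by rewrite divr_gt0.
split; first by rewrite !lt_min ltr01 q2.
- by rewrite ge_min lexx.
- by rewrite !gt_min; apply/orP; right; apply/orP; left; lra.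
- by move=> d d0; rewrite !le_min => /and3P[d1 _ de]; nra.
Qed.

(** The second point of such a scheme serves as a regular reference function near
    w0, the first point as initial value of the scheme restarted there. *)
Lemma scheme_start D A T (w0 : R -> R) w tau : 0 < T -> 0 < tau ->
  (forall f, D f -> sq2 f) -> sq2 w0 -> mild_solution D A w0 w ->
  exists2 d0, 0 < d0 & forall d (N : nat) (t : nat -> R) (W : nat -> R -> R), 0 < d -> d <= d0 -> euler_scheme D A T d N t W ->
   (forall i s, (i < N)%N -> t i < s <= t i.+1 -> dist2 (w s) (W i.+1) <= d ^+ 2) ->
   [/\ (1 < N)%N, dist2 (W 1%N) w0 <= tau & dist2 (W 2%N) w0 <= tau].
Proof.
move=> T0 tau0 Dsq sw0 sol; have sq_w := mild_sq sol.
have tau8 : 0 < tau / 8 by rewrite divr_gt0.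
have [q q0 H] := mild_continuous sol (lexx 0) tau8.
have q20 : 0 < Num.min (q / 2) (T / 2) by rewrite lt_min !divr_gt0.
have tau4 : 0 < tau / 4 by rewrite divr_gt0.
have [d0 [d00 d01 dq dsq]] := small_squares tau4 q20.
exists d0 => // d N t W d_gt0 dd0 [[t0 tN] dt sW0 DW] wW.
have dd := dsq d d_gt0 dd0; move: dq; rewrite lt_min => /andP[dq dT].
have N1 : (1 < N)%N.
  case: N tN dt {DW wW} => [|[|N]]//; first by rewrite t0 => T0'; move: T0; rewrite -T0' ltxx.
  by move=> tN /(_ 0%N isT)[_]; rewrite tN t0; lra.
have near0 s f : 0 <= s -> s < q -> sq2 f -> dist2 (w s) f <= d ^+ 2 -> dist2 f w0 <= tau.
  move=> s0 sq sf wf; have h0 := H s s0.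
  rewrite subr0 ger0_norm// in h0; have {}h0 := h0 sq.
  have h1 := dist2_tri (sq_w s s0) (sq_w 0 (lexx 0)) sw0.
  rewrite (mild_initial sw0 sol) in h1.
  have h2 := dist2_tri sf (sq_w s s0) sw0; rewrite (dist2C f (w s)) in h2.
  by lra.
have [a1 a2] := dt 0%N (ltnW N1); have [b1 b2] := dt 1%N N1; rewrite t0 in a1 a2.
split => //.
- apply: (near0 (t 1%N)); [exact: ltW|lra|by apply: Dsq; have [] := DW 0%N (ltnW N1)|].
  by apply: wW; [exact: ltnW|rewrite t0 a1 lexx].
- apply: (near0 (t 2%N)); [lra|lra|by apply: Dsq; have [] := DW 1%N N1|].
  by apply: wW; rewrite ?b1 ?lexx.
Qed.

Lemma scheme_times D A T d (N : nat) (t : nat -> R) (W : nat -> R -> R) :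
  euler_scheme D A T d N t W ->
  forall i j, (i <= j)%N -> (j <= N)%N -> t i <= t j.
Proof.
move=> [_ dt _ _] i; elim=> [|j IH]; first by rewrite leqn0 => /eqP ->.
rewrite leq_eqVlt ltnS => /predU1P[-> //|ij] jN.
by apply: (le_trans (IH ij (ltnW jN))); have [h _] := dt j jN; exact: ltW.
Qed.

(** The regularity of W_(i+2) comes from the fact that W_(i+1) is already in the
    domain of A; the first step has no such predecessor. *)
Lemma neumann_scheme_smooth T d (N : nat) (t : nat -> R) (W : nat -> R -> R) (a C1 : R) :
  euler_scheme dom_A op_A T d N t W ->
  exists E, forall i, (i < N.-1)%N -> exists c p g L G,
    [/\ C2_neumann (W i.+2) c p g L G, energy_const L G a C1 <= E &
     euler (W i.+2) (W i.+1) (t i.+2 - t i.+1) =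
       (fun x => - g x) %[ae mu in `]-1, 1[%classic]].
Proof.
move=> [_ dt _ DW].
pose Q i E := exists c p g L G,
    [/\ C2_neumann (W i.+2) c p g L G, energy_const L G a C1 <= E &
     euler (W i.+2) (W i.+1) (t i.+2 - t i.+1) =
       (fun x => - g x) %[ae mu in `]-1, 1[%classic]].
apply: (@uniform_bound _ _ Q).
  move=> i k k' [c [p [g [L [G [h1 h2 h3]]]]]] kk'; exists c, p, g, L, G; split => //.
  exact: le_trans kk'.
move=> i iN; have iN1 : (i.+1 < N)%N by case: N iN {dt DW}.
have [D1 _] := DW i (ltnW iN1); have [D2 eqn] := DW i.+1 iN1; have [h _] := dt i.+1 iN1.
rewrite -subr_gt0 in h; have [c [p [g [L [G [C Ag]]]]]] := euler_C2_neumann D1 D2 h eqn.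
exists (energy_const L G a C1), c, p, g, L, G; split => //.
move: Ag eqn; generalize (op_A (W i.+2)) => f Ag eqn.
apply: (ae_imp _ (ae_and Ag eqn)) => x [h1 h2] hx.
have := h2 hx; rewrite -(h1 hx) /euler opprK => /eqP.
by rewrite addr_eq0 => /eqP ->; rewrite opprK.
Qed.

Lemma time_gap (t x x' y y' c d T : R) : 0 < d -> d <= 1 -> y - y' <= d -> x - x' <= d ->
  y' < t -> t <= y -> x' < t -> t <= x -> 0 <= c -> c <= d -> y <= T -> x <= T ->
  (x - c - y) ^+ 2 + d * (x - c) + d * y <= d * (4 + 2 * T).
Proof.
move=> d0 d1 hy hx y't ty x't tx c0 cd yT xT.
have g : (x - c - y) ^+ 2 <= 4 * d.
  apply: (@le_trans _ _ ((2 * d) ^+ 2)); last by nra.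
  rewrite -ler_sqrt ?exprn_even_ge0// !sqrtr_sqr [leRHS]ger0_norm; last by lra.
  by rewrite ler_norml; apply/andP; split; lra.
have := ler_wpM2l (ltW d0) yT; have xcT : x - c <= T by lra.
have := ler_wpM2l (ltW d0) xcT.
lra.
Qed.

Section Convergence.
Context (J : R -> R) (r : R) (J_ge0 : forall z : R, 0 <= J z)
  (J_cont : continuous J) (J_sym : forall z : R, J (- z) = J z) (r_gt0 : 0 < r)
  (J_out : forall z : R, r <= `|z| -> J z = 0)
  (J_int : (\int[mu]_z (J z)%:E = 1)%E)
  (w0 : R -> R) (w0sq : sq2 w0) (weps : R -> R -> R -> R) (w : R -> R -> R)
  (weps_sol : forall eps : R, 0 < eps ->
     mild_solution (dom_B J 1 eps) (op_B J (2 / second_moment J) 1 eps) w0 (weps eps))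
  (w_sol : mild_solution dom_A op_A w0 w) (T : R) (T_gt0 : 0 < T).

Let dom_A_sq f : dom_A f -> sq2 f.
Proof. by move=> /dom_A_data[c [p [[]]]]. Qed.

(** The parameters are chosen in the order u, th, d, scheme for A, eps, scheme for B:
    K1 depends on u, and the bound E, from which eps is chosen, on the scheme for
    A. *)
Lemma mild_solutions_close tau : 0 < tau ->
  exists2 eps0, 0 < eps0 & forall eps, 0 < eps -> eps < eps0 ->
    forall t, 0 <= t -> t <= T -> dist2 (weps eps t) (w t) <= tau.
Proof.
move=> tau0; have T0 := T_gt0; pose B := 2 * dist2 w0 zero + 2.
have B2 : 2 <= B by have := dist2_ge0 w0 zero; rewrite /B; lra.
pose t1 := Num.min (tau / 82) 1.
have t10 : 0 < t1 by rewrite lt_min ltr01 divr_gt0.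
have t11 : t1 <= 1 by rewrite ge_min lexx orbT.
have t1tau : 82 * t1 <= tau by rewrite mulrC -ler_pdivlMr// ge_min lexx.
have B0 : 0 <= B by lra.
have near_bound f : sq2 f -> dist2 f w0 <= 1 -> dist2 f zero <= B.
  by move=> sf h; have := dist2_tri sf w0sq (@sq_zero R); rewrite /B; lra.
have [d0 d00 start] := scheme_start T_gt0 t10 dom_A_sq w0sq w_sol.
(* u is close to w0 and regular; every constant chosen later may depend on gu. *)
have [N1 [s1 [U [Us _ wU]]]] := mild_approximable dom_A_sq w0sq w_sol T_gt0 d00.
have [N1_gt1 _ uw0] := start _ _ _ _ d00 (lexx _) Us wU.
have [_ ds1 _ DU] := Us.
have [D1 _] := DU 0%N (ltnW N1_gt1); have [D2 eqn] := DU 1%N N1_gt1.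
have [h1 _] := ds1 1%N N1_gt1; rewrite -subr_gt0 in h1.
have [cu [pu [gu [Lu [Gu [Cu _]]]]]] := euler_C2_neumann D1 D2 h1 eqn.
have su : sq2 (U 2%N) by exact: dom_A_sq.
set u := U 2%N in uw0 Cu su *.
pose K1 := 1 + (dist2 gu zero + 4 * B) / 2.
have K10 : 0 < K1 by have := dist2_ge0 gu zero; rewrite /K1; lra.
pose th := t1 / (4 * K1); have th0 : 0 < th by rewrite divr_gt0// mulr_gt0.
pose q := t1 * th / (K1 * (4 + 2 * T)).
have T4 : 0 < 4 + 2 * T by lra.
have q0 : 0 < q by apply: divr_gt0; apply: mulr_gt0.
have dq0 : 0 < Num.min d0 q by rewrite lt_min d00.
have [d [d_gt0 d_le1 + dsq]] := small_squares t10 dq0.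
rewrite lt_min => /andP[dd0 dq]; have {}dsq := dsq d d_gt0 (lexx _);
(* Restarted at W 1, this scheme has regular iterates from the first step on. *)
have [N [tw [W [Ws W0 wW]]]] := mild_approximable dom_A_sq w0sq w_sol T_gt0 d_gt0.
have [N_gt1 W1 _] := start _ _ _ _ d_gt0 (ltW dd0) Ws wW.
pose C1 := 2 / second_moment J.
have [E0 WA0] := neumann_scheme_smooth (r ^+ 2) C1 Ws.
pose E := Num.max (Num.max E0 (energy_const Lu Gu (r ^+ 2) C1)) 0.
have E_ge0 : 0 <= E by rewrite le_max lexx orbT.
have Eu : energy_const Lu Gu (r ^+ 2) C1 <= E by rewrite !le_max lexx orbT.
(* eta = s k for s = sqrt eps. *)
pose k := E * r + 2 * B.
have k0 : 0 < k by rewrite ltr_wpDl ?mulr_ge0 ?(ltW r_gt0)//; lra.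
pose X := Num.min 1 (t1 / (2 * T)).
have X0 : 0 < X by rewrite lt_min ltr01 divr_gt0// mulr_gt0.
pose eps0 := Num.min 1 (Num.min (2 * r)^-1 ((X / k) ^+ 2)).
have Xk : 0 < X / k by rewrite divr_gt0.
exists eps0; first by rewrite !lt_min ltr01 invr_gt0 mulr_gt0//= exprn_gt0.
move=> eps eps_gt0; rewrite !lt_min => /and3P[eps1 epsr epsX] t t_ge0 tT.
(* The choice s = sqrt eps balances the two terms a / s and s of eta. *)
pose s := Num.sqrt eps; have s0 : 0 < s by rewrite sqrtr_gt0.
have s2 : s ^+ 2 = eps by rewrite sqr_sqrtr// ltW.
have s_le1 : s <= 1 by rewrite -(expr_le1 (n := 2))// ?s2 ltW.
have epsr1 : 2 * (r * eps) < 1.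
  by rewrite mulrA mulrC -ltr_pdivlMr ?mulr_gt0// div1r.
pose eta := E * (r * eps) / s + 2 * s * B.
have etaE : eta = s * k by rewrite /eta /k -s2; field; rewrite gt_eqF.
have eta0 : 0 <= eta by rewrite etaE mulr_ge0// ltW.
have etaX : eta <= X.
  rewrite etaE -ler_pdivlMr// -(ler_pXn2r (n := 2))// ?nnegrE ?(ltW s0)// ?(ltW Xk)//.
  by rewrite s2 ltW.
have eta1 : eta <= 1 by apply: (le_trans etaX); rewrite ge_min lexx.
have etaT : 2 * eta * T <= t1.
  have : eta <= t1 / (2 * T) by apply: (le_trans etaX); rewrite ge_min lexx orbT.
  by rewrite ler_pdivlMr ?mulr_gt0//; nra.
have sol := weps_sol eps_gt0.
have sv := mild_sq sol; have sw := mild_sq w_sol.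
have := t_ge0; rewrite le_eqVlt => /predU1P[<-|t_gt0].
  have := dist2_tri (sv 0 (lexx _)) w0sq (sw 0 (lexx _)).
  rewrite (mild_initial w0sq sol) (dist2C w0) (mild_initial w0sq w_sol).
  by rewrite !mulr0 addr0 => /le_trans; apply; exact: ltW.
have dBsq f : dom_B J 1 eps f -> sq2 f by exact: dom_B_sq.
have [M [tv [V [Vs V0 vV]]]] := mild_approximable dBsq w0sq sol T_gt0 d_gt0.
have [[tv0 tvM] dtv sV0 VB] := Vs; have [[tw0 twN] dtw sW0 DW] := Ws.
have tT' : 0 < t <= T by rewrite t_gt0.
(* V j.+1 and W i.+1 are the iterates that approximate the solutions at time t. *)
have [j jM tj] := locate tv0 tvM tT'; have [i iN ti] := locate tw0 twN tT'.
have sW1 : sq2 (W 1%N) by apply: dom_A_sq; have [] := DW 0%N (ltnW N_gt1).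
have V0B := near_bound _ sV0 (le_trans V0 (le_trans dsq t11)).
have W1B := near_bound _ sW1 (le_trans W1 t11).
have uB := near_bound _ su (le_trans uw0 t11).
have dtw1 i' : (i' < N.-1)%N -> tw i'.+1 - tw 1%N < tw i'.+2 - tw 1%N /\
    tw i'.+2 - tw 1%N - (tw i'.+1 - tw 1%N) <= d.
  move=> i'N; have /dtw[] : (i'.+1 < N)%N by case: (N) i'N.
  move=> h hd; split; first by rewrite ltrD2r.
  by rewrite (_ : _ - _ - _ = tw i'.+2 - tw i'.+1)//; ring.
have WA i' : (i' < N.-1)%N -> exists c p g L G,
    [/\ C2_neumann (W i'.+2) c p g L G, energy_const L G (r ^+ 2) C1 <= E &
     euler (W i'.+2) (W i'.+1) (tw i'.+2 - tw 1%N - (tw i'.+1 - tw 1%N)) =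
       (fun x => - g x) %[ae mu in `]-1, 1[%classic]].
  move=> /WA0[c [p [g [L [G [a1 a2 a3]]]]]]; exists c, p, g, L, G; split => //.
    by apply: (le_trans a2); rewrite !le_max lexx.
  by rewrite (_ : _ - _ - _ = tw i'.+2 - tw i'.+1)//; ring.
have iN1 : (i <= N.-1)%N by case: (N) iN.
have close := @schemes_close R J r eps s d eta E B J_ge0 J_cont J_sym r_gt0 J_out
  J_int eps_gt0 epsr1 s0 s_le1 erefl M N.-1 tv (fun i => tw i.+1 - tw 1%N) V
  (fun i => W i.+1) tv0 (subrr _) dtv dtw1 sV0 sW1 VB WA V0B W1B
  u cu pu gu Lu Gu Cu Eu uB th i j.+1 eta0 th0 iN1 jM.
have vV' := vV j t jM tj; have wW' := wW i t iN ti.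
have sVj : sq2 (V j.+1) by apply: dBsq; have [] := VB j jM.
have sWi : sq2 (W i.+1) by apply: dom_A_sq; have [] := DW i iN.
have Vu := dist2_tri sV0 w0sq su; rewrite (dist2C w0) in Vu.
have Wu := dist2_tri sW1 w0sq su; rewrite (dist2C w0) in Wu.
move: close; rewrite /=; set K := eta + _.
have KK : K <= K1 by rewrite /K /K1 lerD2r.
have K0 : 0 <= K by rewrite /K addr_ge0// divr_ge0// addr_ge0 ?dist2_ge0// mulr_ge0.
set x := tw i.+1 - tw 1%N; set y := tv j.+1 => close.
have [_ dj] := dtv j jM; have [_ di] := dtw i iN.
have [tw1 dtw0] := dtw 0%N (ltnW N_gt1); rewrite tw0 in tw1 dtw0.
have [/andP[tj1 tj2] /andP[ti1 ti2]] := (tj, ti).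
have yT : y <= T by rewrite -tvM; exact: (scheme_times Vs).
have XT : tw i.+1 <= T by rewrite -twN; exact: (scheme_times Ws).
rewrite subr0 in dtw0.
have F := time_gap d_gt0 d_le1 dj di tj1 tj2 ti1 ti2 (ltW tw1) dtw0 yT XT.
have F1 : K / th * ((x - y) ^+ 2 + d * x + d * y) <= t1.
  apply: (@le_trans _ _ (K1 / th * (d * (4 + 2 * T)))).
    apply: (@le_trans _ _ (K / th * (d * (4 + 2 * T)))).
      by rewrite ler_wpM2l// divr_ge0// ltW.
    by rewrite ler_wpM2r ?ler_wpM2r ?invr_ge0 ?(ltW th0)// mulr_ge0 ?(ltW d_gt0)// ltW.
  apply: (@le_trans _ _ (K1 / th * (q * (4 + 2 * T)))).
    by apply: ler_wpM2l; [apply: divr_ge0|apply: ler_wpM2r]; exact: ltW.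
  rewrite le_eqVlt; apply/orP; left; apply/eqP; rewrite /q; field.
  by rewrite !gt_eqF.
have F2 : 4 * K * th <= t1.
  apply: (@le_trans _ _ (4 * K1 * th)); first by rewrite ler_wpM2r ?(ltW th0)// ler_wpM2l.
  by rewrite le_eqVlt; apply/orP; left; apply/eqP; rewrite /th; field; rewrite gt_eqF.
have F3 : 2 * eta * y <= t1.
  by apply: le_trans etaT; rewrite ler_wpM2l// mulr_ge0.
have Z1 := dist2_tri (sv t t_ge0) sVj (sw t t_ge0).
have Z2 := dist2_tri sVj sWi (sw t t_ge0); rewrite (dist2C (W i.+1)) in Z2.
clear -Z1 Z2 close F1 F2 F3 Vu Wu V0 W1 uw0 dsq vV' wW' t1tau; lra.
Qed.

Lemma maxima_vanish : exists m : R -> \bar R,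
    (forall eps : R, 0 < eps ->
       is_max [set L2norm (-1) 1 (weps eps t \- w t) | t in `[0, T]] (m eps)) /\
    m eps @[eps --> 0^'+] --> 0%E.
Proof.
have ex eps : exists t : R, 0 < eps -> 0 <= t <= T /\
    is_max [set L2norm (-1) 1 (weps eps t \- w t) | t in `[0, T]]
      (Num.sqrt (dist2 (weps eps t) (w t)))%:E.
  have [eps0|eps0] := ltP 0 eps; last by exists 0; lra.
  have sol := weps_sol eps0.
  have [t tT mt] := maximum_of_dist2 T_gt0 (mild_sq sol) (mild_sq w_sol)
    (dist2_continuous T_gt0 (mild_sq sol) (mild_sq w_sol)
      (mild_continuous sol) (mild_continuous w_sol)).
  by exists t.
have [tm tmP] := choice ex.
exists (fun eps => (Num.sqrt (dist2 (weps eps (tm eps)) (w (tm eps))))%:E); split.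
  by move=> eps /tmP[].
apply: cvg_EFin; first by near=> eps.
apply/cvgrPdist_le => e e0.
have e2 : 0 < e ^+ 2 by rewrite exprn_gt0.
have [eps0 eps00 H] := mild_solutions_close e2.
near=> eps; rewrite /= sub0r normrN ger0_norm ?sqrtr_ge0//.
have eps_gt0 : 0 < eps by near: eps; exact: nbhs_right_gt.
have eps_lt : eps < eps0 by near: eps; exact: nbhs_right_lt.
have [/andP[t0 tT] _] := tmP eps eps_gt0.
by rewrite -[leRHS](ger0_norm (ltW e0)) -sqrtr_sqr; exact/ler_wsqrtr/H.
Unshelve. all: by end_near.
Qed.

End Convergence.

End Mild.

(** * Convergence *)

Theorem theorem1p3 (R : realType) (J : R -> R) (r : R)
    (J_ge0 : forall z, 0 <= J z)
    (J_cont : continuous J)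
    (J_sym : forall z, J (- z) = J z)
    (r_gt0 : 0 < r)
    (J_supp : closure [set z | J z != 0] = `[- r, r]%classic)
    (J_int : (\int[@lebesgue_measure R]_z (J z)%:E = 1)%E)
    (w0 : R -> R) (w0_L2 : L2 (-1) 1 w0)
    (weps : R -> R -> R -> R) (w : R -> R -> R)
    (weps_sol : forall eps : R, 0 < eps ->
       mild_solution (dom_B J 1 eps) (op_B J (2 / second_moment J) 1 eps)
         w0 (weps eps))
    (w_sol : mild_solution dom_A op_A w0 w)
    (T : R) (T_gt0 : 0 < T) :
  exists m : R -> \bar R,
    (forall eps : R, 0 < eps ->
       is_max [set L2norm (-1) 1 (weps eps t \- w t) | t in `[0, T]] (m eps)) /\
    m eps @[eps --> 0^'+] --> 0%E.
Proof.
have r1_gt0 : 0 < r + 1 by rewrite addr_gt0.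
(* The larger radius avoids a discussion of J at the endpoints of its support. *)
have J_out z : r + 1 <= `|z| -> J z = 0.
  move=> rz; apply: contrapT => /eqP Jz.
  have : `[- r, r]%classic z by rewrite -J_supp; exact: subset_closure.
  rewrite /= in_itv/= -ler_norml => /(le_trans rz).
  by rewrite gerDl ler10.
exact: (maxima_vanish J_ge0 J_cont J_sym r1_gt0 J_out J_int
  ((L2P _ _ _).1 w0_L2) weps_sol w_sol T_gt0).
Qed.
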